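(* Let $E$ be a pseudo-algebraically closed field of characteristic different from $2$. Then $E$ is square-reflexive. In particular, $u(E(X))\leq 4$ and quadratic forms over $E(X)$ satisfy the local-global principle for isotropy with respect to $\Omega_{E(X)/E}$; that is, every anisotropic quadratic form over $E(X)$ remains anisotropic over the completion $E(X)_v$ for some $v\in\Omega_{E(X)/E}$.
   Context: $E$ is pseudo-algebraically closed if every absolutely irreducible curve over $E$ has an $E$-rational point. $E(X)$ is the rational function field in one variable over $E$. $\Omega_{E(X)/E}$ is the set of all valuations $v$ on $E(X)$ with value group $\mathbb{Z}$ such that $v(E^\times)=0$; $E(X)_v$ is the completion of $E(X)$ with respect to $v$. Quadratic forms (in the statement) are regular (nondegenerate); a form is isotropic if it has a nontrivial zero, and anisotropic otherwise. For a field $F$ of characteristic different from $2$, $u(F)\in\mathbb{N}\cup\{\infty\}$ is the supremum of the dimensions of anisotropic quadratic forms over $F$. Square-reflexivity. For a commutative ring $R$ let $R^\times$ be its group of units and $R^{\times 2}=\{x^2\mid x\in R^\times\}$; an element of $R$ is square-free if it is not equal to $x^2y$ for any $x\in R\setminus R^\times$ and $y\in R$. For a nonzero $f\in E[X]$ put $E_f=E[X]/(f)$, let $\mathrm{N}_{E_f/E}:E_f\to E$ be the norm of this finite-dimensional $E$-algebra and let $\mathrm{lc}(f)$ be the leading coefficient of $f$. A square-free polynomial $f\in E[X]\setminus\{0\}$ is called square-reflexive if for every $\alpha\in E_f^\times$ with $\mathrm{N}_{E_f/E}(\alpha)\in E^{\times 2}\cup \mathrm{lc}(f)E^{\times 2}$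 there exists a polynomial $g\in E[X]$ coprime to $f$ such that $g+(f)\in\alpha E_f^{\times 2}$ and $f+(g)\in E_g^{\times 2}$. The field $E$ is called square-reflexive if every square-free polynomial in $E[X]$ is square-reflexive. *)

(* Defs.v *)
From HB Require Import structures.
From mathcomp Require Import all_boot all_order all_algebra.
From mathcomp Require Import mpoly.

Set Implicit Arguments.
Unset Strict Implicit.
Unset Printing Implicit Defensive.

Import Order.TTheory GRing.Theory Num.Theory.
Local Open Scope ring_scope.

Definition in_ideal (R : comNzRingType) (s : seq R) (x : R) : Prop :=
  exists c : nat -> R, x = \sum_(i < size s) c i * s`_i.

Definition prime_ideal (R : comNzRingType) (I : R -> Prop) : Prop :=
  ~ I 1 /\ forall x y, I (x * y) -> I x \/ I y.

Definition algebraic_closure (E : fieldType) (L : closedFieldType)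
    (iota : {rmorphism E -> L}) : Prop :=
  forall x : L, algebraicOver iota x.

(* By the Hilbert basis theorem every closed subscheme of affine n-space over E
   is given by a finite list s of equations.  It is absolutely irreducible (as a
   variety, i.e. geometrically integral) when the ideal generated by s over the
   algebraic closure of E is prime; the closure is unique up to isomorphism, so
   the choice of L is immaterial. *)
Definition absolutely_irreducible (E : fieldType) (n : nat)
    (s : seq {mpoly E[n]}) : Prop :=
  forall (L : closedFieldType) (iota : {rmorphism E -> L}),
    algebraic_closure iota ->
    prime_ideal (in_ideal [seq map_mpoly iota p | p <- s]).

(* The classes of the t_i in the coordinate ring E[X_1..X_n]/(s) are
   algebraically independent over E. *)
Definition alg_independent_mod (E : fieldType) (n : nat)
    (s : seq {mpoly E[n]}) (k : nat) (t : k.-tuple {mpoly E[n]}) : Prop :=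
  forall q : {mpoly E[k]}, in_ideal s (q \mPo t) -> q = 0.

(* Dimension of an integral affine variety, as the transcendence degree over E
   of its coordinate ring. *)
Definition has_dimension (E : fieldType) (n : nat)
    (s : seq {mpoly E[n]}) (d : nat) : Prop :=
  (exists t : d.-tuple {mpoly E[n]}, alg_independent_mod s t) /\
  (forall t : d.+1.-tuple {mpoly E[n]}, ~ alg_independent_mod s t).

Definition has_rational_point (E : fieldType) (n : nat)
    (s : seq {mpoly E[n]}) : Prop :=
  exists a : 'I_n -> E, forall p, p \in s -> p.@[a] = 0.

(* Affine curves suffice: a nonempty affine open subscheme of an absolutely
   irreducible curve is again an absolutely irreducible curve. *)
Definition pseudo_algebraically_closed (E : fieldType) : Prop :=
  forall (n : nat) (s : seq {mpoly E[n]}),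
    absolutely_irreducible s -> has_dimension s 1 -> has_rational_point s.

(* 0 = 0^2 * 1 is not square-free. *)
Definition square_free (R : comUnitRingType) (r : R) : Prop :=
  forall x y : R, r = x ^+ 2 * y -> x \is a GRing.unit.

Section QuotientAlgebra.
Variable E : fieldType.
Implicit Types f g a b : {poly E}.

(* Elements of E_f = E[X]/(f) are represented by polynomials, compared modulo f.
   The library type {poly %/ f} denotes E[X]/(f) only when f is monic and not
   constant, whereas f ranges here over all nonzero polynomials. *)
Definition eq_mod f a b : Prop := f %| a - b.

Definition unit_mod f a : Prop := exists b, eq_mod f (a * b) 1.

(* The class of b lies in a * (E_f^x)^2. *)
Definition in_square_class_mod f a b : Prop :=
  exists2 c, unit_mod f c & eq_mod f b (a * c ^+ 2).

(* Norm of the class of a: determinant of multiplication by a on E_f in the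
   basis 1, X, .., X^(deg f - 1).  For constant f, E_f = 0 and the norm is 1. *)
Definition norm_mod f a : E :=
  \det (\matrix_(i < (size f).-1, j < (size f).-1) ((a * 'X^i) %% f)`_j).

Definition square_reflexive_poly f : Prop :=
  forall a, unit_mod f a ->
    (exists2 c : E, c != 0 &
       norm_mod f a = c ^+ 2 \/ norm_mod f a = lead_coef f * c ^+ 2) ->
    exists g, [/\ coprimep g f,
                  in_square_class_mod f a g
                & in_square_class_mod g 1 f].

End QuotientAlgebra.

Definition square_reflexive (E : fieldType) : Prop :=
  forall f : {poly E}, square_free f -> square_reflexive_poly f.

(* Over a field of characteristic different from 2, an n-dimensional quadratic
   form is given by its symmetric Gram matrix A: q(x) = x A x^T.  It is regular
   when A is invertible. *)
Definition regular_form (F : fieldType) (n : nat) (A : 'M[F]_n) : Prop :=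
  A^T = A /\ A \in unitmx.

Definition isotropic (F : fieldType) (n : nat) (A : 'M[F]_n) : Prop :=
  exists2 x : 'rV[F]_n, x != 0 & x *m A *m x^T = 0.

Definition anisotropic (F : fieldType) (n : nat) (A : 'M[F]_n) : Prop :=
  ~ isotropic A.

(* u(F) <= m, where u(F) is the supremum in N u {oo} of the dimensions of the
   anisotropic quadratic forms over F. *)
Definition u_invariant_le (F : fieldType) (m : nat) : Prop :=
  forall (n : nat) (A : 'M[F]_n),
    regular_form A -> anisotropic A -> (n <= m)%N.

(* v(x) >= m, with the convention v(0) = oo.  Valuations are given as
   functions to int whose value at 0 is irrelevant. *)
Definition val_ge (F : fieldType) (v : F -> int) (m : int) (x : F) : bool :=
  (x == 0) || (m <= v x).

Definition Z_valuation (F : fieldType) (v : F -> int) : Prop :=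
  [/\ forall x y, x != 0 -> y != 0 -> v (x * y) = v x + v y,
      forall m x y, val_ge v m x -> val_ge v m y -> val_ge v m (x + y)
    & forall m : int, exists2 x, x != 0 & v x = m].

Definition cauchy_seq (F : fieldType) (v : F -> int) (s : nat -> F) : Prop :=
  forall m : int, exists N : nat,
    forall i j : nat, (N <= i)%N -> (N <= j)%N -> val_ge v m (s i - s j).

Definition converges (F : fieldType) (v : F -> int) (s : nat -> F) (l : F) :
    Prop :=
  forall m : int, exists N : nat,
    forall i : nat, (N <= i)%N -> val_ge v m (s i - l).

(* A completion exists and is unique up to a unique isomorphism. *)
Definition is_completion (F : fieldType) (v : F -> int)
    (K : fieldType) (w : K -> int) (iota : {rmorphism F -> K}) : Prop :=
  [/\ Z_valuation w,
      forall x, x != 0 -> w (iota x) = v x,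
      forall (m : int) (y : K), exists x : F, val_ge w m (y - iota x)
    & forall s, cauchy_seq w s -> exists l, converges w s l].

Definition Omega (E : fieldType) (v : {fraction {poly E}} -> int) : Prop :=
  Z_valuation v /\ forall c : E, c != 0 -> v (tofrac c%:P) = 0.

Definition local_global_isotropy (E : fieldType) : Prop :=
  forall (n : nat) (A : 'M[{fraction {poly E}}]_n),
    regular_form A -> anisotropic A ->
    exists2 v : {fraction {poly E}} -> int, Omega v &
    exists (K : fieldType) (w : K -> int)
           (iota : {rmorphism {fraction {poly E}} -> K}),
      is_completion v w iota /\ anisotropic (map_mx iota A).

(* Main.v *)
Require Import Defs.
From mathcomp Require Import all_boot all_order all_algebra.
From HB Require Import structures.
From mathcomp Require Import all_field.
From mathcomp Require Import mpoly ring lra zify boolp generic_quotient.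
Set Implicit Arguments. Unset Strict Implicit. Unset Printing Implicit Defensive.
Import Order.TTheory GRing.Theory Num.Theory.
Local Open Scope ring_scope.

(** Throughout, E is pseudo-algebraically closed of characteristic different from 2.
    All of its arithmetic comes from rational points on curves of Kummer type.  Let f be
    monic and separable and P a polynomial in X over E[T].  The polynomials z of degree less
    than deg f with z^2 = P(X, t) modulo f are the points of a curve: over an extension L of E
    that contains the roots e of f, the coefficients of z may be exchanged for the values
    z(e), which are square roots of the functions P(e, T) on the line.  If no product of
    distinct P(e, T) is a square in L(T), these square roots generate a Kummer tower over
    L(T) in which their products are linearly independent, so the coordinate ring is a
    subring of a field.  The curve is then absolutely irreducible and of dimension one and
    has a rational point ([kummer_curve_point]).  Two choices of P are used.
    A square-free polynomial of positive degree takes square values ([square_value]), and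
    every unit class modulo f, up to squares, is the class of some t - X with t in E
    ([square_class_value]); in both, t can avoid finitely many points.  If f is inseparable,
    the second statement is reduced to separable f by Frobenius maps of odd degree q.

    Square reflexivity follows because N(t - X) = f(t) / lc f: if t - X is in the class of
    alpha, the hypothesis on N(alpha) says that f(t) is a square, or lc f times a square.  In
    the first case g = t - X will do, and the second is reduced to it with another linear
    factor ([square_reflexive_pac]).

    For quadratic forms, [square_class_value] shows that conics over E and over its finite
    extensions are isotropic, so Legendre's theorem on ternary forms over E(X) holds by the
    classical descent; a Moebius transformation shows that one rational place may be ignored
    in it ([legendre_at]).  The decisive step is [linking].  Suppose that <a1,a2> and the
    negative of another form s have a common value in every completion.  At the finitely many
    primes dividing a coefficient, [square_class_value] provides a polynomial g with the
    classes of such values there, and with a single uncontrolled zero t.  Then <a1,a2,-g> is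
    isotropic by [legendre_at], and g together with s is a form of one dimension less to
    which the principle can be applied, provided that the place at infinity, where g is not
    controlled either, does no harm.  For a quaternary form with non-constant discriminant
    this is achieved by moving to infinity a point at which the discriminant is a square
    ([quaternary_nonconstant]); constant discriminants are treated over E(sqrt u), where a
    ternary subform decides ([quaternary_descent]).  The same step, with the quaternary case
    as input, shows that all quinary forms are isotropic, their local isotropy being
    automatic ([quinary_isotropic]); hence u(E(X)) <= 4.  Dimensions at most two are direct,
    and general forms are diagonalised.

    Completions are constructed only to pass from approximate local zeros to exact ones and
    back; local isotropy itself is formulated inside E(X) ([locally_isotropic]). *)

(** * Fields of fractions *)

Lemma sub_frac (K : fieldType) (a b c d : K) : b != 0 -> d != 0 ->
  a / b - c / d = (a * d - c * b) / (b * d).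
Proof. by move=> b0 d0; field; rewrite d0 b0. Qed.

(** F is the field of fractions of R along emb. Arguments about E(X) are carried
    out in this form, which keeps the construction of fractions out of sight. *)
Definition fraction_field (R : idomainType) (F : fieldType) (emb : {rmorphism R -> F}) :=
  injective emb /\ forall x, exists a b, b != 0 /\ x = emb a / emb b.

Lemma frac_quotient (R : idomainType) (x : {fraction R}) :
  exists a b : R, b != 0 /\ x = tofrac a / tofrac b.
Proof.
elim/quotW: x => y; exists \n_y, \d_y; split; first exact: denom_ratioP.
apply: (canRL (mulfK _)); first by rewrite tofrac_eq0 denom_ratioP.
rewrite -[LHS]/(FracField.mul _ _) !piE /FracField.mulf.
apply/eqmodP; rewrite /= FracField.equivfE /=.
rewrite !numden_Ratio ?oner_eq0 ?mulf_neq0 ?denom_ratioP ?oner_neq0 //.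
by rewrite !mulr1 mulrC.
Qed.

Lemma tofrac_fraction_field (R : idomainType) : fraction_field (@tofrac R).
Proof.
split; last exact: frac_quotient.
by move=> a b /eqP; rewrite tofrac_eq => /eqP.
Qed.

Section FractionLift.
Variables (R : idomainType) (F : fieldType) (emb : {rmorphism R -> F}).
Hypothesis frF : fraction_field emb.
Variables (K : fieldType) (phi : {rmorphism R -> K}).
Hypothesis phi_inj : injective phi.

Let lift (x : F) : K :=
  phi (sval (cid (frF.2 x))) / phi (sval (cid (svalP (cid (frF.2 x))))).

Let phi_eq0 a : (phi a == 0) = (a == 0).
Proof. by rewrite -(rmorph0 phi) (inj_eq phi_inj). Qed.

Lemma emb_eq0 a : (emb a == 0) = (a == 0).
Proof. by rewrite -(rmorph0 emb) (inj_eq frF.1). Qed.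

Let liftE a b : b != 0 -> lift (emb a / emb b) = phi a / phi b.
Proof.
move=> b0; rewrite /lift; case: cid => a' /= ex; case: cid => b' /= [b'0].
move/eqP; rewrite eqr_div ?emb_eq0 // -!rmorphM (inj_eq frF.1) => /eqP e.
by apply/eqP; rewrite eqr_div ?phi_eq0 // -!rmorphM e.
Qed.

Lemma fraction_field_lift :
  exists psi : {rmorphism F -> K}, forall a, psi (emb a) = phi a.
Proof.
have l1 a : lift (emb a) = phi a.
  by rewrite -[emb a]divr1 -(rmorph1 emb) liftE ?oner_eq0 // rmorph1 divr1.
have lz : zmod_morphism lift.
  move=> x y; have [a [b [b0 ->]]] := frF.2 x.
  have [c [d [d0 ->]]] := frF.2 y.
  have e : emb a / emb b - emb c / emb d = emb (a * d - c * b) / emb (b * d).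
    by rewrite rmorphB !rmorphM sub_frac // emb_eq0.
  rewrite e !liftE ?mulf_neq0 // rmorphB !rmorphM.
  by rewrite sub_frac // phi_eq0.
have lm : monoid_morphism lift.
  split; first by rewrite -(rmorph1 emb) l1 rmorph1.
  move=> x y; have [a [b [b0 ->]]] := frF.2 x.
  have [c [d [d0 ->]]] := frF.2 y.
  by rewrite mulf_div -!rmorphM !liftE ?mulf_neq0 // !rmorphM mulf_div.
pose A := GRing.isZmodMorphism.Build _ _ lift lz.
pose M := GRing.isMonoidMorphism.Build _ _ lift lm.
pose L : {rmorphism F -> K} := HB.pack lift A M.
by exists L.
Qed.

Lemma fraction_field_ext (f g : {rmorphism F -> K}) :
  (forall a, f (emb a) = g (emb a)) -> f =1 g.
Proof.
by move=> e x; have [a [b [_ ->]]] := frF.2 x; rewrite !fmorph_div !e.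
Qed.

End FractionLift.

Lemma frac_lift (R : idomainType) (K : fieldType) (phi : {rmorphism R -> K}) :
  injective phi ->
  exists psi : {rmorphism {fraction R} -> K}, forall a, psi (tofrac a) = phi a.
Proof. exact: fraction_field_lift (tofrac_fraction_field R) _ _. Qed.

(** * Kummer towers of square roots *)

Definition nonsquare (F : fieldType) (c : F) := forall x : F, x ^+ 2 <> c.

Definition square_independent (F : fieldType) (s : seq F) :=
  forall m : bitseq, size m = size s -> has id m ->
  nonsquare (\prod_(a <- mask m s) a).

(** An element of an algebra over R with basis the products of distinct z_0, ..,
    z_(d-1): its 2^d coordinates are the leaves of a binary tree, which branches on
    z_0 at the root. *)
Fixpoint ktree (R : Type) (d : nat) : Type :=
  if d is d'.+1 then (ktree R d' * ktree R d')%type else R.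

Fixpoint kmap2 (R S T : Type) (g : R -> S -> T) d :
    ktree R d -> ktree S d -> ktree T d :=
  match d with
  | 0 => g
  | d'.+1 => fun a b => (kmap2 g a.1 b.1, kmap2 g a.2 b.2)
  end.

Fixpoint kall (R : Type) (P : R -> Prop) d : ktree R d -> Prop :=
  match d with
  | 0 => P
  | d'.+1 => fun c => kall P c.1 /\ kall P c.2
  end.

Fixpoint keval (R : Type) (K : pzRingType) (phi : R -> K) (z : nat -> K) d :
    ktree R d -> K :=
  match d with
  | 0 => phi
  | d'.+1 => fun c => keval phi (z \o S) c.1 + keval phi (z \o S) c.2 * z 0%N
  end.

Lemma sqrt_independent (F K : fieldType) (j : {rmorphism F -> K}) (a : F) (r : K) :
  r ^+ 2 = j a -> nonsquare a ->
  forall u v, j u + j v * r = 0 -> u = 0 /\ v = 0.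
Proof.
move=> r2 nsq u v e; have [v0|v0] := eqVneq v 0.
  by move: e; rewrite v0 rmorph0 mul0r addr0 => /eqP; rewrite fmorph_eq0 => /eqP.
have jv0 : j v != 0 by rewrite fmorph_eq0.
case: (nsq (u / v)); apply: (fmorph_inj j).
rewrite rmorphXn fmorph_div -r2.
have -> : j u = - (j v * r) by apply/eqP; rewrite -addr_eq0 e.
by rewrite mulNr sqrrN mulrAC divff // mul1r.
Qed.

Lemma square_in_quadratic_extension (F : fieldType) (K : fieldType)
    (j : {rmorphism F -> K}) (a : F) (r : K) :
    2%:R != 0 :> F -> r ^+ 2 = j a -> nonsquare a ->
    forall c x y, (j x + j y * r) ^+ 2 = j c -> exists b, b ^+ 2 = c \/ b ^+ 2 = a * c.
Proof.
move=> two_neq0 r2 nsq c x y.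
have indep := sqrt_independent r2 nsq.
move=> e; have [] := indep (x ^+ 2 + y ^+ 2 * a - c) (2%:R * x * y).
  transitivity ((j x + j y * r) ^+ 2 - j c); last by rewrite e subrr.
  have -> : (j x + j y * r) ^+ 2 = j x ^+ 2 + j y ^+ 2 * j a + 2%:R * j x * j y * r.
    rewrite -r2; ring.
  rewrite !(rmorphB, rmorphD, rmorphM) /= ?rmorphXn ?rmorph_nat /=; ring.
move=> e1 /eqP; rewrite !mulf_eq0 (negPf two_neq0) /= => /orP[] /eqP v0.
  exists (y * a); right; move/eqP: e1; rewrite v0 expr0n /= add0r subr_eq0 => /eqP <-; ring.
exists x; left; move/eqP: e1; rewrite v0 expr0n /= mul0r addr0 subr_eq0 => /eqP <-; ring.
Qed.

(** Elements of a quadratic extension F(r) all have the form x + y r; the tower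
    below is generated by such elements, which is why it suffices to know squares there. *)
Lemma adjoin_sqrt (F : fieldType) (a : F) : nonsquare a ->
  exists (K : fieldType) (j : {rmorphism F -> K}) (r : K),
    r ^+ 2 = j a /\ forall z, exists x y, z = j x + j y * r.
Proof.
move=> nsq; pose p : {poly F} := 'X^2 - a%:P.
have sp : size p = 3 by rewrite size_XnsubC.
have irr : irreducible_poly p.
  apply: cubic_irreducible; first by rewrite sp.
  move=> x; apply/negP=> /rootP; rewrite /p !hornerE => /eqP.
  by rewrite subr_eq0 => /eqP; apply: nsq.
have [L dimL [z rz gen]] := irredp_FAdjoin irr.
exists L, (in_alg L), z; split.
  move: rz; rewrite /root /p rmorphB /= map_polyXn map_polyC /= !hornerE.
  by rewrite subr_eq0 => /eqP.
move=> w; have /Fadjoin_polyP[q qo ->] : w \in <<1; z>>%VS by rewrite gen memvf.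
have /polyOver1P[q' ->] := qo.
have : (size (q' %% p)%R <= 2)%N.
  by have := ltn_modp q' p; rewrite -[p != 0]negbK -size_poly_eq0 sp /= ltnS => ->.
rewrite [X in (map_poly _ X)](divp_eq q' p) => s2.
exists (q' %% p)`_0, (q' %% p)`_1.
rewrite rmorphD rmorphM /= hornerD hornerM (rootP rz) mulr0 add0r.
rewrite (@horner_coef_wide _ 2); last by rewrite size_map_poly.
by rewrite !big_ord_recl big_ord0 !coef_map /= expr0 expr1 mulr1 addr0.
Qed.

(** If no product of distinct members of [s] is a square in F, then a field
    obtained by adjoining one square root z_i of each member has the products
    of distinct z_i as a basis over F.  The induction peels off the head a of
    [s]: in F(sqrt a) an element c of F is a square only if c or a * c already
    is one in F, so the hypothesis passes to the tail. *)
Lemma kummer_tower (F : fieldType) (s : seq F) d : size s = d ->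
  2%:R != 0 :> F -> square_independent s ->
  exists (K : fieldType) (phi : {rmorphism F -> K}) (z : nat -> K),
    (forall i, (i < d)%N -> z i ^+ 2 = phi s`_i) /\
    forall c : ktree F d, keval phi z c = 0 -> kall (eq^~ 0) c.
Proof.
elim: d F s => [|d IH] F s.
  by move=> _ _ _; exists F, idfun, (fun=> 0); split.
case: s => [//|a s] [ds] two ind.
have nsa : nonsquare a.
  have := ind (true :: nseq (size s) false).
  by rewrite /= size_nseq mask_false big_seq1; apply.
have [F1 [j [r [r2 gen]]]] := adjoin_sqrt nsa.
have [|||K [psi [z [z2 zi]]]] := IH F1 (map j s).
- by rewrite size_map.
- by rewrite -(rmorph_nat j) fmorph_eq0.
- move=> m sm hm x; rewrite -map_mask big_map -rmorph_prod /= => ex.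
  rewrite size_map in sm.
  have [u [v xe]] := gen x; rewrite xe in ex.
  have [b [eb|eb]] := square_in_quadratic_extension two r2 nsa ex.
    by apply: (ind (false :: m) _ _ b); rewrite //= sm.
  by apply: (ind (true :: m) _ _ b); rewrite //= ?sm ?big_cons.
pose z' i := if i is i'.+1 then z i' else psi r.
exists K, (psi \o j : {rmorphism F -> K}), z'; split.
  case=> [|i] /=; first by rewrite -rmorphXn r2.
  by rewrite ltnS => hi; rewrite z2 // (nth_map 0) ?ds.
have indep u v : j u + j v * r = 0 -> u = 0 /\ v = 0.
  by move=> e; have := sqrt_independent r2 nsa e.
have merge n (w : nat -> K) (A B : ktree F n) :
    keval (psi \o j) w A + keval (psi \o j) w B * psi r =
    keval psi w (kmap2 (fun x y => j x + j y * r) A B).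
  elim: n w A B => [|n IHd] w A B /=; first by rewrite -rmorphM -rmorphD.
  by rewrite -!IHd; ring.
have split_leaves n (A B : ktree F n) :
    kall (eq^~ 0) (kmap2 (fun x y => j x + j y * r) A B) ->
    kall (eq^~ 0) A /\ kall (eq^~ 0) B.
  elim: n A B => [|n IHd] A B /=; first exact: indep.
  by case=> /IHd[? ?] /IHd[? ?].
have ez : z' \o S = z by [].
by case=> A B /=; rewrite ez merge => /zi/split_leaves.
Qed.

(** * Ideals and normal forms in Kummer towers *)

Section Ideals.
Variable R : comNzRingType.
Implicit Types (s : seq R) (x y : R).

Lemma in_ideal0 s : in_ideal s 0.
Proof. by exists (fun=> 0); rewrite big1 // => i _; rewrite mul0r. Qed.

Lemma in_idealD s x y : in_ideal s x -> in_ideal s y -> in_ideal s (x + y).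
Proof.
move=> [a ->] [b ->]; exists (fun i => a i + b i).
by rewrite -big_split; apply: eq_bigr => i _; rewrite mulrDl.
Qed.

Lemma in_idealM s a x : in_ideal s x -> in_ideal s (a * x).
Proof.
move=> [c ->]; exists (fun i => a * c i).
by rewrite mulr_sumr; apply: eq_bigr => i _; rewrite mulrA.
Qed.

Lemma in_idealB s x y : in_ideal s x -> in_ideal s y -> in_ideal s (x - y).
Proof. by move=> hx hy; rewrite -mulN1r; apply/in_idealD/in_idealM. Qed.

Lemma in_ideal_sum s I (r : seq I) (F : I -> R) :
  (forall i, in_ideal s (F i)) -> in_ideal s (\sum_(i <- r) F i).
Proof.
by move=> h; elim/big_ind: _ => //; [exact: in_ideal0 | exact: in_idealD].
Qed.

Lemma mem_in_ideal s x : x \in s -> in_ideal s x.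
Proof.
move=> xs; exists (fun i => (i == index x s)%:R).
have lt : (index x s < size s)%N by rewrite index_mem.
rewrite (bigD1 (Ordinal lt)) //= eqxx mul1r nth_index // big1 ?addr0 //.
by move=> i /negPf ne; rewrite -val_eqE /= in ne; rewrite ne mul0r.
Qed.

Lemma in_ideal_vanish s x : in_ideal s x ->
  forall (S : comNzRingType) (f : {rmorphism R -> S}),
  (forall y, y \in s -> f y = 0) -> f x = 0.
Proof.
move=> [c ->] S f h; rewrite rmorph_sum big1 // => i _.
by rewrite rmorphM (h s`_i) ?mulr0 // mem_nth.
Qed.

End Ideals.

(* Below, [ev] and [z] present a ring M over a ring R by square roots [z i] of
   elements of R, modulo an ideal of M. *)
Section NormalForm.
Variables (R M : comNzRingType) (s : seq M) (ev : {rmorphism R -> M}).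

Lemma keval_add (z : nat -> M) d (b c : ktree R d) :
  keval ev z (kmap2 +%R b c) = keval ev z b + keval ev z c.
Proof.
elim: d z b c => [|d IH] z b c /=; first exact: rmorphD.
by rewrite !IH; ring.
Qed.

Lemma keval_scale (a : R) (z : nat -> M) d (c : ktree R d) :
  keval ev z (kmap2 (fun _ => *%R a) c c) = ev a * keval ev z c.
Proof.
elim: d z c => [|d IH] z c /=; first exact: rmorphM.
by rewrite !IH; ring.
Qed.

Lemma keval0 (z : nat -> M) d (c : ktree R d) :
  kall (eq^~ 0) c -> keval ev z c = 0.
Proof.
elim: d z c => [|d IH] z c /=; first by move=> ->; rewrite rmorph0.
by case=> /(IH (z \o S)) -> /(IH (z \o S)) ->; rewrite mul0r addr0.
Qed.

(** Modulo z_i^2 = a_i, multiplication by z_i exchanges the two subtrees at each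
    node of level i, one of them being multiplied by a_i. *)
Lemma keval_mul_root (z : nat -> M) (a : nat -> R) d i (c : ktree R d) :
  (forall j, (j < d)%N -> in_ideal s (z j ^+ 2 - ev (a j))) -> (i < d)%N ->
  exists c' : ktree R d, in_ideal s (z i * keval ev z c - keval ev z c').
Proof.
elim: d i z a c => [//|d IH] [|i] z a [A B] hz /= lt.
  exists (kmap2 (fun _ => *%R (a 0%N)) B B, A) => /=; rewrite keval_scale.
  set A' := keval _ _ A; set B' := keval _ _ B.
  have -> : z 0%N * (A' + B' * z 0%N) - (ev (a 0%N) * B' + A' * z 0%N) =
    B' * (z 0%N ^+ 2 - ev (a 0%N)) by ring.
  exact/in_idealM/hz.
have hz' j : (j < d)%N -> in_ideal s ((z \o S) j ^+ 2 - ev ((a \o S) j)).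
  by move=> hj; apply: hz.
have [A' hA] := IH i _ _ A hz' lt; have [B' hB] := IH i _ _ B hz' lt.
exists (A', B') => /=; move: hA hB => /=.
set u := keval _ _ A; set v := keval _ _ B.
set u' := keval _ _ A'; set v' := keval _ _ B' => hA hB.
have -> : z i.+1 * (u + v * z 0%N) - (u' + v' * z 0%N) =
   (z i.+1 * u - u') + z 0%N * (z i.+1 * v - v') by ring.
exact/in_idealD/in_idealM.
Qed.

End NormalForm.

Lemma keval_morph (R M K : comNzRingType) (ev : R -> M) (g : {rmorphism M -> K})
    (z : nat -> M) d (c : ktree R d) :
  g (keval ev z c) = keval (g \o ev) (g \o z) c.
Proof.
elim: d z c => [|d IH] z c //=; rewrite rmorphD rmorphM !IH //.
Qed.

Lemma keval_leaves (R S K : comNzRingType) (p : S -> K) (g : R -> S)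
    (z : nat -> K) d (c : ktree R d) :
  keval (p \o g) z c = keval p z (kmap2 (fun _ => g) c c).
Proof. by elim: d z c => [|d IH] z c //=; rewrite !IH. Qed.

Lemma kall_leaves (R S : Type) (P : S -> Prop) (g : R -> S) d (c : ktree R d) :
  kall P (kmap2 (fun _ => g) c c) -> kall (P \o g) c.
Proof. by elim: d c => [|d IH] c //= [/IH ? /IH ?]. Qed.

Lemma lagrange_basis (L : fieldType) (es : seq L) : uniq es ->
  exists l : nat -> {poly L}, forall j, (j < size es)%N ->
    (size (l j) <= size es)%N /\
    forall k, (k < size es)%N -> (l j).[es`_k] = (k == j)%:R.
Proof.
move=> ue.
pose q j := \prod_(e <- es | e != es`_j) ('X - e%:P).
exists (fun j => (q j).[es`_j]^-1 *: q j) => j hj.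
have root_q k : (k < size es)%N -> k != j -> (q j).[es`_k] = 0.
  move=> hk kj; apply/rootP; rewrite /q -big_filter root_prod_XsubC mem_filter.
  by rewrite nth_uniq // kj mem_nth.
have qj : (q j).[es`_j] != 0.
  rewrite -[_ == _]/(root _ _) /q -big_filter root_prod_XsubC mem_filter.
  by rewrite eqxx.
split.
  rewrite (leq_trans (size_scale_leq _ _)) // /q -big_filter size_prod_XsubC.
  rewrite size_filter -(count_predC (pred1 es`_j) es) /=.
  rewrite [X in (_ <= X + _)%N](_ : _ = 1%N); last first.
    by rewrite (count_uniq_mem _ ue) mem_nth.
  by rewrite add1n.
move=> k hk; rewrite hornerZ; have [->|kj] := eqVneq k j.
  by rewrite mulVf.
by rewrite (root_q k) ?mulr0.
Qed.

(** Both sides have degree < size es and agree at the points of es. *)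
Lemma lagrange_expand (L : fieldType) (S : idomainType) (j : {rmorphism L -> S})
    (es : seq L) (l : nat -> {poly L}) (G : {poly S}) : uniq es ->
  (forall i, (i < size es)%N -> (size (l i) <= size es)%N /\
    forall k, (k < size es)%N -> (l i).[es`_k] = (k == i)%:R) ->
  (size G <= size es)%N ->
  G = \sum_(i < size es) G.[j es`_i] *: map_poly j (l i).
Proof.
move=> ue hl sG; apply/eqP; rewrite -subr_eq0; set D := _ - _.
apply: contraT => D0.
have sD : (size D <= size es)%N.
  rewrite (leq_trans (size_polyD _ _)) // geq_max sG size_polyN.
  apply: (leq_trans (size_sum _ _ _)); apply/bigmax_leqP => i _.
  rewrite (leq_trans (size_scale_leq _ _)) //.
  by rewrite size_map_poly (hl i _).1.
suff rD : all (root D) (map j es).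
  have := max_poly_roots D0 rD; rewrite size_map map_inj_uniq; last exact: fmorph_inj.
  by rewrite ltnNge sD => /(_ ue).
apply/allP => _ /mapP[e ees ->].
have [k hk <-] : exists2 k, (k < size es)%N & es`_k = e.
  by exists (index e es); rewrite ?index_mem ?nth_index.
rewrite rootE /D hornerD hornerN horner_sum (bigD1 (Ordinal hk)) //=.
rewrite big1 => [|i ne]; last first.
  rewrite hornerZ horner_map /= (hl i _).2 //.
  by rewrite -val_eqE /= eq_sym in ne; rewrite (negPf ne) rmorph0 mulr0.
by rewrite hornerZ horner_map /= (hl k _).2 // eqxx rmorph1 mulr1 addr0 subrr.
Qed.

(** * The curve z^2 = P(X, t) modulo f *)

Section CurveVars.
Variables (R : comNzRingType) (d : nat).
Local Notation M := {mpoly R[2 + d]}.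

(** The coordinates of the curve are t, an inverse w of h(t) and the coefficients
    of z. *)
Definition tvar : M := 'X_(lshift d ord0).
Definition wvar : M := 'X_(lshift d ord_max).
Definition zvar (i : 'I_d) : M := 'X_(rshift 2 i).
Definition tpoly : {poly R} -> M := horner_eval tvar \o map_poly (@mpolyC (2 + d) R).
Definition zpoly : {poly M} := \sum_(i < d) zvar i *: 'X^i.

HB.instance Definition _ := GRing.RMorphism.copy tpoly
  (horner_eval tvar \o map_poly (@mpolyC (2 + d) R)).

Lemma tpolyC c : tpoly c%:P = c%:MP.
Proof. by rewrite /tpoly /= map_polyC /= /horner_eval hornerC. Qed.

Lemma tpolyX : tpoly 'X = tvar.
Proof. by rewrite /tpoly /= map_polyX /horner_eval hornerX. Qed.

End CurveVars.
Arguments tvar {R d}. Arguments wvar {R d}. Arguments zvar {R d}. 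
Arguments tpoly {R d}. Arguments zpoly {R d}.

Section Curve.
Variables (E : fieldType) (d : nat) (f : {poly E}) (P : {poly {poly E}}) (h : {poly E}).
Hypotheses (fm : f \is monic) (sf : size f = d.+1).
Local Notation M := {mpoly E[2 + d]}.

Let fM : {poly M} := map_poly (@mpolyC (2 + d) E) f.
Let fMm : fM \is monic. Proof. exact: monic_map. Qed.

(** P is a polynomial in X over E[T]; here T is the coordinate t. *)
Definition curve_rem : {poly M} :=
  Pdiv.Ring.rmodp (zpoly ^+ 2 - map_poly tpoly P) fM.

Definition curve_eqs : seq M :=
  (wvar * tpoly h - 1) :: [seq curve_rem`_k | k <- iota 0 d].


Lemma size_curve_rem : (size curve_rem <= d)%N.
Proof.
have sfM : size fM = d.+1.
  by rewrite size_map_poly_id0 // (monicP fm) rmorph1 oner_eq0.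
by rewrite -ltnS -sfM /curve_rem Pdiv.Ring.ltn_rmodpN0 ?monic_neq0.
Qed.

Lemma curve_division : exists Q,
  zpoly ^+ 2 - map_poly tpoly P = Q * fM + curve_rem.
Proof. by eexists; exact: Pdiv.RingMonic.rdivp_eq. Qed.

Lemma curve_eval (S : comNzRingType) (psi : {rmorphism M -> S}) (x : S) :
  root (map_poly (psi \o @mpolyC (2 + d) E) f) x ->
  (map_poly psi zpoly).[x] ^+ 2 - (map_poly (psi \o tpoly) P).[x] =
  \sum_(k < d) psi curve_rem`_k * x ^+ k.
Proof.
move=> /rootP rx; have [Q /(congr1 (map_poly psi))/(congr1 (horner^~ x))] := curve_division.
rewrite rmorphB rmorphXn rmorphD rmorphM /= !hornerE /fM.
rewrite -!map_poly_comp rx mulr0 add0r => ->.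
rewrite (@horner_coef_wide _ d); last first.
  by rewrite (leq_trans (size_poly _ _)) ?size_curve_rem.
by apply: eq_bigr => k _; rewrite coef_map.
Qed.

Lemma curve_point (a : 'I_(2 + d) -> E) :
  (forall p, p \in curve_eqs -> p.@[a] = 0) ->
  exists t z, h.[t] != 0 /\ f %| z ^+ 2 - map_poly (horner_eval t) P.
Proof.
move=> ha; pose t := a (lshift d ord0).
have mt g : (tpoly g).@[a] = g.[t].
  elim/poly_ind: g => [|g c IH]; first by rewrite !rmorph0 horner0.
  rewrite !rmorphD !rmorphM /= IH tpolyX tpolyC /tvar mevalXU mevalC.
  by rewrite !hornerE.
exists t, (map_poly (meval a) zpoly); split.
  have := ha _ (mem_head _ _); rewrite rmorphB rmorphM rmorph1 /= mt => e.
  by apply: contra_eq_neq e => ->; rewrite mulr0 sub0r oppr_eq0 oner_eq0.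
have rem0 : map_poly (meval a) curve_rem = 0.
  apply/polyP => k; rewrite coef_map coef0 /=.
  have [lt|ge] := ltnP k d; last first.
    by rewrite nth_default ?rmorph0 // (leq_trans size_curve_rem).
  by apply: ha; rewrite inE map_f ?orbT // mem_iota.
have [Q /(congr1 (map_poly (meval a)))] := curve_division.
rewrite rmorphB rmorphXn rmorphD rmorphM /= rem0 addr0.
have -> : map_poly (meval a) fM = f.
  by rewrite /fM -map_poly_comp map_poly_id // => x _ /=; rewrite mevalC.
have -> : map_poly (meval a) (map_poly tpoly P) = map_poly (horner_eval t) P.
  by rewrite -map_poly_comp; apply: eq_map_poly => g /=; rewrite mt.
by move=> ->; rewrite dvdp_mull.
Qed.

Section Split.
Variables (L : fieldType) (iota : {rmorphism E -> L}) (es : seq L).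
Hypotheses (ues : uniq es) (fes : map_poly iota f = \prod_(e <- es) ('X - e%:P)).
Local Notation ML := {mpoly L[2 + d]}.
Local Notation I := (in_ideal (map (map_mpoly iota) curve_eqs)).

(** The function P(e, T) on the line whose square root is the value of z at a root
    e of f. *)
Definition branch (e : L) : {poly L} := (map_poly (map_poly iota) P).[e%:P].
Let zeta (i : nat) : ML := zpoly.[(es`_i)%:MP].

Let szes : size es = d.
Proof.
by apply/eqP; rewrite -eqSS -sf -(size_map_poly iota) fes size_prod_XsubC.
Qed.

Let psiC : map_mpoly iota \o @mpolyC (2 + d) E =1 @mpolyC (2 + d) L \o iota.
Proof. by move=> x /=; rewrite map_mpolyC. Qed.

Let psiX i : map_mpoly iota 'X_i = 'X_i :> ML.
Proof. by rewrite map_mpolyX. Qed.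

Let psiT : map_mpoly iota \o tpoly =1 @tpoly L d \o map_poly iota.
Proof.
elim/poly_ind => [|g c IH]; first by rewrite !rmorph0.
move=> /= in IH *; rewrite !rmorphD !rmorphM /= IH map_polyX map_polyC /= !tpolyX !tpolyC psiX.
by rewrite map_mpolyC.
Qed.

Let psiZ : map_poly (map_mpoly iota) zpoly = zpoly :> {poly ML}.
Proof.
rewrite /zpoly rmorph_sum; apply: eq_bigr => i _.
by rewrite /= map_polyZ /= map_polyXn psiX.
Qed.

Lemma zeta_square i : (i < d)%N -> I (zeta i ^+ 2 - tpoly (branch es`_i)).
Proof.
move=> hi; have hr : root (map_poly (map_mpoly iota \o @mpolyC (2 + d) E) f) (es`_i)%:MP.
  have -> : map_poly (map_mpoly iota \o @mpolyC (2 + d) E) f =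
            map_poly (@mpolyC (2 + d) L) (map_poly iota f).
    by rewrite -map_poly_comp; apply: eq_map_poly.
  rewrite fes (big_rem es`_i) ?mem_nth ?szes //= rmorphM rootM /=.
  by rewrite rmorphB /= map_polyX map_polyC /= rootE !hornerE subrr eqxx.
have := curve_eval hr; rewrite psiZ.
have -> : map_poly (map_mpoly iota \o @tpoly E d) P =
          map_poly (@tpoly L d) (map_poly (map_poly iota) P).
  by rewrite -map_poly_comp; apply: eq_map_poly.
rewrite -[(es`_i)%:MP]tpolyC horner_map /= tpolyC => ->.
apply: in_ideal_sum => k; rewrite [X in in_ideal _ X]mulrC; apply/in_idealM/mem_in_ideal.
rewrite inE; apply/orP; right; apply/mapP; exists curve_rem`_k => //.
by apply/mapP; exists (k : nat); rewrite ?mem_iota /= ?add0n ?ltn_ord.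
Qed.

Lemma inverse_eq : I (wvar * tpoly (map_poly iota h) - 1).
Proof.
apply: mem_in_ideal; rewrite inE; apply/orP; left.
have pw : map_mpoly iota wvar = wvar :> ML := psiX _.
have pt : map_mpoly iota (tpoly h) = tpoly (map_poly iota h) :> ML := psiT h.
by rewrite rmorphB rmorphM rmorph1 /= pw pt.
Qed.

Let hT : ML := tpoly (map_poly iota h).
(** Up to a power of h, p lies in the span over L[T] of the products of distinct
    values of z at the roots of f. *)
Definition normal (p : ML) := exists k (c : ktree {poly L} d),
  I (hT ^+ k * p - keval tpoly zeta c).

Lemma normalD p q : normal p -> normal q -> normal (p + q).
Proof.
move=> [k [c hc]] [l [b hb]].
exists (k + l)%N, (kmap2 +%R (kmap2 (fun _ => *%R (map_poly iota h ^+ l)) c c)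
                        (kmap2 (fun _ => *%R (map_poly iota h ^+ k)) b b)).
rewrite keval_add !keval_scale !rmorphXn /= -/hT exprD.
set u := keval _ _ c in hc *; set v := keval _ _ b in hb *.
have -> : hT ^+ k * hT ^+ l * (p + q) - (hT ^+ l * u + hT ^+ k * v) =
  hT ^+ l * (hT ^+ k * p - u) + hT ^+ k * (hT ^+ l * q - v) by ring.
by apply: in_idealD; apply: in_idealM.
Qed.

Lemma normal_scale g p : normal p -> normal (tpoly g * p).
Proof.
move=> [k [c hc]]; exists k, (kmap2 (fun _ => *%R g) c c).
rewrite keval_scale mulrCA -mulrBr; exact: in_idealM.
Qed.

Lemma normal_zeta i p : (i < d)%N -> normal p -> normal (zeta i * p).
Proof.
move=> hi [k [c hc]].
have [c' hc'] := keval_mul_root c zeta_square hi.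
exists k, c'; set u := keval _ _ c in hc hc' *.
have -> : hT ^+ k * (zeta i * p) - keval tpoly zeta c' =
   zeta i * (hT ^+ k * p - u) + (zeta i * u - keval tpoly zeta c') by ring.
by apply: in_idealD => //; apply: in_idealM.
Qed.

Lemma normal_w p : normal p -> normal (wvar * p).
Proof.
move=> [k [c hc]]; exists k.+1, c; rewrite exprS.
have -> : hT * hT ^+ k * (wvar * p) - keval tpoly zeta c =
  (hT ^+ k * p) * (wvar * hT - 1) + (hT ^+ k * p - keval tpoly zeta c) by ring.
by apply: in_idealD => //; apply/in_idealM/inverse_eq.
Qed.

Lemma normal1 : normal 1.
Proof.
suff [c hc] : exists c : ktree {poly L} d, keval (@tpoly L d) zeta c = 1.
  by exists 0%N, c; rewrite hc expr0 mulr1 subrr; apply: in_ideal0.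
suff gen m (z : nat -> ML) : exists c : ktree {poly L} m, keval (@tpoly L d) z c = 1.
  exact: gen.
elim: m z => [|m IH] z /=; first by exists 1; rewrite rmorph1.
have [c hc] := IH (z \o S).
exists (c, kmap2 (fun _ => *%R 0) c c) => /=.
by rewrite keval_scale hc rmorph0 !mul0r addr0.
Qed.

(** The span contains 1 and is stable under multiplication by every coordinate: t is a
    scalar, w is absorbed by the power of h, and the coefficients of z are linear
    combinations of its values at the roots of f by Lagrange interpolation. *)
Lemma normal_all p : normal p.
Proof.
have [l hl] := lagrange_basis ues.
have zE i : zvar i = \sum_(j < d) tpoly ((l j)`_i)%:P * zeta j :> ML.
  have szp : (size (@zpoly L d) <= size es)%N.
    rewrite szes (leq_trans (size_sum _ _ _)) //; apply/bigmax_leqP => k _.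
    by rewrite (leq_trans (size_scale_leq _ _)) // size_polyXn.
  have := lagrange_expand (@mpolyC (2 + d) L) ues hl szp.
  move=> /(congr1 (fun q : {poly ML} => q`_i)).
  rewrite {1}/zpoly !coef_sum (bigD1 i) //= big1 => [|j ji]; last first.
    by rewrite coefZ coefXn -val_eqE eq_sym in ji *; rewrite (negPf ji) mulr0.
  rewrite coefZ coefXn eqxx mulr1 addr0 => ->; rewrite szes.
  by apply: eq_bigr => j _; rewrite coefZ coef_map tpolyC mulrC.
have normal0 : normal 0.
  by rewrite -(mul0r 1) -(rmorph0 tpoly); apply/normal_scale/normal1.
have normal_sum J (r : seq J) F : (forall j, normal (F j)) -> normal (\sum_(j <- r) F j).
  by move=> hF; elim/big_ind: _ => //; apply: normalD.
have nX i q : normal q -> normal ('X_i * q).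
  case: (split_ordP i) => [j ->|j ->] nq.
    case: (unliftP ord_max j) => [j' ->|->]; last exact: normal_w.
    rewrite -[lshift d _]/(lshift d _) (_ : lift ord_max j' = ord0); last first.
      by apply: val_inj; rewrite /= (ord1 j').
    by rewrite -/tvar -tpolyX; apply: normal_scale.
  rewrite -/(zvar j) zE mulr_suml; apply: normal_sum => k.
  by rewrite -mulrA; apply: normal_scale; apply: normal_zeta.
have nXn i k q : normal q -> normal ('X_i ^+ k * q).
  by move=> nq; elim: k => [|k IH]; rewrite ?expr0 ?mul1r // exprS -mulrA; apply: nX.
elim/mpolyind: p => [//|c m p _ _ IH]; apply: normalD => //.
rewrite -mul_mpolyC -tpolyC; apply: normal_scale; rewrite mpolyXE_id.
elim/big_rec: _ => [|i q _ nq]; first exact: normal1.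
exact: nXn.
Qed.

End Split.
End Curve.

Lemma keval_ext (R : Type) (K : pzRingType) (p q : R -> K) (y z : nat -> K) d
    (c : ktree R d) :
  p =1 q -> (forall i, (i < d)%N -> y i = z i) -> keval p y c = keval q z c.
Proof.
move=> pq; elim: d y z c => [|d IH] y z c yz /=; first exact: pq.
by rewrite yz // !(IH (y \o S) (z \o S)) // => i hi; apply: yz.
Qed.

Lemma kall_impl (R : Type) (P Q : R -> Prop) d (c : ktree R d) :
  (forall a, P a -> Q a) -> kall P c -> kall Q c.
Proof.
by move=> PQ; elim: d c => [|d IH] c //=; [exact: PQ | case=> /IH ? /IH ?].
Qed.

Section Kernel.
Variables (E : fieldType) (d : nat) (f : {poly E}) (P : {poly {poly E}}) (h : {poly E}).
Hypotheses (fm : f \is monic) (sf : size f = d.+1) (h0 : h != 0).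
Variables (L : fieldType) (iota : {rmorphism E -> L}) (es : seq L).
Hypotheses (ues : uniq es) (fes : map_poly iota f = \prod_(e <- es) ('X - e%:P)).
Hypothesis two : 2%:R != 0 :> E.
Hypothesis ind : square_independent [seq tofrac (branch P iota e) | e <- es].
Local Notation ML := {mpoly L[2 + d]}.
Local Notation I := (in_ideal (map (map_mpoly iota) (curve_eqs d f P h))).
Local Notation zeta i := ((@zpoly L d).[(es`_i)%:MP]).

(** The generic point of the curve over L has its coordinates in the Kummer tower
    over L(T).  A polynomial vanishing there has a normal form with coefficients 0,
    because the products of distinct square roots are independent, so it is in the
    ideal up to a power of h, and h is invertible modulo the ideal. *)
Lemma curve_kernel : exists (K : fieldType) (phi : {rmorphism {poly L} -> K})
    (ev : {rmorphism ML -> K}),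
  [/\ injective phi, ev \o tpoly =1 phi,
      forall i, (i < d)%N -> ev (zeta i) ^+ 2 = phi (branch P iota es`_i)
    & forall p, ev p = 0 <-> I p].
Proof.
have szes : size es = d.
  by apply/eqP; rewrite -eqSS -sf -(size_map_poly iota) fes size_prod_XsubC.
have twoF : 2%:R != 0 :> {fraction {poly L}}.
  rewrite -(rmorph_nat (@tofrac _)) tofrac_eq0 -polyCMn polyC_eq0.
  by rewrite -(rmorph_nat iota) fmorph_eq0.
have [|K [Phi [z [z2 zi]]]] := @kummer_tower _ _ d _ twoF ind.
  by rewrite size_map.
pose phi : {rmorphism {poly L} -> K} := Phi \o @tofrac _.
have z2' i : (i < d)%N -> z i ^+ 2 = phi (branch P iota es`_i).
  by move=> hi; rewrite z2 // (nth_map 0) ?szes.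
have phi_inj : injective phi.
  by move=> a b /fmorph_inj/eqP; rewrite tofrac_eq => /eqP.
pose c : {rmorphism L -> K} := phi \o polyC.
have [l hl] := lagrange_basis ues.
pose Z : {poly K} := \sum_(j < d) z j *: map_poly c (l j).
have sZ : (size Z <= d)%N.
  rewrite (leq_trans (size_sum _ _ _)) //; apply/bigmax_leqP => j _.
  rewrite (leq_trans (size_scale_leq _ _)) // size_map_poly.
  have [] := hl j; first by rewrite szes.
  by rewrite szes.
pose xi (i : 'I_(2 + d)) : K := match split i with
  | inl j => if j == ord0 then phi 'X else (phi (map_poly iota h))^-1
  | inr j => Z`_j end.
pose ev : {rmorphism ML -> K} := mmap c xi.
have evT g : ev (tpoly g) = phi g.
  elim/poly_ind: g => [|g a IH]; first by rewrite !rmorph0.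
  rewrite !rmorphD !rmorphM /= IH tpolyX tpolyC /ev /= mmapC /tvar mmapX mmap1U.
  by rewrite /xi (unsplitK (inl ord0)) eqxx.
have evZ : map_poly ev zpoly = Z.
  apply/polyP => k; rewrite coef_map /zpoly coef_sum raddf_sum.
  have [lt|ge] := ltnP k d; last first.
    rewrite big1 ?nth_default ?(leq_trans sZ) // => i _.
    have ne : (k == i) = false.
      by apply/negbTE; rewrite neq_ltn (leq_trans (ltn_ord i) ge) orbT.
    by rewrite coefZ coefXn ne mulr0 raddf0.
  rewrite (bigD1 (Ordinal lt)) //= coefZ coefXn eqxx mulr1 big1 => [|i ne].
    rewrite addr0 /ev /= mmapX mmap1U /xi.
    by rewrite (unsplitK (inr (Ordinal lt))).
  rewrite coefZ coefXn -val_eqE /= eq_sym in ne *.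
  by rewrite (negPf ne) mulr0 mmap0.
have Ze i : (i < d)%N -> Z.[c es`_i] = z i.
  move=> hi; rewrite horner_sum (bigD1 (Ordinal hi)) //= big1 => [|j ne].
    by rewrite hornerZ horner_map /= (hl i _).2 ?szes // eqxx rmorph1 mulr1 addr0.
  rewrite hornerZ horner_map /= (hl j _).2 ?szes //.
  by rewrite -val_eqE /= eq_sym in ne; rewrite (negPf ne) !rmorph0 mulr0.
have evzeta i : (i < d)%N -> ev (zeta i) = z i.
  move=> hi; rewrite -horner_map evZ [ev _](_ : _ = c es`_i) ?Ze //.
  by rewrite /ev /= mmapC.
have evC : ev \o @mpolyC (2 + d) L =1 c by move=> x; rewrite /ev /= mmapC.
pose psi : {rmorphism {mpoly E[2 + d]} -> K} := ev \o map_mpoly iota.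
have psiT g : psi (tpoly g) = phi (map_poly iota g).
  rewrite -evT; apply: (congr1 ev).
  elim/poly_ind: g => [|g a IH]; first by rewrite !rmorph0.
  rewrite !rmorphD !rmorphM /= IH map_polyX map_polyC /= !tpolyX !tpolyC.
  by rewrite /tvar map_mpolyX map_mpolyC.
have psiZ : map_poly psi zpoly = Z.
  rewrite -evZ; apply/polyP => k; rewrite !coef_map; apply: (congr1 ev).
  rewrite /zpoly !coef_sum rmorph_sum; apply: eq_bigr => i _.
  by rewrite !coefZ !coefXn rmorphM rmorph_nat /= /zvar map_mpolyX.
have rem0 : map_poly psi (curve_rem d f P) = 0.
  apply/eqP; apply: contraT => G0.
  have := max_poly_roots G0 (_ : all _ (map c es)) _.
  rewrite size_map map_inj_uniq ?ues; last exact: fmorph_inj.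
  rewrite szes ltnNge (leq_trans (size_poly _ _)) ?(size_curve_rem _ fm sf) //.
  apply => //; apply/allP => _ /mapP[e he ->].
  have [k hk <-] : exists2 k, (k < d)%N & es`_k = e.
    by exists (index e es); rewrite ?nth_index // -szes index_mem.
  have hr : root (map_poly (psi \o @mpolyC (2 + d) E) f) (c es`_k).
    have -> : map_poly (psi \o @mpolyC (2 + d) E) f = map_poly c (map_poly iota f).
      rewrite -map_poly_comp; apply: eq_map_poly => x /=.
      by rewrite map_mpolyC mmapC.
    rewrite fes (big_rem es`_k) ?mem_nth ?szes //= rmorphM rootM /=.
    by rewrite rmorphB /= map_polyX map_polyC /= rootE !hornerE subrr eqxx.
  have := curve_eval P fm sf hr; rewrite psiZ (Ze _ hk) (z2' _ hk).
  have -> : map_poly (psi \o @tpoly E d) P =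
            map_poly phi (map_poly (map_poly iota) P).
    by rewrite -map_poly_comp; apply: eq_map_poly => x /=; exact: psiT.
  have eb : (map_poly phi (map_poly (map_poly iota) P)).[c es`_k] =
            phi (branch P iota es`_k) by rewrite /branch -horner_map.
  rewrite eb subrr => e0.
  rewrite rootE (@horner_coef_wide _ d); last first.
    by rewrite (leq_trans (size_poly _ _)) ?(size_curve_rem _ fm sf).
  by rewrite [eqbRHS]e0; apply/eqP; apply: eq_bigr => i _; rewrite coef_map.
have hK : phi (map_poly iota h) != 0.
  by rewrite -(rmorph0 phi) (inj_eq phi_inj) map_poly_eq0.
have van p : I p -> ev p = 0.
  move=> /in_ideal_vanish; apply => _ /mapP[q hq ->]; move: hq.
  rewrite inE => /orP[/eqP -> | /mapP[k _ ->]].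
    rewrite -[ev _]/(psi _) rmorphB rmorphM rmorph1 psiT /psi /= /wvar map_mpolyX.
    rewrite mmapX mmap1U /xi (unsplitK (inl ord_max)).
    by rewrite mulVf // subrr.
  by rewrite -[ev _]/(psi _) -coef_map rem0 coef0.
exists K, phi, ev; split=> //.
  by move=> i hi; rewrite evzeta // z2 // (nth_map 0) ?szes.
move=> p; split=> [ep|]; last exact: van.
have [k [t ht]] := normal_all P h fm sf ues fes p.
have /eqP := van _ ht; rewrite rmorphB rmorphM ep mulr0 sub0r oppr_eq0.
rewrite keval_morph => /eqP e.
have : keval Phi z (kmap2 (fun _ => @tofrac {poly L}) t t) = 0.
  by rewrite -keval_leaves -[RHS]e; apply: keval_ext => [a|i /evzeta] //=; rewrite evT.
move=> /zi/kall_leaves t0; move: ht; rewrite keval0; last first.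
  apply: kall_impl t0 => a /eqP; rewrite tofrac_eq0 => /eqP //.
rewrite subr0 => hp.
have w1 : I ((wvar * tpoly (map_poly iota h)) ^+ k - 1).
  by rewrite -[X in _ - X](expr1n _ k) subrXX; rewrite mulrC; apply/in_idealM/inverse_eq.
have -> : p = wvar ^+ k * (tpoly (map_poly iota h) ^+ k * p) -
  p * ((wvar * tpoly (map_poly iota h)) ^+ k - 1).
  by rewrite exprMn; ring.
by apply: in_idealB; apply: in_idealM.
Qed.

End Kernel.

(** * Descent of ideal membership *)

Section Descent.
Variables (E L : fieldType) (j : {rmorphism E -> L}).

(** The basis starts with 1 because the coordinate at 1 is the one to be compared. *)
Lemma finite_span (cs : seq L) :
  exists m (b : nat -> L), [/\ b 0%N = 1,
    forall a : nat -> E, \sum_(k < m.+1) j (a k) * b k = 0 ->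
      forall k, (k <= m)%N -> a k = 0
  & forall c, c \in cs -> exists a : nat -> E, c = \sum_(k < m.+1) j (a k) * b k].
Proof.
elim: cs => [|c cs [m [b [b0 ind gen]]]].
  exists 0%N, (fun=> 1); split=> // a; rewrite big_ord1 mulr1 => /eqP.
  by rewrite fmorph_eq0 => /eqP a0 k; rewrite leqn0 => /eqP ->.
have [[a ca]|nspan] := EM (exists a : nat -> E, c = \sum_(k < m.+1) j (a k) * b k).
  exists m, b; split=> // x; rewrite inE => /orP[/eqP ->|/gen //].
  by exists a.
pose b' k := if k == m.+1 then c else b k.
have sumE (a : nat -> E) : \sum_(k < m.+2) j (a k) * b' k =
    \sum_(k < m.+1) j (a k) * b k + j (a m.+1) * c.
  rewrite big_ord_recr /= /b' eqxx; congr (_ + _); apply: eq_bigr => k _.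
  by rewrite (ltn_eqF (ltn_ord k)).
exists m.+1, b'; split=> //.
  move=> a; rewrite sumE => e.
  have [a0|a0] := eqVneq (a m.+1) 0.
    rewrite a0 rmorph0 mul0r addr0 in e => k.
    by rewrite leq_eqVlt => /orP[/eqP -> //|]; apply: ind.
  case: nspan; exists (fun k => - (a k / a m.+1)).
  have ja : j (a m.+1) != 0 by rewrite fmorph_eq0.
  apply: (mulfI ja); rewrite mulr_sumr; move/eqP: e; rewrite addrC addr_eq0 => /eqP ->.
  rewrite -sumrN; apply: eq_bigr => k _; rewrite rmorphN fmorph_div /= mulNr mulrN.
  by congr (- _); rewrite mulrA mulrCA divff // mulr1.
move=> x; rewrite inE => /orP[/eqP ->|/gen[a ->]].
  pose a k : E := (k == m.+1)%:R.
  exists a; rewrite sumE /a eqxx rmorph1 mul1r big1 ?add0r // => k _.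
  by rewrite (ltn_eqF (ltn_ord k)) rmorph0 mul0r.
pose a' k : E := if k == m.+1 then 0 else a k.
exists a'; rewrite sumE /a' eqxx rmorph0 mul0r addr0.
by apply: eq_bigr => k _; rewrite (ltn_eqF (ltn_ord k)).
Qed.

(** Expanding the coefficients of a relation over L in a basis that starts with
    1 and comparing the coordinates at 1 gives a relation over E. *)
Lemma in_ideal_descent n (s : seq {mpoly E[n]}) (p : {mpoly E[n]}) :
  in_ideal (map (map_mpoly j) s) (map_mpoly j p) -> in_ideal s p.
Proof.
move=> [c pc]; rewrite size_map in pc.
pose cs := flatten [seq [seq (c i)@_m | m <- msupp (c i)] | i <- iota 0 (size s)].
have [m [b [b0 ind gen]]] := finite_span cs.
have expand i : exists q : nat -> {mpoly E[n]}, (i < size s)%N ->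
    c i = \sum_(k < m.+1) b k *: map_mpoly j (q k).
  have [lt|ge] := ltnP i (size s); last by exists (fun=> 0).
  have /choice[a ha] x : exists a : nat -> E, x \in msupp (c i) ->
      (c i)@_x = \sum_(k < m.+1) j (a k) * b k.
    have [xs|xs] := boolP (x \in msupp (c i)); last by exists (fun=> 0).
    have [|a ha] := gen ((c i)@_x); last by exists a.
    apply/flattenP; exists [seq (c i)@_m | m <- msupp (c i)].
      by apply/mapP; exists i; rewrite ?mem_iota.
    exact: map_f.
  exists (fun k => \sum_(x <- msupp (c i)) a x k *: 'X_[x]) => _.
  rewrite {1}[c i]mpolyE.
  transitivity (\sum_(k < m.+1) \sum_(x <- msupp (c i)) (b k * j (a x k)) *: 'X_[x]);
    last first.
    apply: eq_bigr => k _; rewrite (raddf_sum (map_mpoly j)) scaler_sumr.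
    by apply: eq_bigr => x _; rewrite /= map_mpolyZ map_mpolyX scalerA.
  rewrite exchange_big /= big_seq [RHS]big_seq; apply: eq_bigr => x /ha ->.
  by rewrite scaler_suml; apply: eq_bigr => k _; rewrite mulrC.
have [q hq] := choice expand.
pose r k := \sum_(i < size s) q i k * s`_i.
have pr : map_mpoly j p = \sum_(k < m.+1) b k *: map_mpoly j (r k).
  rewrite pc; under eq_bigr => i _ do rewrite (hq _ (ltn_ord i)) (nth_map 0) // mulr_suml.
  rewrite exchange_big /=; apply: eq_bigr => k _.
  rewrite (raddf_sum (map_mpoly j)) scaler_sumr; apply: eq_bigr => i _.
  by rewrite /= rmorphM -scalerAl.
suff -> : p = r 0%N by exists (fun i => q i 0%N).
apply/mpolyP => x.
have := ind (fun k => (k == 0%N)%:R * p@_x - (r k)@_x) _ 0%N (leq0n _).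
rewrite eqxx mul1r => h; apply/eqP; rewrite -subr_eq0; apply/eqP/h.
under eq_bigr => k _ do rewrite rmorphB mulrBl /=.
rewrite sumrB big_ord_recl eqxx b0 mul1r mulr1 big1 => [|k _]; last first.
  by rewrite /= mul0r rmorph0 mul0r.
rewrite addr0; apply/eqP; rewrite subr_eq0; apply/eqP.
rewrite -mcoeff_map_mpoly pr raddf_sum; apply: eq_bigr => k _.
by rewrite /= mcoeffZ mcoeff_map_mpoly mulrC.
Qed.

End Descent.

(** * Algebraic dependence *)

Lemma clear_denominators (R : idomainType) (p : {poly {fraction R}}) :
  exists c (q : {poly R}), c != 0 /\ tofrac c *: p = map_poly (@tofrac R) q.
Proof.
elim/poly_ind: p => [|p x [c [q [c0 e]]]].
  by exists 1, 0; rewrite oner_eq0 scaler0 rmorph0.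
have [a [b [b0 ->]]] := frac_quotient x.
exists (c * b), (b *: q * 'X + (c * a)%:P); split; first by rewrite mulf_neq0.
rewrite [RHS]rmorphD [X in _ = X + _]rmorphM /= map_polyX map_polyC map_polyZ /= -e.
rewrite scalerDr scalerAl scalerA -rmorphM [b * c]mulrC; congr (_ * _ + _).
rewrite -mul_polyC -polyCM; congr polyC.
by rewrite !rmorphM /= mulrACA [X in _ * X]mulrC -mulrA mulVf ?mulr1 ?tofrac_eq0.
Qed.

Section Exchange.
Variables (E K : fieldType) (rho : {rmorphism {fraction {poly E}} -> K}).
Let j : {rmorphism E -> K} := rho \o @tofrac _ \o polyC.
Definition eval_at (u : K) : {rmorphism {poly E} -> K} := horner_eval u \o map_poly j.

Let eval_swap (q : {poly {poly E}}) u v :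
  (map_poly (eval_at u) q).[v] = (map_poly (eval_at v) (swapXY q)).[u].
Proof.
have e w (r : {poly {poly E}}) :
    map_poly (eval_at w) r = map_poly (horner_eval w) (map_poly (map_poly j) r).
  by rewrite -map_poly_comp.
rewrite !e -(swapXY_map j) -horner_polyC -{1}[v](hornerC v u).
by rewrite horner_map.
Qed.

Let clear_algebraic u w (psi : {rmorphism {fraction {poly E}} -> K}) :
  (forall g, psi (tofrac g) = eval_at u g) -> algebraicOver psi w ->
  exists q : {poly {poly E}}, q != 0 /\ (map_poly (eval_at u) q).[w] = 0.
Proof.
move=> hpsi [p p0 /rootP pw].
have [c [q [c0 e]]] := clear_denominators p.
have tc : tofrac c != 0 by rewrite tofrac_eq0.
exists q; split.
  apply: contra_neq p0 => q0; move/eqP: e; rewrite q0 rmorph0 scaler_eq0.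
  by rewrite (negPf tc) => /eqP.
have -> : map_poly (eval_at u) q = map_poly psi (map_poly (@tofrac _) q).
  by rewrite -map_poly_comp; apply: eq_map_poly => g /=; rewrite hpsi.
by rewrite -e map_polyZ hornerZ pw mulr0.
Qed.

Let rho_eval : forall g, rho (tofrac g) = eval_at (rho (tofrac 'X)) g.
Proof.
elim/poly_ind => [|g c IH]; first by rewrite !rmorph0.
rewrite !rmorphD !rmorphM IH /= map_polyX map_polyC /horner_eval hornerX hornerC //.
Qed.

(** Two elements algebraic over E(T) satisfy a nontrivial polynomial relation
    over E: if u is transcendental over E, then T is algebraic over E(u) by
    reading a relation between T and u as an equation for T, and so is everything
    algebraic over E(T). *)
Lemma exchange u w : algebraicOver rho u -> algebraicOver rho w ->
  exists q : {poly {poly E}}, q != 0 /\ (map_poly (eval_at u) q).[w] = 0.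
Proof.
move=> au aw.
have [[g [g0 gu]]|ntr] := EM (exists g : {poly E}, g != 0 /\ eval_at u g = 0).
  exists g%:P; split; first by rewrite polyC_eq0.
  by rewrite map_polyC /= hornerC.
have inj : injective (eval_at u).
  move=> a b ab; apply/eqP; rewrite -subr_eq0; apply: contraPT (introT eqP ab) => ne.
  move=> /eqP ab'; case: ntr; exists (a - b); split=> //.
  by rewrite rmorphB ab' subrr.
have [psi hpsi] := frac_lift inj.
pose T := rho (tofrac 'X).
have aT : algebraicOver psi T.
  have [q [q0 qT]] := clear_algebraic rho_eval au.
  exists (map_poly (@tofrac _) (swapXY q)).
    rewrite map_poly_eq0_id0 ?lead_coef_eq0 ?swapXY_eq0 //.
    by rewrite tofrac_eq0 lead_coef_eq0 swapXY_eq0.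
  apply/rootP; rewrite -map_poly_comp -[RHS]qT eval_swap.
  by congr (_.[_]); apply: eq_map_poly => g /=; rewrite hpsi.
have arho x : integralOver psi (rho x).
  have ag g : integralOver psi (rho (tofrac g)).
    rewrite rho_eval /=; apply: integral_horner.
      apply/integral_poly => i; rewrite coef_map.
      rewrite [X in integralOver _ X](_ : _ = psi (tofrac (g`_i)%:P)).
        exact: integral_id.
      by rewrite hpsi /= map_polyC /horner_eval hornerC.
    exact/integral_algebraic.
  have [a [b [b0 ->]]] := frac_quotient x.
  by rewrite fmorph_div; apply: integral_div.
apply: (clear_algebraic hpsi); apply/integral_algebraic.
have [p p0 pw] := aw.
apply: (@integral_root _ _ psi (map_poly rho p)) pw _; first by rewrite map_poly_eq0.
by apply/integral_poly => i; rewrite coef_map; apply: arho.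
Qed.

End Exchange.

(** * Splitting fields *)

Lemma irreducible_factor (F : fieldType) (g : {poly F}) : (1 < size g)%N ->
  exists p, irreducible_poly p /\ p %| g.
Proof.
move=> sg; pose Q n := `[< exists p : {poly F}, [/\ size p = n, (1 < n)%N & p %| g] >].
have exQ : exists n, Q n by exists (size g); apply/asboolP; exists g.
case: (ex_minnP exQ) => n /asboolP[p [sp n1 pg]] hmin.
exists p; split=> //; split; first by rewrite sp.
move=> q sq qp; rewrite -dvdp_size_eqp // eqn_leq dvdp_leq //=; last first.
  by rewrite -size_poly_gt0 sp (ltn_trans _ n1).
rewrite sp; apply: hmin; apply/asboolP; exists q; split=> //.
  rewrite ltn_neqAle eq_sym sq size_poly_gt0; apply: contraTneq qp => ->.
  by rewrite dvd0p -size_poly_eq0 sp -lt0n (ltn_trans _ n1).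
exact: dvdp_trans qp pg.
Qed.

Definition splits_over (E L : fieldType) (iota : {rmorphism E -> L}) (g : {poly E}) :=
  exists c (rs : seq L), map_poly iota g = c *: \prod_(r <- rs) ('X - r%:P).

(** Roots are adjoined one at a time. *)
Lemma splitting_field (E : fieldType) (g : {poly E}) :
  exists (L : fieldType) (iota : {rmorphism E -> L}),
    (forall x, algebraicOver iota x) /\ splits_over iota g.
Proof.
have [n] := ubnP (size g); elim: n E g => // n IH E g; rewrite ltnS => sg.
have [sg1|sg1] := leqP (size g) 1.
  exists E, idfun; split; first by move=> x; apply: algebraic_id.
  exists g`_0, [::]; rewrite big_nil map_poly_id // [LHS](size1_polyC sg1).
  by rewrite alg_polyC.
have [p [irr pg]] := irreducible_factor sg1.
have [F _ [z pz _]] := irredp_FAdjoin irr.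
pose i1 : {rmorphism E -> F} := in_alg F.
have rz : root (map_poly i1 g) z.
  by have /dvdpP[q' ->] := pg; rewrite rmorphM rootM pz orbT.
have /factor_theorem[q qe] := rz.
have q0 : q != 0.
  apply: contraTneq sg1 => q0; move/eqP: qe; rewrite q0 mul0r map_poly_eq0 => /eqP ->.
  by rewrite size_poly0.
have sq : (size q < n)%N.
  have := size_map_poly i1 g; rewrite qe size_Mmonic ?monicXsubC // size_XsubC addn2 /= => e.
  by rewrite (leq_trans _ sg) // -e.
have [L [i2 [alg [c [rs e]]]]] := IH F q sq.
exists L, (i2 \o i1 : {rmorphism E -> L}); split; last first.
  exists c, (i2 z :: rs); rewrite big_cons map_poly_comp qe rmorphM /= e.
  rewrite rmorphB /= map_polyX map_polyC /=; by rewrite -scalerAl mulrC.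
move=> x; have [h h0 hx] := alg x; apply/integral_algebraic.
apply: (integral_root (p := map_poly i2 h)); rewrite ?map_poly_eq0 //.
apply/integral_poly => k; rewrite coef_map; apply: integral_rmorph.
apply/integral_algebraic.
have /polyOver1P[m hm] := minPolyOver 1%AS (h`_k).
exists m; last by rewrite -hm root_minPoly.
by rewrite -(map_poly_eq0 i1) -[map_poly _ _]hm monic_neq0 ?monic_minPoly.
Qed.

(** * Rational points on the curves of Kummer type *)

Section TwoVariables.
Variable E : fieldType.
Let M2 := {mpoly E[2]}.

(** The passage from the nested polynomials of [exchange] to relations between two
    coordinates. *)
Definition flatten2 (q : {poly {poly E}}) : M2 :=
  (map_poly (horner_eval 'X_ord0 \o map_poly (@mpolyC 2 E)) q).['X_ord_max].

Lemma flatten2_eval (K : comNzRingType) (j : {rmorphism E -> K}) (v : 'I_2 -> K) q :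
  mmap j v (flatten2 q) =
  (map_poly (horner_eval (v ord0) \o map_poly j) q).[v ord_max].
Proof.
have hin g : mmap j v (horner_eval 'X_ord0 (map_poly (@mpolyC 2 E) g)) =
     horner_eval (v ord0) (map_poly j g).
  rewrite /horner_eval; elim/poly_ind: g => [|g c IH].
    by rewrite !rmorph0 !horner0 mmap0.
  rewrite !rmorphD !rmorphM /= !map_polyX !map_polyC !hornerE mmapD.
  by rewrite (rmorphM (mmap j v)) /= IH mmapX mmap1U mmapC.
rewrite /flatten2 -(horner_map (mmap j v)) /= mmapX mmap1U; congr (_.[_]).
by rewrite -map_poly_comp; apply: eq_map_poly => g /=; rewrite hin.
Qed.

Lemma flatten2_neq0 q : q != 0 -> flatten2 q != 0.
Proof.
apply: contra_neq => q0.
pose v (i : 'I_2) : {poly {poly E}} := if i == ord0 then 'X%:P else 'X.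
have := flatten2_eval (polyC \o polyC) v q.
rewrite q0 mmap0 /v eqxx (_ : (ord_max == ord0 :> 'I_2) = false) // => ->.
have -> : map_poly (horner_eval 'X%:P \o map_poly (polyC \o polyC)) q = map_poly polyC q.
  apply: eq_map_poly => g /=; rewrite /horner_eval map_poly_comp.
  by rewrite (horner_map polyC) /=; congr polyC; rewrite -/(comp_poly _ _) comp_polyXr.
by rewrite -/(comp_poly _ _) comp_polyXr.
Qed.

Lemma mpoly1_inj (q : {mpoly E[1]}) : mmap polyC (fun=> 'X) q = 0 -> q = 0.
Proof.
move=> q0; suff -> : q = (map_poly (@mpolyC 1 E) (mmap polyC (fun=> 'X) q)).['X_ord0].
  by rewrite q0 rmorph0 horner0.
pose back : {rmorphism {poly E} -> {mpoly E[1]}} :=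
  horner_eval 'X_ord0 \o map_poly (@mpolyC 1 E).
rewrite -[RHS]/(back _); clear q0; elim/mpolyind: q => [|c m q _ _ IH].
  by rewrite mmap0 rmorph0.
rewrite mmapD rmorphD -IH mmapZ rmorphM /= map_polyC /horner_eval hornerC mul_mpolyC.
congr (_ *: _ + _); rewrite mmapX /mmap1 big_ord1 map_polyXn hornerXn mpolyXE_id big_ord1.
by [].
Qed.

End TwoVariables.

Section PacPoint.
Variables (E : fieldType) (d : nat) (f : {poly E}) (P : {poly {poly E}}) (h g : {poly E}).
Hypotheses (pac : pseudo_algebraically_closed E) (two : 2%:R != 0 :> E).
Hypotheses (fm : f \is monic) (sf : size f = d.+1) (h0 : h != 0) (sep : separable_poly f).
Hypotheses (g0 : g != 0) (fg : f %| g).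
(* A multiple g of f is split, rather than f, so that L can be taken large enough for
   the independence to be proved. *)
Hypothesis ind : forall (L : fieldType) (iota : {rmorphism E -> L}) (es : seq L),
  splits_over iota g -> uniq es -> map_poly iota f = \prod_(e <- es) ('X - e%:P) ->
  square_independent [seq tofrac (branch P iota e) | e <- es].

Lemma splits_dvd (L : fieldType) (iota : {rmorphism E -> L}) : splits_over iota g ->
  exists es : seq L, uniq es /\ map_poly iota f = \prod_(e <- es) ('X - e%:P).
Proof.
move=> [c [rs e]].
have c0 : c != 0.
  by apply: contra_neq g0 => c0; apply/eqP; rewrite -(map_poly_eq0 iota) e c0 scale0r.
have : map_poly iota f %| \prod_(r <- rs) ('X - r%:P).
  by rewrite -(dvdpZr _ _ c0) -e dvdp_map.
move=> /dvdp_prod_XsubC[m]; rewrite eqp_monic ?monic_map ?monic_prod_XsubC // => /eqP em.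
exists (mask m rs); split=> //.
by rewrite -separable_prod_XsubC -em separable_map.
Qed.

Let kernel (L : fieldType) (iota : {rmorphism E -> L}) es (sp : splits_over iota g) ues fes :=
  curve_kernel fm sf h0 ues fes two (ind (es := es) sp ues fes).

(** By [curve_kernel] the ideal is the kernel of a morphism to a field. *)
Lemma curve_absolutely_irreducible : absolutely_irreducible (curve_eqs d f P h).
Proof.
move=> L iota _.
have [rs e] := closed_field_poly_normal (map_poly iota g).
have sp : splits_over iota g by eexists; eexists; exact: e.
have [es [ues fes]] := splits_dvd sp.
have [K [phi [ev [_ _ _ ker]]]] := kernel sp ues fes.
split=> [/ker|x y /ker]; first by rewrite rmorph1 => /eqP; rewrite oner_eq0.
by rewrite rmorphM => /eqP; rewrite mulf_eq0 => /orP[] /eqP /ker; [left | right].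
Qed.

(** The coordinate t is transcendental, since the tower contains L(T).  All coordinates
    are algebraic over E(T), so [exchange] gives a relation between any two functions
    on the curve; it holds modulo the ideal over L, hence over E. *)
Lemma curve_dimension : has_dimension (curve_eqs d f P h) 1.
Proof.
have [L [iota [alg sp]]] := splitting_field g.
have [es [ues fes]] := splits_dvd sp.
have [K [phi [ev [phi_inj evT ev2 ker]]]] := kernel sp ues fes.
pose psi : {rmorphism {mpoly E[2 + d]} -> K} := ev \o map_mpoly iota.
have kerE p : psi p = 0 -> in_ideal (curve_eqs d f P h) p.
  by move=> /ker/in_ideal_descent.
have vanE p : in_ideal (curve_eqs d f P h) p -> psi p = 0.
  move=> /in_ideal_vanish; apply=> q hq; apply/ker/mem_in_ideal.
  by apply/mapP; exists q.
pose phiE : {rmorphism {poly E} -> K} := phi \o map_poly iota.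
have phiE_inj : injective phiE.
  by move=> a b /phi_inj/map_poly_inj.
have psiT q : psi (tpoly q) = phiE q.
  rewrite /phiE /= -[RHS]evT; apply: (congr1 ev).
  elim/poly_ind: q => [|q a IH]; first by rewrite !rmorph0.
  rewrite !rmorphD !rmorphM /= IH map_polyX map_polyC /= !tpolyX !tpolyC.
  by rewrite /tvar map_mpolyX map_mpolyC.
pose jE : {rmorphism E -> K} := phiE \o polyC.
have psiC a : psi a%:MP = jE a by rewrite -(@tpolyC _ d) psiT.
have psiV : psi tvar = phiE 'X by rewrite -(@tpolyX E d) psiT.
have psi_mmap k (t : k.-tuple {mpoly E[2 + d]}) (q : {mpoly E[k]}) :
    psi (q \mPo t) = mmap jE (fun i => psi (tnth t i)) q.
  elim/mpolyind: q => [|c m q _ _ IH]; first by rewrite mmap0 !raddf0.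
  rewrite comp_mpolyD mmapD rmorphD IH comp_mpolyZ -mul_mpolyC rmorphM mmapZ.
  rewrite psiC comp_mpolyX rmorph_prod mmapX; congr (_ * _ + _).
  by apply: eq_bigr => i _; rewrite rmorphXn.
split.
  exists [tuple tvar] => q /vanE; rewrite psi_mmap => e; apply: mpoly1_inj.
  apply: phiE_inj; rewrite rmorph0 -[RHS]e.
  elim/mpolyind: {e} q => [|c m q _ _ IH]; first by rewrite !mmap0 rmorph0.
  rewrite !mmapD rmorphD IH !mmapZ rmorphM; congr (_ * _ + _).
  rewrite !mmapX /mmap1 !big_ord1 rmorphXn (tnth_nth 0).
  by congr (_ ^+ _); exact: esym psiV.
move=> t hind.
have [rho hrho] := frac_lift phiE_inj.
have algc x : integralOver rho (phi x%:P).
  have [p p0 px] := alg x; apply: (@integral_root _ _ rho (map_poly (phi \o polyC) (map_poly iota p))).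
  - by rewrite !map_poly_eq0.
  - by move: px => /rootP px; apply/rootP; rewrite (horner_map (phi \o polyC)) px rmorph0.
  apply/integral_poly => i; rewrite !coef_map.
  rewrite [X in integralOver _ X](_ : _ = rho (tofrac (p`_i)%:P)); first exact: integral_id.
  by rewrite hrho /= map_polyC.
have algT : integralOver rho (phi 'X).
  have -> : phi 'X = rho (tofrac 'X) by rewrite hrho /= map_polyX.
  exact: integral_id.
have algp q : integralOver rho (phi q).
  elim/poly_ind: q => [|q a IH]; first by rewrite rmorph0; apply: integral0.
  by rewrite rmorphD rmorphM; apply: integral_add => //; apply: integral_mul.
have algz i : (i < d)%N -> integralOver rho (ev (@zpoly L d).[(es`_i)%:MP]).
  move=> hi; apply: (@integral_root_monic _ _ rho _ ('X^2 - (phi (branch P iota es`_i))%:P)).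
  - by rewrite monicXnsubC.
  - by rewrite rootE !hornerE ev2 // subrr.
  apply/integral_poly => k; rewrite coefB coefXn coefC; apply: integral_sub.
    exact: integral_nat.
  by case: eqP => _; [exact: algp | exact: integral0].
have algk m (z : nat -> K) (c : ktree {poly L} m) :
    (forall i, (i < m)%N -> integralOver rho (z i)) -> integralOver rho (keval phi z c).
  elim: m z c => [|m IH] z c hz /=; first exact: algp.
  have hz' i : (i < m)%N -> integralOver rho ((z \o S) i) by move=> hi; apply: hz.
  by apply: integral_add; [|apply: integral_mul; last exact: hz]; apply: IH.
have algE p : algebraicOver rho (psi p).
  apply/integral_algebraic; rewrite [psi p]/(ev (map_mpoly iota p)).
  have [k [c hc]] := normal_all P h fm sf ues fes (map_mpoly iota p).
  have := (ker _).2 hc; rewrite rmorphB rmorphM rmorphXn keval_morph => /eqP.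
  rewrite subr_eq0 (_ : ev (tpoly _) = phi (map_poly iota h)); last exact: evT.
  rewrite (@keval_ext _ _ _ phi _ (fun i => ev (@zpoly L d).[(es`_i)%:MP])) //.
  have hn : phi (map_poly iota h) ^+ k != 0.
    by rewrite expf_neq0 // -(rmorph0 phi) (inj_eq phi_inj) map_poly_eq0.
  set kv := keval _ _ c => /eqP e.
  rewrite [X in integralOver _ X](_ : _ = kv / phi (map_poly iota h) ^+ k).
    by apply: integral_div; [exact: algk | rewrite -rmorphXn; apply: algp].
  by apply: (canRL (mulfK hn)); rewrite mulrC; exact: e.
have [q [q0 hq]] := exchange (algE (tnth t ord0)) (algE (tnth t ord_max)).
suff /hind/eqP : in_ideal (curve_eqs d f P h) (flatten2 q \mPo t).
  by rewrite (negPf (flatten2_neq0 q0)).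
apply: kerE; rewrite psi_mmap flatten2_eval -[RHS]hq.
congr (_.[_]); apply: eq_map_poly => x /=; congr (horner_eval _ _).
by apply: eq_map_poly => y /=; rewrite hrho.
Qed.

Theorem kummer_curve_point :
  exists t z, h.[t] != 0 /\ f %| z ^+ 2 - map_poly (horner_eval t) P.
Proof.
have [a ha] := pac curve_absolutely_irreducible curve_dimension.
exact: curve_point ha.
Qed.

End PacPoint.

(** * Square-free polynomials and inseparability *)

(** Over an imperfect field such an f need not be separable. *)
Definition radical (E : fieldType) (f : {poly E}) :=
  f != 0 /\ forall g k, f %| g ^+ k -> f %| g.

Lemma frobenius_power (E : fieldType) q : [pchar E].-nat q ->
  exists phi : {rmorphism E -> E}, forall x, phi x = x ^+ q.
Proof.
move=> hq; pose phi (x : E) := x ^+ q.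
have qN (x : E) : (- x) ^+ q = - x ^+ q.
  apply/eqP; rewrite -addr_eq0 -exprDn_pchar // addNr expr0n gtn_eqF //.
  by case/andP: hq.
have za : zmod_morphism phi by move=> x y; rewrite /phi exprDn_pchar // qN.
have mm : monoid_morphism phi by split; [exact: expr1n | move=> x y; exact: exprMn].
pose A := GRing.isZmodMorphism.Build _ _ phi za.
pose M := GRing.isMonoidMorphism.Build _ _ phi mm.
by exists (HB.pack phi A M : {rmorphism E -> E}).
Qed.

Lemma pchar_nat_poly (E : fieldType) q : [pchar E].-nat q -> [pchar {poly E}].-nat q.
Proof. by rewrite (eq_pnat _ (pchar_poly E)). Qed.

Lemma frobenius_comp (E : fieldType) q (phi : {rmorphism E -> E}) (u : {poly E}) :
  [pchar E].-nat q -> (forall x, phi x = x ^+ q) ->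
  map_poly phi u \Po 'X^q = u ^+ q.
Proof.
move=> hq hphi; have hq' := pchar_nat_poly hq.
elim/poly_ind: u => [|u c IH].
  by rewrite rmorph0 comp_poly0 expr0n gtn_eqF //; case/andP: hq.
rewrite exprDn_pchar // exprMn -IH rmorphD rmorphM /= map_polyX map_polyC /=.
by rewrite comp_polyD comp_polyM comp_polyX comp_polyC hphi polyC_exp.
Qed.

Lemma dvdp_comp (E : fieldType) (a b c : {poly E}) : a %| b -> a \Po c %| b \Po c.
Proof. by move=> /dvdpP[u ->]; rewrite comp_polyM dvdp_mull. Qed.

(** Take F of least degree with F | f^phi and f | F(X^q) for some Frobenius phi; as f is
    radical, F is square-free.  If D = gcd(F, F') were not constant, D and F / D would be
    coprime, so D' = 0 and D = k(X^p).  After one more Frobenius map D becomes k^p, which may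
    be replaced with k, and the degree drops. *)
Lemma separable_model (E : fieldType) (f : {poly E}) : radical f ->
  exists q (phi : {rmorphism E -> E}) (F : {poly E}),
    [/\ [pchar E].-nat q, forall x, phi x = x ^+ q, separable_poly F,
        F %| map_poly phi f & f %| F \Po 'X^q].
Proof.
move=> [f0 rad].
pose Q n := `[< exists q (phi : {rmorphism E -> E}) (F : {poly E}),
    [/\ [pchar E].-nat q, forall x, phi x = x ^+ q, size F = n,
        F %| map_poly phi f & f %| F \Po 'X^q] >].
have exQ : exists n, Q n.
  exists (size f); apply/asboolP; exists 1%N, idfun, f; split=> //.
    by rewrite map_poly_id.
  by rewrite expr1 comp_polyXr.
case: (ex_minnP exQ) => n /asboolP[q [phi [F [hq hphi sF Ff fF]]]] hmin.
exists q, phi, F; split=> //.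
have F0 : F != 0.
  by apply: contraTneq Ff => ->; rewrite dvd0p map_poly_eq0.
have q_gt0 : (0 < q)%N by case/andP: hq.
(* F is square-free because n is least *)
have sqf a : a ^+ 2 %| F -> (size a <= 1)%N.
  move=> /dvdpP[b Fe]; rewrite leqNgt; apply/negP => sa.
  have [b0 a0] : b != 0 /\ a != 0.
    by apply/andP; move: F0; rewrite Fe mulf_eq0 expf_eq0 /= negb_or.
  have sF' : size F = (size (b * a)%R + size a).-1.
    by rewrite Fe expr2 mulrA size_mul ?mulf_neq0.
  have : (0 < size (b * a)%R)%N by rewrite size_poly_gt0 mulf_neq0.
  have : (n <= size (b * a)%R)%N.
    apply: hmin; apply/asboolP; exists q, phi, (b * a); split=> //.
      by apply: dvdp_trans Ff; rewrite Fe expr2 mulrA dvdp_mulr.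
    apply: (rad _ 2%N); apply: dvdp_trans fF _.
    rewrite -rmorphXn; apply: dvdp_comp; rewrite Fe.
    have -> : (b * a) ^+ 2 = b * (b * a ^+ 2) by ring.
    by rewrite dvdp_mull.
  by lia.
rewrite unlock; apply: contraT; rewrite coprimep_def => ncop.
pose D := gcdp F F^`(); have D0 : D != 0 by rewrite gcdp_eq0 (negPf F0).
have sD : (1 < size D)%N by rewrite ltn_neqAle eq_sym ncop size_poly_gt0.
have /dvdpP[G FG] : D %| F := dvdp_gcdl _ _.
have G0 : G != 0 by apply: contraNneq F0 => G0; rewrite FG G0 mul0r.
have copDG : coprimep D G.
  rewrite coprimep_def eqn_leq size_poly_gt0 gcdp_eq0 negb_and D0 /= andbT.
  by apply: sqf; rewrite FG expr2 dvdp_mul // ?dvdp_gcdr ?dvdp_gcdl.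
have dD0 : D^`() = 0.
  have : D %| D^`() * G.
    have hD : D %| G^`() * D + G * D^`().
      by rewrite -derivM -FG; apply: dvdp_gcdr.
    by rewrite mulrC -(dvdp_addr _ (dvdp_mull G^`() (dvdpp D))).
  rewrite Gauss_dvdpl // => /dvdp_leq hl; apply/eqP; apply: contraT => dD0.
  by have := hl dD0; rewrite leqNgt lt_size_deriv.
have [p pch] : exists p, p \in [pchar E].
  have := congr1 (fun u : {poly E} => u`_(size D).-2) dD0; rewrite coef0 coef_deriv.
  case: (size D) (lead_coefE D) sD => [|[|m]] //= lc _.
  rewrite -lc -mulr_natr => /eqP; rewrite mulf_eq0 lead_coef_eq0 (negPf D0) /=.
  exact: natf0_pchar.
have p_pr : prime p := pcharf_prime pch.
pose k : {poly E} := \poly_(i < size D) D`_(i * p).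
have Dk : D = k \Po 'X^p.
  apply/polyP => i; rewrite coef_comp_poly_Xn ?prime_gt0 //.
  case: ifP => [/dvdnP[m ->]|ndiv]; rewrite ?mulnK ?prime_gt0 //.
    rewrite coef_poly; case: ltnP => // le.
    by rewrite nth_default // (leq_trans le) // leq_pmulr ?prime_gt0.
  case: i ndiv => [|i] ndiv; first by rewrite dvdn0 in ndiv.
  have := congr1 (fun u : {poly E} => u`_i) dD0; rewrite coef0 coef_deriv -mulr_natr.
  by move=> /eqP; rewrite mulf_eq0 -(dvdn_pcharf pch) ndiv orbF => /eqP.
have k0 : k != 0 by apply: contraNneq D0 => e; rewrite Dk e comp_poly0.
have sk : (size D).-1 = ((size k).-1 * p)%N.
  by rewrite Dk size_comp_poly size_polyXn.
have pp : [pchar E].-nat p by rewrite pnatE.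
have [psi hpsi] := frobenius_power pp.
have hqp : [pchar E].-nat (q * p) by rewrite pnatM hq.
pose phip : {rmorphism E -> E} := psi \o phi.
pose F1 := k * map_poly psi G.
have eF : map_poly psi F = k ^+ p * map_poly psi G.
  rewrite FG rmorphM mulrC /= -(frobenius_comp k pp hpsi); congr (_ * _).
  by rewrite {1}Dk map_comp_poly /= map_polyXn.
have F1F : F1 %| map_poly psi F.
  by rewrite eF dvdp_mul // dvdp_exp ?prime_gt0.
have F10 : F1 != 0 by rewrite mulf_neq0 ?map_poly_eq0.
have sF1 : (size F1 < size F)%N.
  rewrite FG !size_mul ?map_poly_eq0 // size_map_poly.
  have sG : (0 < size G)%N by rewrite size_poly_gt0.
  have sk0 : (0 < (size k).-1)%N.
    rewrite lt0n; apply: contraTneq sD => e; move: sk; rewrite e mul0n.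
    by case: (size D) => [|[|]].
  have := ltn_Pmulr (prime_gt1 p_pr) sk0; rewrite -sk; move: sG sk0 sD.
  by move: (size k) (size G) (size D) => x y z; clear; lia.
have : (n <= size F1)%N; last by rewrite leqNgt -sF sF1.
apply: hmin; apply/asboolP; exists (q * p)%N, phip, F1; split=> //.
- by move=> x; rewrite /phip /= hphi hpsi exprM.
- by apply: dvdp_trans F1F _; rewrite /phip map_poly_comp dvdp_map.
apply: (rad _ p); rewrite -(dvdp_pexp2r _ _ (prime_gt0 p_pr)).
apply: (@dvdp_trans _ ((F \Po 'X^q) ^+ p)); first by rewrite dvdp_pexp2r ?prime_gt0.
rewrite -(frobenius_comp _ pp hpsi) map_comp_poly /= map_polyXn -comp_polyA.
have -> : 'X^q \Po 'X^p = 'X^(q * p) :> {poly E}.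
  by rewrite rmorphXn /= comp_polyX -exprM mulnC.
rewrite -[(F1 \Po _) ^+ p]rmorphXn -rmorphXn; apply: dvdp_comp.
rewrite eF exprMn; apply: dvdp_exp (prime_gt0 p_pr) _; apply: dvdp_mul => //.
exact: dvdp_exp (prime_gt0 p_pr) (dvdpp _).
Qed.

(** * Square values and square classes over a pseudo-algebraically closed field *)

(** The coefficients of e are computed from the top, each by a division by 2. *)
Lemma sqrt_algorithm (E : fieldType) (M : {poly E}) n : 2%:R != 0 :> E ->
  M \is monic -> size M = (2 * n).+1 ->
  exists e : {poly E}, [/\ e \is monic, size e = n.+1 & (size (M - e ^+ 2)%R <= n)%N].
Proof.
move=> two mM sM.
suff h k : (k <= n)%N -> exists e : {poly E}, [/\ e \is monic, size e = n.+1 &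
    (size (M - e ^+ 2)%R <= 2 * n - k)%N].
  by have [e [me se le]] := h n (leqnn n); exists e; split; rewrite // (leq_trans le) // mul2n -addnn addnK.
elim: k => [|k IH] le.
  exists 'X^n; rewrite monicXn size_polyXn; split=> //; rewrite subn0.
  apply/leq_sizeP => i; rewrite -exprM [(n * 2)%N]mulnC leq_eqVlt coefB coefXn => /orP[/eqP <-|lt].
    by rewrite eqxx; have := lead_coefE M; rewrite sM (monicP mM) /= => <-; rewrite subrr.
  by rewrite gtn_eqF // subr0 nth_default // sM.
have [e [me se le']] := IH (ltnW le).
set D := M - e ^+ 2 in le'; pose r := D`_(2 * n - k.+1); pose c := r / 2%:R.
have sc : (size (c *: 'X^(n - k.+1))%R <= n)%N.
  by rewrite (leq_trans (size_scale_leq _ _)) // size_polyXn; lia.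
exists (e + c *: 'X^(n - k.+1)); split.
- by rewrite monicE lead_coefDl ?se ?ltnS // -monicE.
- by rewrite size_polyDl se.
have -> : M - (e + c *: 'X^(n - k.+1)) ^+ 2 =
   D - (2%:R * c) *: (e * 'X^(n - k.+1)) - c ^+ 2 *: 'X^(2 * (n - k.+1)).
  rewrite /D sqrrD -!mul_polyC !rmorphM /= mulnC exprM rmorph_nat; ring.
apply/leq_sizeP => i; rewrite leq_eqVlt => hi.
rewrite !coefB !coefZ coefXn coefMXn (mulrC 2%:R) divfK //.
have e1 : e`_n = 1 by have := lead_coefE e; rewrite se (monicP me).
case/orP: hi => [/eqP <-|hi].
  have -> : (2 * n - k.+1 < n - k.+1)%N = false by lia.
  have -> : (2 * n - k.+1 - (n - k.+1))%N = n by lia.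
  have -> : (2 * n - k.+1 == 2 * (n - k.+1))%N = false by apply/eqP; lia.
  by rewrite e1 mulr1 mulr0 subr0 -coefB subrr.
have -> : (i < n - k.+1)%N = false by lia.
have -> : (i == 2 * (n - k.+1))%N = false by apply/eqP; lia.
rewrite [e`__]nth_default ?se; last by lia.
by rewrite !mulr0 !subr0 -coefB nth_default // (leq_trans le') //; lia.
Qed.

(** Let e0 be given by [sqrt_algorithm].  If M were not e0^2 then M - e0^2 =
    (e - e0) (e + e0) would have at least the degree of e. *)
Lemma monic_sqrt_rational (E L : fieldType) (iota : {rmorphism E -> L}) (M : {poly E})
    (e : {poly L}) : 2%:R != 0 :> E -> M \is monic -> e \is monic ->
  e ^+ 2 = map_poly iota M -> exists e0, M = e0 ^+ 2.
Proof.
move=> two mM me ee.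
have se : size e = (size e).-1.+1 by rewrite prednK // size_poly_gt0 monic_neq0.
have sM : size M = (2 * (size e).-1).+1.
  rewrite -(size_map_poly iota) -ee expr2 size_Mmonic ?monic_neq0 //.
  by move: (size e) se; clear => k; lia.
have [e0 [me0 se0 le]] := sqrt_algorithm two mM sM.
exists e0; apply/eqP; rewrite -subr_eq0; apply: contraT => D0.
have : map_poly iota (M - e0 ^+ 2) = (e - map_poly iota e0) * (e + map_poly iota e0).
  by rewrite rmorphB rmorphXn /= -ee subr_sqr.
move=> /(congr1 (fun u : {poly L} => size u)); rewrite size_map_poly.
have ms : (size (e + map_poly iota e0)%R) = size e.
  apply/eqP; rewrite eqn_leq (leq_trans (size_polyD _ _)); last first.
    by rewrite size_map_poly se0 -se maxnn.
  rewrite {1}se ltnNge; apply/negP => /leq_sizeP/(_ (size e).-1 (leqnn _)).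
  rewrite coefD coef_map /= -lead_coefE (monicP me).
  have := lead_coefE e0; rewrite se0 (monicP me0) /= => <-.
  rewrite rmorph1 -[1 + 1]/(2%:R) -(rmorph_nat iota) => /eqP.
  by rewrite fmorph_eq0 (negPf two).
have d0 : e - map_poly iota e0 != 0.
  apply: contraNneq D0 => /subr0_eq d.
  have : map_poly iota (M - e0 ^+ 2) = 0 by rewrite rmorphB rmorphXn /= -d ee subrr.
  by move=> /eqP; rewrite map_poly_eq0.
rewrite size_mul //; last by rewrite -size_poly_eq0 ms size_poly_eq0 monic_neq0.
have : (0 < size (e - map_poly iota e0)%R)%N by rewrite size_poly_gt0.
move: le se; rewrite ms; move: (size e) (size (e - _)) (size (M - _)); clear.
move=> a b c le e; lia.
Qed.

Lemma square_quotient (K : fieldType) (x a b m : K) :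
  b != 0 -> x = a / b -> x ^+ 2 = m -> a ^+ 2 = m * b ^+ 2.
Proof. by move=> b0 -> <-; rewrite expr_div_n divfK // expf_neq0. Qed.

(** L may be inseparable over E, and m need not remain square-free over L.  But a
    square root of m is a polynomial, and its monic multiple has coefficients in E. *)
Lemma nonsquare_frac (E L : fieldType) (iota : {rmorphism E -> L}) (m : {poly E}) :
  2%:R != 0 :> E -> square_free m -> (1 < size m)%N ->
  nonsquare (tofrac (map_poly iota m)).
Proof.
move=> two sqf sm x xe.
have [a [b [b0 xab]]] := frac_quotient x.
have b0' : tofrac b != 0 by rewrite tofrac_eq0.
have ab : a ^+ 2 = map_poly iota m * b ^+ 2.
  apply/eqP; rewrite -tofrac_eq tofracXn tofracM tofracXn; apply/eqP.
  exact: square_quotient b0' xab xe.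
have /dvdpP[e ae] : b %| a by rewrite -(@dvdp_pexp2r _ _ _ 2) // ab dvdp_mull.
have m0 : m != 0 by rewrite -size_poly_gt0 (ltn_trans _ sm).
have em : e ^+ 2 = map_poly iota m.
  apply: (mulIf (expf_neq0 2 b0)); rewrite -ab ae exprMn //.
have lm : lead_coef m != 0 by rewrite lead_coef_eq0.
have le2 : lead_coef e ^+ 2 = iota (lead_coef m).
  by rewrite -lead_coef_map -em lead_coef_exp.
have le : lead_coef e != 0.
  by apply: contraNneq lm => l0; rewrite -(fmorph_eq0 iota) -le2 l0 expr0n.
have [|||e0 he0] := @monic_sqrt_rational _ _ iota ((lead_coef m)^-1 *: m) ((lead_coef e)^-1 *: e) two.
- by rewrite monicE lead_coefZ mulVf.
- by rewrite monicE lead_coefZ mulVf.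
- by rewrite exprZn em map_polyZ /= fmorphV -le2 exprVn.
have := sqf e0 (lead_coef m)%:P.
rewrite mulrC mul_polyC -he0 scalerA divff // scale1r => /(_ erefl) ue.
have me : m = (lead_coef m) *: e0 ^+ 2 by rewrite -he0 scalerA divff // scale1r.
move: sm; rewrite me size_scale //.
by move: ue; rewrite poly_unitE => /andP[/eqP s1 _]; rewrite (size1_polyC (eq_leq s1)) -polyC_exp ltnNge size_polyC_leq1.
Qed.

(** This is the curve y^2 = m(t), the case f = X of [kummer_curve_point]. *)
Lemma square_value (E : fieldType) (m h : {poly E}) :
  pseudo_algebraically_closed E -> 2%:R != 0 :> E ->
  square_free m -> (1 < size m)%N -> h != 0 ->
  exists t y, h.[t] != 0 /\ m.[t] = y ^+ 2.
Proof.
move=> pac two sqf sm h0.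
have mX : ('X : {poly E}) \is monic by exact: monicX.
have sX : size ('X : {poly E}) = 2%N by rewrite size_polyX.
have sepX : separable_poly ('X : {poly E}).
  by rewrite unlock derivX coprimep1.
have X0 : ('X : {poly E}) != 0 by rewrite monic_neq0.
have [|t [z [ht dz]]] := kummer_curve_point (P := m%:P) pac two mX sX h0 sepX X0 (dvdpp _).
  move=> L iota es _ ues fes.
  have : size es = 1%N.
    by apply/eqP; rewrite -eqSS -sX -(size_map_poly iota) fes size_prod_XsubC.
  case: es ues fes => [|e [|]] // _ _ _ [|[] [|]] //= _ _.
  by rewrite big_seq1 /branch map_polyC hornerC; apply: nonsquare_frac.
exists t, z.[0]; split=> //; apply/esym/eqP; rewrite -subr_eq0.
move: dz; rewrite -['X]subr0 -polyC0 dvdp_XsubCl rootE hornerD hornerN map_polyC /=.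
by rewrite hornerC horner_exp.
Qed.

Lemma inverse_mod (E : fieldType) (a f : {poly E}) :
  coprimep a f -> exists b, f %| a * b - 1.
Proof.
move=> /Bezout_eq1_coprimepP[[u v] /= e].
by exists u; rewrite -e mulrC opprD addrA subrr sub0r dvdpNr dvdp_mull.
Qed.

Lemma coprimep_linear (E : fieldType) (f : {poly E}) t :
  coprimep (t%:P - 'X) f = (f.[t] != 0).
Proof.
have -> : t%:P - 'X = (-1) *: ('X - t%:P) by rewrite scaleN1r opprB.
by rewrite coprimepZl ?oppr_eq0 ?oner_eq0 // coprimep_sym coprimep_XsubC.
Qed.

Lemma pchar_nat_odd (E : fieldType) q : 2%:R != 0 :> E -> [pchar E].-nat q -> odd q.
Proof.
move=> two /andP[q0 /allP hq]; apply: contraNT two; rewrite -dvdn2 => q2.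
by have := hq 2%N; rewrite mem_primes q2 q0 /= => /(_ isT); rewrite !inE => /andP[_ ->].
Qed.

Lemma binomial_frobenius (R : comNzRingType) q (a b : R) :
  [pchar R].-nat q -> odd q -> (a - b) ^+ q = a ^+ q - b ^+ q.
Proof. by move=> hq oq; rewrite exprDn_pchar // exprNn -signr_odd oq expr1 mulN1r. Qed.

Lemma splits_dvdp (E L : fieldType) (iota : {rmorphism E -> L}) (g : {poly E})
    (u : {poly L}) : g != 0 -> splits_over iota g -> u %| map_poly iota g ->
  (1 < size u)%N -> exists r, root u r.
Proof.
move=> g0 [c [rs e]] ug su.
have c0 : c != 0.
  by apply: contra_neq g0 => c0; apply/eqP; rewrite -(map_poly_eq0 iota) e c0 scale0r.
rewrite e (dvdpZr _ _ c0) in ug; have [m /eqp_root er] := dvdp_prod_XsubC ug.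
have [m' hm] := dvdp_prod_XsubC ug.
move: su; rewrite (eqp_size hm); case: (mask m' rs) hm => [|r s] hm.
  by rewrite big_nil size_poly1.
by exists r; rewrite (eqp_root hm) big_cons rootM root_XsubC eqxx.
Qed.

(** The branch at a root e of F is beta(e) (T^q - e) = beta(e) (T - r)^q with r^q = e.  The
    r belonging to distinct e are distinct, and the multiplicity q is odd. *)
Lemma kummer_branches_independent (E : fieldType) (F beta alpha : {poly E}) q :
  2%:R != 0 :> E -> [pchar E].-nat q -> F != 0 -> F %| alpha * beta - 1 ->
  forall (L : fieldType) (iota : {rmorphism E -> L}) (es : seq L),
  splits_over iota (F * (F \Po 'X^q)) -> uniq es ->
  map_poly iota F = \prod_(e <- es) ('X - e%:P) ->
  square_independent
    [seq tofrac (branch (map_poly polyC beta * (('X^q)%:P - 'X)) iota e) | e <- es].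
Proof.
move=> two hq F0 Fab L iota es spl ues fes m sm hm x.
have oq := pchar_nat_odd two hq.
have q0 : (0 < q)%N by case/andP: hq.
have hqL : [pchar {poly L}].-nat q.
  by rewrite (eq_pnat _ (pchar_poly L)) (eq_pnat _ (fmorph_pchar iota)).
pose C e := (map_poly iota beta).[e].
have brE e : branch (map_poly polyC beta * (('X^q)%:P - 'X)) iota e =
    (C e)%:P * ('X^q - e%:P).
  rewrite /branch rmorphM rmorphB /= map_polyX map_polyC /= map_polyXn.
  rewrite hornerM hornerD hornerN hornerC hornerX; congr (_ * _).
  rewrite -map_poly_comp (_ : map_poly _ beta = map_poly polyC (map_poly iota beta)).
    by rewrite horner_map.
  by rewrite -map_poly_comp; apply: eq_map_poly => a /=; rewrite map_polyC.
have C0 e : e \in es -> C e != 0.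
  move=> he; have re : root (map_poly iota F) e by rewrite fes root_prod_XsubC.
  have /dvdpP[u /(congr1 (fun v => (map_poly iota v).[e]))] := Fab.
  rewrite rmorphB !rmorphM rmorph1 /= !hornerE (rootP re) mulr0 => /eqP.
  by rewrite subr_eq0; apply: contraTneq => Ce0; rewrite -/(C e) Ce0 mulr0 eq_sym oner_eq0.
rewrite -map_mask big_map -rmorph_prod /=.
under eq_bigr => e _ do rewrite brE.
set B := \prod_(e <- _) _ => xB.
have [a [b [b0 xab]]] := frac_quotient x.
have b0' : tofrac b != 0 by rewrite tofrac_eq0.
have ab : a ^+ 2 = B * b ^+ 2.
  apply/eqP; rewrite -tofrac_eq tofracXn tofracM tofracXn; apply/eqP.
  exact: square_quotient b0' xab xB.
have [e1 me1] : exists e1, e1 \in mask m es.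
  have : (0 < size (mask m es))%N.
    by rewrite size_mask ?sm ?size_map // -has_count.
  by case: (mask m es) => // e1 s _; exists e1; rewrite mem_head.
have e1s := mem_mask me1.
have [r1 rr] : exists r, root ('X^q - e1%:P) r.
  apply: splits_dvdp spl _ _.
  - by rewrite mulf_neq0 // comp_poly_eq0 // size_polyXn.
  - rewrite rmorphM dvdp_mull //= map_comp_poly map_polyXn.
    have -> : 'X^q - e1%:P = ('X - e1%:P) \Po 'X^q.
      by rewrite comp_polyB comp_polyX comp_polyC.
    by apply: dvdp_comp; rewrite fes dvdp_XsubCl root_prod_XsubC.
  - by rewrite size_XnsubC.
have r1q : r1 ^+ q = e1.
  by move: rr; rewrite rootE !hornerE subr_eq0 => /eqP.
have Bq : mup r1 B = q.
  rewrite /B (big_rem e1) //= mupMl; last first.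
    rewrite rootE horner_prod prodf_seq_neq0; apply/allP => e he /=.
    have ne : e != e1.
      by apply: contraTneq he => ->; rewrite mem_rem_uniqF ?mask_uniq.
    rewrite hornerM hornerC mulf_neq0 ?C0 ?(mem_mask (mem_rem he)) //.
    by rewrite !hornerE r1q subr_eq0 eq_sym.
  rewrite mupMr ?rootC ?C0 // -r1q polyC_exp -binomial_frobenius //.
  by rewrite mup_XsubCX eqxx.
have B0 : B != 0.
  rewrite /B prodf_seq_neq0; apply/allP => e he /=.
  by rewrite mulf_neq0 ?polyC_eq0 ?C0 ?(mem_mask he) // -size_poly_eq0 size_XnsubC.
have a0 : a != 0.
  by have := mulf_neq0 B0 (expf_neq0 2 b0); rewrite -ab expf_eq0.
have := congr1 (mup r1) ab.
rewrite !expr2 !mupM ?mulf_neq0 // Bq !addnn => /(congr1 odd).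
by rewrite oddD !odd_double oq.
Qed.

(** For f separable this is a point on the curve z^2 = beta (t - X) modulo f, where beta is
    the inverse of alpha.  In general the curve is taken for the model F of
    [separable_model] with T^q in place of T; the substitution of X^q for X then gives
    (t - X)^q = alpha^q z^2 modulo f, which suffices since q is odd. *)
Theorem square_class_value (E : fieldType) (f alpha h : {poly E}) :
  pseudo_algebraically_closed E -> 2%:R != 0 :> E ->
  radical f -> coprimep alpha f -> h != 0 ->
  exists t z, [/\ f.[t] != 0, h.[t] != 0 & f %| (t%:P - 'X) - alpha * z ^+ 2].
Proof.
move=> pac two rad cop h0; have f0 := rad.1.
have [q [phi [F0 [hq hphi sep0 F0f fF0]]]] := separable_model rad.
have oq := pchar_nat_odd two hq.
have F00 : F0 != 0 by rewrite separable_poly_neq0.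
pose F := (lead_coef F0)^-1 *: F0.
have lc0 : (lead_coef F0)^-1 != 0 by rewrite invr_eq0 lead_coef_eq0.
have mF : F \is monic by rewrite monicE lead_coefZ mulVf // lead_coef_eq0.
have Ff : F %| map_poly phi f by rewrite dvdpZl.
have fF : f %| F \Po 'X^q by rewrite comp_polyZ dvdpZr.
have sep : separable_poly F by rewrite (eqp_separable (eqp_scale F0 lc0)).
have Fn0 := monic_neq0 mF.
have [d sF] : exists d, size F = d.+1.
  by exists (size F).-1; rewrite prednK // size_poly_gt0.
have copF : coprimep (map_poly phi alpha) F.
  by apply: coprimep_dvdl Ff _; rewrite coprimep_map.
have [beta Fab] : exists beta, F %| map_poly phi alpha * beta - 1.
  exact: inverse_mod copF.
have g0 : F * (F \Po 'X^q) != 0.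
  rewrite mulf_neq0 // comp_poly_eq0 // size_polyXn; by case/andP: hq.
have [t [z [ht dz]]] := kummer_curve_point pac two mF sF (mulf_neq0 h0 f0) sep g0
  (dvdp_mulr _ (dvdpp F)) (kummer_branches_independent two hq Fn0 Fab).
move: ht; rewrite hornerM mulf_eq0 negb_or => /andP[ht ft].
pose k := q./2; have qk : q = (k * 2).+1 by rewrite -[LHS]odd_double_half oq muln2.
pose s := (t%:P - 'X) ^+ k : {poly E}.
have [s' fs] : exists s', f %| s * s' - 1.
  by apply/inverse_mod/coprimep_expl; rewrite coprimep_linear.
pose z' := z \Po 'X^q; pose b' := beta \Po 'X^q.
have tq : (t%:P - 'X) ^+ q = (t ^+ q)%:P - 'X^q :> {poly E}.
  by rewrite binomial_frobenius ?polyC_exp // pchar_nat_poly.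
have d1 : f %| z' ^+ 2 - b' * (t%:P - 'X) ^+ q.
  apply: (dvdp_trans fF); have := dvdp_comp 'X^q dz.
  have -> : map_poly (horner_eval t) (map_poly polyC beta * (('X^q)%:P - 'X)) =
            beta * ((t ^+ q)%:P - 'X).
    rewrite rmorphM rmorphB /= map_polyX map_polyC -map_poly_comp map_poly_id.
      by rewrite /= /horner_eval hornerXn.
    by move=> x _ /=; rewrite /horner_eval hornerC.
  by rewrite !(comp_polyB, comp_polyM, comp_polyX, comp_polyC) tq expr2.
have d2 : f %| alpha ^+ q * b' - 1.
  apply: (dvdp_trans fF); have := dvdp_comp 'X^q Fab.
  by rewrite comp_polyB comp_polyM (frobenius_comp _ hq hphi) -polyC1 comp_polyC.
exists t, (alpha ^+ k * z' * s'); split=> //.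
have tE : (t%:P - 'X) ^+ q = (t%:P - 'X) * s ^+ 2 :> {poly E}.
  by rewrite {1}qk exprS /s -exprM.
have aE : alpha ^+ q = alpha * (alpha ^+ k) ^+ 2 by rewrite {1}qk exprS -exprM.
move: d1 d2; rewrite tE aE; move: (alpha ^+ k) => ak; set w := t%:P - 'X => d1 d2.
have -> : w - alpha * (ak * z' * s') ^+ 2 =
  - (s' ^+ 2 * (alpha * ak ^+ 2 * (z' ^+ 2 - b' * (w * s ^+ 2)) +
      w * s ^+ 2 * (alpha * ak ^+ 2 * b' - 1))) - w * (s * s' + 1) * (s * s' - 1).
  by ring.
by rewrite dvdp_sub ?dvdpNr ?dvdp_mull // dvdp_add ?dvdp_mull.
Qed.

(** * Radical and square-free polynomials *)

Section Radical.
Variable E : fieldType.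
Implicit Types f g p : {poly E}.

Lemma irreducible_coprime p a : irreducible_poly p -> coprimep a p = ~~ (p %| a).
Proof.
move=> irr; rewrite coprimep_sym; apply/idP/idP => [cop|ndiv].
  apply/negP => pa; have := coprimep_dvdl pa cop; rewrite coprimepp => /eqP sp.
  by case: irr; rewrite sp.
apply/coprimepP => d dp da; case: irr => p1 irr.
have [/eqP sd|sd] := boolP (size d == 1%N); first by rewrite -size_poly_eq1 sd.
case/negP: ndiv; have := irr d sd dp => /eqp_dvdl <-; exact: da.
Qed.

Lemma irreducible_dvdM p a b : irreducible_poly p -> p %| a * b -> (p %| a) || (p %| b).
Proof.
move=> irr pab; have [//|na] /= := boolP (p %| a).
by rewrite -(@Gauss_dvdpr _ _ a) // coprimep_sym irreducible_coprime.
Qed.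

Lemma radical_irreducible p : irreducible_poly p -> radical p.
Proof.
move=> irr; split; first exact: irredp_neq0.
move=> g [|k]; first by rewrite expr0 dvdp1 => /eqP sp; case: irr; rewrite sp.
elim: k => [|k IH]; first by rewrite expr1.
by rewrite exprS => /(irreducible_dvdM irr)/orP[].
Qed.

Lemma radical_mul f g : coprimep f g -> radical f -> radical g -> radical (f * g).
Proof.
move=> cop [f0 rf] [g0 rg]; split; first by rewrite mulf_neq0.
move=> a k; rewrite !Gauss_dvdp // => /andP[fa ga].
by rewrite (rf _ _ fa) (rg _ _ ga).
Qed.

Lemma radical_unit f : size f = 1%N -> radical f.
Proof.
move=> sf; split; first by rewrite -size_poly_eq0 sf.
move=> g k _; rewrite (size1_polyC (eq_leq sf)) -[_%:P]mulr1 mul_polyC dvdpZl ?dvd1p //.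
by rewrite -polyC_eq0 -(size1_polyC (eq_leq sf)) -size_poly_eq0 sf.
Qed.

Lemma square_free_neq0 f : square_free f -> f != 0.
Proof.
move=> sq; apply/eqP => f0; have := sq 0 0.
by rewrite mulr0 f0 unitr0 => /(_ erefl).
Qed.

Lemma square_free_radical f : square_free f -> radical f.
Proof.
have [n] := ubnP (size f); elim: n f => // n IH f sn sqf.
have f0 := square_free_neq0 sqf.
have [s1|s1] := leqP (size f) 1.
  by apply: radical_unit; apply/eqP; rewrite eqn_leq s1 size_poly_gt0.
have [p [irr /dvdpP[g fe]]] := irreducible_factor s1.
have p0 := irredp_neq0 irr; have sp : (1 < size p)%N by case: irr.
have g0 : g != 0 by apply: contraNneq f0 => e; rewrite fe e mul0r.
rewrite fe; apply: radical_mul; last exact: radical_irreducible.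
- rewrite irreducible_coprime //; apply/negP => /dvdpP[u ge].
  have := sqf p u; rewrite fe ge -mulrA mulrC expr2 => /(_ erefl).
  by rewrite poly_unitE => /andP[/eqP s _]; rewrite s in sp.
- apply: IH.
    have := sn; rewrite fe size_mul // ltnS => le.
    have : (0 < size g)%N by rewrite size_poly_gt0.
    move: le sp; move: (size g) (size p) => k l; clear; lia.
  by move=> x y e; apply: (sqf x (y * p)); rewrite fe e mulrA.
Qed.

Lemma radical_square_free f : radical f -> square_free f.
Proof.
move=> [f0 rad] x y fe.
have : f %| x * y.
  apply: (rad _ 2%N); rewrite fe exprMn dvdp_mul // expr2 dvdp_mulr //.
have [x0 y0] : x != 0 /\ y != 0.
  by apply/andP; move: f0; rewrite fe mulf_eq0 expf_eq0 /= negb_or.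
rewrite {1}fe expr2 -mulrA dvdp_mul2l // -[X in _ %| X]mul1r dvdp_mul2r // dvdp1 => /eqP sx.
rewrite poly_unitE sx eqxx /= unitfE.
by have := lead_coefE x; rewrite sx /= => <-; rewrite lead_coef_eq0.
Qed.

Lemma chinese_poly f g a b : coprimep f g ->
  exists c, f %| c - a /\ g %| c - b.
Proof.
move=> /Bezout_eq1_coprimepP[[u v] /= e].
exists (u * f * b + v * g * a); split.
  have -> : u * f * b + v * g * a - a = f * (u * b - u * a).
    by rewrite -[X in _ - X]mul1r -e; ring.
  exact: dvdp_mulr.
have -> : u * f * b + v * g * a - b = g * (v * a - v * b).
  by rewrite -[X in _ - X]mul1r -e; ring.
exact: dvdp_mulr.
Qed.

Lemma irreducible_shift p c : irreducible_poly p -> irreducible_poly (p \Po ('X - c%:P)).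
Proof.
move=> [sp irr]; split; first by rewrite size_comp_poly2 // size_XsubC.
have shift (q : {poly E}) d : (q \Po ('X - d%:P)) \Po ('X + d%:P) = q.
  by rewrite -comp_polyA comp_polyB comp_polyX comp_polyC addrK comp_polyXr.
move=> q sq qp; have sq' : size (q \Po ('X + c%:P)) = size q.
  by rewrite size_comp_poly2 // size_XaddC.
have : q \Po ('X + c%:P) %= p.
  by apply: irr; rewrite ?sq' // -[p](shift p c) dvdp_comp.
move=> /andP[d1 d2].
have back : (q \Po ('X + c%:P)) \Po ('X - c%:P) = q.
  by have := shift q (- c); rewrite polyCN opprK.
by rewrite -back; apply/andP; split; apply: dvdp_comp.
Qed.

End Radical.

(** * Diagonal forms *)

(** Isotropy of the diagonal form with the coefficients a; vectors are functions on nat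
    so that forms of all dimensions are handled as lists. *)
Definition iso (K : fieldType) (a : seq K) := exists x : nat -> K,
  (exists i, (i < size a)%N /\ x i != 0) /\ \sum_(i < size a) a`_i * x i ^+ 2 = 0.

Definition conics_isotropic (K : fieldType) := forall a b c : K, iso [:: a; b; c].

Section IsoSmall.
Variable K : fieldType.
Implicit Types a b c d : K.

Lemma iso2P a b : iso [:: a; b] <->
  exists x y, (x != 0) || (y != 0) /\ a * x ^+ 2 + b * y ^+ 2 = 0.
Proof.
split=> [[x [[i [hi xi]] e]]|[x [y [h e]]]].
  exists (x 0%N), (x 1%N); split; last by rewrite -[RHS]e !big_ord_recl big_ord0 /= addr0.
  by case: i hi xi => [|[|]] //= _ ->; rewrite ?orbT.
exists (fun i => nth 0 [:: x; y] i); split.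
  by case/orP: h => h; [exists 0%N | exists 1%N].
by rewrite !big_ord_recl big_ord0 /= addr0.
Qed.

Lemma iso3P a b c : iso [:: a; b; c] <->
  exists x y z, [|| x != 0, y != 0 | z != 0] /\
    a * x ^+ 2 + b * y ^+ 2 + c * z ^+ 2 = 0.
Proof.
split=> [[x [[i [hi xi]] e]]|[x [y [z [h e]]]]].
  exists (x 0%N), (x 1%N), (x 2%N); split.
    by case: i hi xi => [|[|[|]]] //= _ ->; rewrite ?orbT.
  by rewrite -[RHS]e !big_ord_recl big_ord0 /= addr0 addrA.
exists (fun i => nth 0 [:: x; y; z] i); split.
  by case/or3P: h => h; [exists 0%N | exists 1%N | exists 2%N].
by rewrite !big_ord_recl big_ord0 /= addr0 addrA.
Qed.

Lemma iso4P a b c d : iso [:: a; b; c; d] <->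
  exists x y z t, [|| x != 0, y != 0, z != 0 | t != 0] /\
    a * x ^+ 2 + b * y ^+ 2 + c * z ^+ 2 + d * t ^+ 2 = 0.
Proof.
split=> [[x [[i [hi xi]] e]]|[x [y [z [t [h e]]]]]].
  exists (x 0%N), (x 1%N), (x 2%N), (x 3%N); split.
    by case: i hi xi => [|[|[|[|]]]] //= _ ->; rewrite ?orbT.
  by rewrite -[RHS]e !big_ord_recl big_ord0 /= addr0 !addrA.
exists (fun i => nth 0 [:: x; y; z; t] i); split.
  by case/or4P: h => h; [exists 0%N | exists 1%N | exists 2%N | exists 3%N].
by rewrite !big_ord_recl big_ord0 /= addr0 !addrA.
Qed.

End IsoSmall.

(** * Conics over residue fields *)

Section ResidueConics.
Variable E : fieldType.
Hypotheses (pac : pseudo_algebraically_closed E) (two : 2%:R != 0 :> E).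

(** If p and p(X - s^2) are not coprime they are equal, whence p(-s^2) = p(0); this
    excludes finitely many s^2.  A field E that is pseudo-algebraically closed has a
    square outside a finite set by [square_value]. *)
Lemma translate_coprime (p : {poly E}) : irreducible_poly p ->
  exists s, s != 0 /\ coprimep p (p \Po ('X - (s ^+ 2)%:P)).
Proof.
move=> irr; have [sp _] := irr.
pose h := p \Po (- 'X) - (p.[0])%:P.
have s2 : size (- 'X : {poly E}) = 2%N by rewrite size_polyN size_polyX.
have h0 : h != 0.
  apply: contraTneq sp => /subr0_eq e.
  by rewrite -(size_comp_poly2 p s2) e size_polyC; case: (p.[0] != 0).
have rX : radical ('X : {poly E}).
  by apply: radical_irreducible; rewrite -['X]subr0 -polyC0; apply: irredp_XsubC.
have [|t [y [ht ty]]] := square_value pac two (radical_square_free rX) _ h0.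
  by rewrite size_polyX.
rewrite hornerX in ty.
have pt : p.[- t] != p.[0].
  by move: ht; rewrite /h hornerD hornerN horner_comp hornerN hornerX hornerC subr_eq0.
exists y; split.
  by apply: contraNneq pt => y0; rewrite ty y0 expr0n oppr0.
rewrite -ty irreducible_coprime; last exact: irreducible_shift.
apply: contraNN pt => pd.
have sz : size (p \Po ('X - t%:P)) = size p by rewrite size_comp_poly2 // size_XsubC.
have p0 := irredp_neq0 irr.
have /eqp_eq : p \Po ('X - t%:P) %= p by rewrite -dvdp_size_eqp ?sz.
rewrite lead_coef_comp ?size_XsubC // lead_coefXsubC expr1n mulr1.
have lp : lead_coef p != 0 by rewrite lead_coef_eq0.
move=> /(scalerI lp)/(congr1 (fun q : {poly E} => q.[0])).
by rewrite horner_comp !hornerE => ->.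
Qed.

(** Modulo p (X) p(X - s^2), [square_class_value] gives a single t such that t - X is in the
    class of -a/c modulo p, and so is t - X - s^2 in the class of b/c.  The difference of
    the two is the square s^2. *)
Lemma residue_conic (p a b c : {poly E}) : irreducible_poly p ->
  ~~ (p %| a) -> ~~ (p %| b) -> ~~ (p %| c) ->
  exists x y z, ~~ (p %| z) /\ p %| a * x ^+ 2 + b * y ^+ 2 + c * z ^+ 2.
Proof.
move=> irr na nb nc; have [sp _] := irr.
have [s [s0 cop]] := translate_coprime irr.
set tr : {poly E} := 'X - (s ^+ 2)%:P in cop.
pose rt : {poly E} := 'X + (s ^+ 2)%:P.
have trK q : (q \Po tr) \Po rt = q.
  by rewrite -comp_polyA /tr comp_polyB comp_polyX comp_polyC addrK comp_polyXr.
have irr' : irreducible_poly (p \Po tr) by exact: irreducible_shift.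
have [c' hc'] : exists c', p %| c * c' - 1.
  by apply: inverse_mod; rewrite irreducible_coprime.
have nc' : ~~ (p %| c').
  apply/negP => pc; move: hc'; rewrite dvdp_addr ?dvdp_mull // dvdpNr dvdp1 => /eqP s1.
  by rewrite s1 in sp.
pose A := - (a * c'); pose B := b * c'.
have nA : ~~ (p %| A) by rewrite dvdpNr; apply/negP => /(irreducible_dvdM irr); rewrite (negPf na) (negPf nc').
have nB : ~~ (p %| B) by apply/negP => /(irreducible_dvdM irr); rewrite (negPf nb) (negPf nc').
have [al [al1 al2]] := chinese_poly A (B \Po tr) cop.
have radf : radical (p * (p \Po tr)).
  by apply: radical_mul => //; apply: radical_irreducible.
have copal : coprimep al (p * (p \Po tr)).
  rewrite coprimepMr !irreducible_coprime //; apply/andP; split.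
    by rewrite -[al](subrK A) dvdp_addr.
  rewrite -[al](subrK (B \Po tr)) dvdp_addr //.
  by apply: contra nB => /(dvdp_comp rt); rewrite !trK.
have [t [z [_ _ dz]]] := square_class_value pac two radf copal (oner_neq0 _).
have d1 : p %| (t%:P - 'X) - A * z ^+ 2.
  have -> : (t%:P - 'X) - A * z ^+ 2 = (t%:P - 'X - al * z ^+ 2) + (al - A) * z ^+ 2 by ring.
  by rewrite dvdp_add ?dvdp_mulr // (dvdp_trans _ dz) // dvdp_mulr.
have d2 : p %| (t%:P - rt) - B * (z \Po rt) ^+ 2.
  have : p \Po tr %| (t%:P - 'X) - (B \Po tr) * z ^+ 2.
    have -> : (t%:P - 'X) - (B \Po tr) * z ^+ 2 =
      (t%:P - 'X - al * z ^+ 2) + (al - (B \Po tr)) * z ^+ 2 by ring.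
    by rewrite dvdp_add ?dvdp_mulr // (dvdp_trans _ dz) // dvdp_mull.
  move=> /(dvdp_comp rt); rewrite trK comp_polyB [(_ * z ^+ 2) \Po _]comp_polyM trK rmorphXn /= comp_polyB.
  by rewrite comp_polyX comp_polyC.
exists z, (z \Po rt), s%:P; split.
  apply/negP => /(dvdp_leq _); rewrite polyC_eq0 s0 size_polyC s0 => /(_ isT).
  by rewrite leqNgt sp.
have -> : a * z ^+ 2 + b * (z \Po rt) ^+ 2 + c * s%:P ^+ 2 =
   c * ((t%:P - 'X) - A * z ^+ 2) - c * ((t%:P - rt) - B * (z \Po rt) ^+ 2)
   - (c * c' - 1) * (a * z ^+ 2 + b * (z \Po rt) ^+ 2).
  rewrite /A /B /rt polyC_exp; ring.
apply: dvdp_sub; last exact: dvdp_mulr.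
apply: dvdp_sub; exact: dvdp_mull.
Qed.

(** Evaluation at r identifies E[X]/(p) with K. *)
Lemma conics_isotropic_extension (p : {poly E}) (K : fieldType)
    (j : {rmorphism E -> K}) (r : K) :
  irreducible_poly p -> root (map_poly j p) r ->
  (forall x, exists g, x = (map_poly j g).[r]) -> conics_isotropic K.
Proof.
move=> irr rp gen a b c.
have div g : p %| g <-> (map_poly j g).[r] = 0.
  split=> [/dvdpP[u ->]|g0]; first by rewrite rmorphM hornerM (rootP rp) mulr0.
  apply: contraT; rewrite -irreducible_coprime // => /inverse_mod[b' /dvdpP[u]].
  move=> /(congr1 (fun v => (map_poly j v).[r])).
  rewrite rmorphB !rmorphM rmorph1 /= hornerD hornerN !hornerM g0 mul0r hornerC.
  by rewrite (rootP rp) mulr0 sub0r => /eqP; rewrite oppr_eq0 oner_eq0.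
have [a0|a0] := eqVneq a 0.
  by apply/iso3P; exists 1, 0, 0; rewrite oner_eq0 a0; split=> //; rewrite !mul0r expr0n !mulr0 !addr0.
have [b0|b0] := eqVneq b 0.
  by apply/iso3P; exists 0, 1, 0; rewrite oner_eq0 b0 orbT; split=> //; rewrite !mul0r expr0n !mulr0 !addr0.
have [c0|c0] := eqVneq c 0.
  by apply/iso3P; exists 0, 0, 1; rewrite oner_eq0 c0 !orbT; split=> //; rewrite !mul0r expr0n !mulr0 !addr0.
have [ga ea] := gen a; have [gb eb] := gen b; have [gc ec] := gen c.
have nd g x : x = (map_poly j g).[r] -> x != 0 -> ~~ (p %| g).
  by move=> -> x0; apply/negP => /div e; rewrite e eqxx in x0.
have [x [y [z [nz d]]]] := residue_conic irr (nd _ _ ea a0) (nd _ _ eb b0) (nd _ _ ec c0).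
apply/iso3P; exists (map_poly j x).[r], (map_poly j y).[r], (map_poly j z).[r].
split; last by have /div := d; rewrite !(rmorphD, rmorphM, expr2) /= !(hornerD, hornerM) -ea -eb -ec.
suff -> : (map_poly j z).[r] != 0 by rewrite !orbT.
by apply/negP => /eqP/div; rewrite (negPf nz).
Qed.

Lemma pac_conics : conics_isotropic E.
Proof.
apply: (@conics_isotropic_extension 'X _ idfun 0).
- by rewrite -['X]subr0 -polyC0; apply: irredp_XsubC.
- by rewrite map_polyX rootX.
- by move=> x; exists x%:P; rewrite map_polyC hornerC.
Qed.

End ResidueConics.

Local Open Scope quotient_scope.

(** * Valuations *)

Section Valuation.
Variables (F : fieldType) (v : F -> int).
Hypothesis Hv : Z_valuation v.

Lemma valM x y : x != 0 -> y != 0 -> v (x * y) = v x + v y.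
Proof. by case: Hv => h _ _; apply: h. Qed.

Lemma val_geD m x y : val_ge v m x -> val_ge v m y -> val_ge v m (x + y).
Proof. by case: Hv => _ h _; apply: h. Qed.

Lemma val1 : v 1 = 0.
Proof.
have := valM (oner_neq0 F) (oner_neq0 F); rewrite mulr1 => /eqP.
by rewrite -{1}[v 1]addr0 (inj_eq (addrI _)) eq_sym => /eqP.
Qed.

Lemma valN x : v (- x) = v x.
Proof.
have [->|x0] := eqVneq x 0; first by rewrite oppr0.
have m1 : (-1 : F) != 0 by rewrite oppr_eq0 oner_eq0.
have : v (-1) = 0.
  have := valM m1 m1; rewrite mulrNN mulr1 val1; lia.
by move=> vm; rewrite -[- x]mulN1r valM // vm add0r.
Qed.

Lemma valV x : x != 0 -> v x^-1 = - v x.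
Proof.
move=> x0; have := valM x0 (invr_neq0 x0); rewrite mulfV // val1; lia.
Qed.

Lemma valX x n : x != 0 -> v (x ^+ n) = v x *+ n.
Proof.
by move=> x0; elim: n => [|n IH]; rewrite ?expr0 ?val1 // exprS valM ?expf_neq0 // IH mulrS.
Qed.

Lemma val_ge0 m : val_ge v m 0. Proof. by rewrite /val_ge eqxx. Qed.

Lemma val_ge_neq0 m x : x != 0 -> val_ge v m x = (m <= v x).
Proof. by rewrite /val_ge => /negPf ->. Qed.

Lemma val_geN m x : val_ge v m (- x) = val_ge v m x.
Proof. by rewrite /val_ge oppr_eq0 valN. Qed.

Lemma val_geB m x y : val_ge v m x -> val_ge v m y -> val_ge v m (x - y).
Proof. by move=> hx hy; apply: val_geD; rewrite ?val_geN. Qed.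

Lemma val_ge_sym m x y : val_ge v m (x - y) = val_ge v m (y - x).
Proof. by rewrite -val_geN opprB. Qed.

Lemma val_geW m n x : m <= n -> val_ge v n x -> val_ge v m x.
Proof. by rewrite /val_ge => mn /orP[-> //|le]; rewrite (le_trans mn le) orbT. Qed.

Lemma val_geM m n x y : val_ge v m x -> val_ge v n y -> val_ge v (m + n) (x * y).
Proof.
have [->|x0] := eqVneq x 0; first by rewrite mul0r !val_ge0.
have [->|y0] := eqVneq y 0; first by rewrite mulr0 !val_ge0.
by rewrite !val_ge_neq0 ?mulf_neq0 // valM //; apply: lerD.
Qed.

Lemma val_ge_sum m n (G : 'I_n -> F) :
  (forall i, val_ge v m (G i)) -> val_ge v m (\sum_i G i).
Proof.
by move=> h; elim/big_ind: _ => //; [exact: val_ge0 | exact: val_geD].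
Qed.

Lemma val_perturb x y : x != 0 -> val_ge v (v x + 1) y -> x + y != 0 /\ v (x + y) = v x.
Proof.
move=> x0 hy; have ne : x + y != 0.
  apply/eqP => e; have : x = - y by apply/eqP; rewrite -addr_eq0 e.
  move=> xy; have y0 : y != 0 by rewrite -oppr_eq0 -xy.
  have vy : v y = v x by rewrite xy valN.
  by move: hy; rewrite val_ge_neq0 // vy lezD1 ltxx.
split=> //; apply/eqP; rewrite eq_le; apply/andP; split.
  rewrite leNgt -lezD1; apply/negP => h.
  have : val_ge v (v x + 1) (x + y - y) by apply: val_geB; rewrite // val_ge_neq0.
  by rewrite addrK val_ge_neq0 // lezD1 ltxx.
have : val_ge v (v x) (x + y).
  by apply: val_geD; [rewrite val_ge_neq0 | apply: val_geW hy; rewrite lerDl].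
by rewrite val_ge_neq0.
Qed.

Lemma val_ge_all x : (forall m, val_ge v m x) -> x = 0.
Proof.
move=> h; apply/eqP; apply: contraT => x0; have := h (v x + 1).
by rewrite val_ge_neq0 // lezD1 ltxx.
Qed.

End Valuation.

(** * Existence of completions *)

Section Completion.
Variables (F : fieldType) (v : F -> int).
Hypothesis Hv : Z_valuation v.

Definition null (s : nat -> F) := forall m : int, exists N : nat,
  forall i, (N <= i)%N -> val_ge v m (s i).

Record cauchy := Cauchy { cseq :> nat -> F; cauchyP : cauchy_seq v cseq }.
HB.instance Definition _ := gen_eqMixin cauchy.
HB.instance Definition _ := gen_choiceMixin cauchy.

Definition ceq (s t : cauchy) : bool := `[< null (fun i => s i - t i) >].

Lemma nullD s t : null s -> null t -> null (fun i => s i + t i).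
Proof.
move=> hs ht m; have [N hN] := hs m; have [N' hN'] := ht m.
exists (maxn N N') => i; rewrite geq_max => /andP[i1 i2].
by apply: (val_geD Hv); [apply: hN | apply: hN'].
Qed.

Lemma nullN s : null s -> null (fun i => - s i).
Proof. by move=> hs m; have [N hN] := hs m; exists N => i /hN; rewrite val_geN. Qed.

Lemma ceq_refl : reflexive ceq.
Proof. by move=> s; apply/asboolP => m; exists 0%N => i _; rewrite subrr val_ge0. Qed.

Lemma ceq_sym : ssrbool.symmetric ceq.
Proof.
suff h s t : ceq s t -> ceq t s by move=> s t; apply/idP/idP; apply: h.
move=> /asboolP /nullN hs; apply/asboolP => m; have [N hN] := hs m.
by exists N => i /hN; rewrite opprB.
Qed.

Lemma ceq_trans : transitive ceq.
Proof.
move=> t s u /asboolP h1 /asboolP h2; apply/asboolP => m.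
have [N hN] := nullD h1 h2 m; exists N => i /hN.
by rewrite addrA subrK.
Qed.

Canonical ceq_equiv := EquivRel ceq ceq_refl ceq_sym ceq_trans.

Definition completion := {eq_quot ceq}.
HB.instance Definition _ : EqQuotient _ ceq completion := EqQuotient.on completion.
HB.instance Definition _ := Choice.on completion.

Lemma pi_eq (s t : cauchy) :
  (\pi_completion s = \pi_completion t) <-> null (fun i => s i - t i).
Proof. by split=> [/eqmodP/asboolP|h] //; apply/eqmodP/asboolP. Qed.

Lemma repr_pi (s : cauchy) : null (fun i => repr (\pi_completion s) i - s i).
Proof. by apply/pi_eq; rewrite reprK. Qed.

Lemma cauchy_bounded (s : cauchy) : exists m : int, exists N : nat,
  forall i, (N <= i)%N -> val_ge v m (s i).
Proof.
have [N hN] := cauchyP s 0.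
have [sN|sN] := eqVneq (s N) 0.
  by exists 0, N => i Ni; have := hN i N Ni (leqnn N); rewrite sN subr0.
exists (Num.min 0 (v (s N))), N => i Ni; rewrite -[s i](subrK (s N)); apply: (val_geD Hv).
  by apply: (@val_geW _ _ _ 0); [rewrite ge_min lexx | apply: hN].
by apply: (@val_geW _ _ _ (v (s N))); [rewrite ge_min lexx orbT | rewrite val_ge_neq0].
Qed.

Lemma const_cauchy x : cauchy_seq v (fun=> x).
Proof. by move=> m; exists 0%N => i j _ _; rewrite subrr val_ge0. Qed.
Definition cconst x : cauchy := Cauchy (const_cauchy x).

Lemma add_cauchy (s t : cauchy) : cauchy_seq v (fun i => s i + t i).
Proof.
move=> m; have [N hN] := cauchyP s m; have [N' hN'] := cauchyP t m.
exists (maxn N N') => i j; rewrite !geq_max => /andP[i1 i2] /andP[j1 j2].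
have -> : s i + t i - (s j + t j) = (s i - s j) + (t i - t j) by ring.
by apply: (val_geD Hv); [apply: hN | apply: hN'].
Qed.
Definition cadd s t : cauchy := Cauchy (add_cauchy s t).

Lemma opp_cauchy (s : cauchy) : cauchy_seq v (fun i => - s i).
Proof.
move=> m; have [N hN] := cauchyP s m; exists N => i j hi hj.
by rewrite -opprD val_geN //; apply: hN.
Qed.
Definition copp s : cauchy := Cauchy (opp_cauchy s).

Lemma null_mul s (t : cauchy) : null s -> null (fun i => s i * t i).
Proof.
move=> hs m; have [b [N hN]] := cauchy_bounded t; have [N' hN'] := hs (m - b).
exists (maxn N N') => i; rewrite geq_max => /andP[i1 i2].
by rewrite -[m](subrK b); apply: (val_geM Hv); [apply: hN' | apply: hN].
Qed.

Lemma mul_cauchy (s t : cauchy) : cauchy_seq v (fun i => s i * t i).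
Proof.
move=> m; have [b [N hN]] := cauchy_bounded s; have [c [M hM]] := cauchy_bounded t.
have [N' hN'] := cauchyP s (m - c); have [M' hM'] := cauchyP t (m - b).
exists (maxn (maxn N M) (maxn N' M')) => i j.
rewrite !geq_max => /andP[/andP[i1 i2] /andP[i3 i4]] /andP[/andP[j1 j2] /andP[j3 j4]].
have -> : s i * t i - s j * t j = (s i - s j) * t i + s j * (t i - t j) by ring.
apply: (val_geD Hv).
  by rewrite -[m](subrK c); apply: (val_geM Hv); [apply: hN' | apply: hM].
by rewrite -[m](subrK b) addrC; apply: (val_geM Hv); [apply: hN | apply: hM'].
Qed.
Definition cmul s t : cauchy := Cauchy (mul_cauchy s t).

Definition stable (s : nat -> F) (m : int) := exists N : nat,
  forall i, (N <= i)%N -> s i != 0 /\ v (s i) = m.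

(** The valuation is eventually constant along a Cauchy sequence that does not tend to 0. *)
Lemma stable_val (s : cauchy) : ~ null s -> exists m, stable s m.
Proof.
move=> nn; have [m hm] : exists m, forall N, exists i, (N <= i)%N /\ ~~ val_ge v m (s i).
  apply: contrapT => h; apply: nn => m; apply: contrapT => h'; apply: h; exists m => N.
  apply: contrapT => h''; apply: h'; exists N => i Ni; apply: contrapT => /negP h3.
  by apply: h''; exists i.
have [N hN] := cauchyP s m; have [k [Nk hk]] := hm N.
have sk0 : s k != 0 by apply: contraNneq hk => ->; rewrite val_ge0.
rewrite val_ge_neq0 // -ltNge in hk.
exists (v (s k)), N => i Ni; have := @val_perturb _ _ Hv (s k) (s i - s k) sk0.
rewrite addrCA subrr addr0; apply; apply: val_geW (hN i k Ni Nk).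
by rewrite lezD1.
Qed.

Lemma inv_cauchy (s : cauchy) : ~ null s -> cauchy_seq v (fun i => (s i)^-1).
Proof.
move=> /stable_val[n [N hN]] m; have [N' hN'] := cauchyP s (m + n + n).
exists (maxn N N') => i j; rewrite !geq_max => /andP[i1 i2] /andP[j1 j2].
have [si vi] := hN i i1; have [sj vj] := hN j j1.
have -> : (s i)^-1 - (s j)^-1 = (s j - s i) * ((s i)^-1 * (s j)^-1).
  by field; rewrite si sj.
have -> : m = (m + n + n) + (- n - n) by lia.
apply: (val_geM Hv); first exact: hN'.
by rewrite val_ge_neq0 ?mulf_neq0 ?invr_neq0 // valM ?invr_neq0 // !valV // vi vj.
Qed.
Definition cinv (s : cauchy) : cauchy :=
  if pselect (null s) is right h then Cauchy (inv_cauchy h) else cconst 0.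

Definition kadd (x y : completion) : completion := \pi_completion (cadd (repr x) (repr y)).
Definition kopp (x : completion) : completion := \pi_completion (copp (repr x)).
Definition kmul (x y : completion) : completion := \pi_completion (cmul (repr x) (repr y)).
Definition kinv (x : completion) : completion := \pi_completion (cinv (repr x)).
Definition kconst x : completion := \pi_completion (cconst x).

Lemma null_ext s t : s =1 t -> null s -> null t.
Proof. by move=> e h m; have [N hN] := h m; exists N => i /hN; rewrite e. Qed.

Lemma null_zero s : (forall i, s i = 0) -> null s.
Proof. by move=> h m; exists 0%N => i _; rewrite h val_ge0. Qed.

Lemma kaddE s t : kadd (\pi_completion s) (\pi_completion t) = \pi_completion (cadd s t).
Proof.
apply/pi_eq; apply: null_ext (nullD (repr_pi s) (repr_pi t)) => i /=.
rewrite /=; ring.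
Qed.

Lemma koppE s : kopp (\pi_completion s) = \pi_completion (copp s).
Proof.
apply/pi_eq; apply: null_ext (nullN (repr_pi s)) => i /=.
rewrite /=; ring.
Qed.

Lemma kmulE s t : kmul (\pi_completion s) (\pi_completion t) = \pi_completion (cmul s t).
Proof.
apply/pi_eq.
apply: null_ext (nullD (null_mul (repr (\pi_completion t)) (repr_pi s))
                       (null_mul s (repr_pi t))) => i /=.
rewrite /=; ring.
Qed.

Lemma kaddA : associative kadd.
Proof.
elim/quotW=> x; elim/quotW=> y; elim/quotW=> z; rewrite (kaddE y z) (kaddE x y) !kaddE.
apply/pi_eq; apply: null_zero => i /=; ring.
Qed.

Lemma kaddC : commutative kadd.
Proof.
elim/quotW=> x; elim/quotW=> y; rewrite !kaddE.
apply/pi_eq; apply: null_zero => i /=; ring.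
Qed.

Lemma kadd0 : left_id (kconst 0) kadd.
Proof.
elim/quotW=> x; rewrite !kaddE.
apply/pi_eq; apply: null_zero => i /=; ring.
Qed.

Lemma kaddN : left_inverse (kconst 0) kopp kadd.
Proof.
elim/quotW=> x; rewrite koppE kaddE.
apply/pi_eq; apply: null_zero => i /=; ring.
Qed.

HB.instance Definition _ := GRing.isZmodule.Build completion kaddA kaddC kadd0 kaddN.

Lemma kmulA : associative kmul.
Proof.
elim/quotW=> x; elim/quotW=> y; elim/quotW=> z; rewrite (kmulE y z) (kmulE x y) !kmulE.
apply/pi_eq; apply: null_zero => i /=; ring.
Qed.

Lemma kmulC : commutative kmul.
Proof.
elim/quotW=> x; elim/quotW=> y; rewrite !kmulE.
apply/pi_eq; apply: null_zero => i /=; ring.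
Qed.

Lemma kmul1 : left_id (kconst 1) kmul.
Proof.
elim/quotW=> x; rewrite !kmulE.
apply/pi_eq; apply: null_zero => i /=; ring.
Qed.

Lemma kmulD : left_distributive kmul kadd.
Proof.
elim/quotW=> x; elim/quotW=> y; elim/quotW=> z.
rewrite (kaddE x y) (kmulE x z) (kmulE y z) kmulE kaddE.
apply/pi_eq; apply: null_zero => i /=; ring.
Qed.

Lemma pi_eq0 s : (\pi_completion s = 0) <-> null s.
Proof.
split=> [/pi_eq|h]; first by apply: null_ext => i /=; rewrite /= subr0.
by apply/pi_eq; apply: null_ext h => i /=; rewrite /= subr0.
Qed.

Lemma kone_neq0 : kconst 1 != 0 :> completion.
Proof.
apply/eqP => /pi_eq0/(_ 1)[N /(_ N (leqnn N))].
by rewrite val_ge_neq0 ?oner_eq0 // val1.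
Qed.

HB.instance Definition _ :=
  GRing.Zmodule_isComNzRing.Build completion kmulA kmulC kmul1 kmulD kone_neq0.

Lemma kmulV (x : completion) : x != 0 -> kmul (kinv x) x = 1.
Proof.
move=> x0; have nn : ~ null (repr x).
  by move=> /pi_eq0 /eqP; rewrite reprK (negPf x0).
rewrite /kinv -{2}[x]reprK kmulE.
apply/pi_eq => m; have [n [N hN]] := stable_val nn; exists N => i /hN[xi _].
rewrite /cinv; case: pselect => // h.
by rewrite /= mulVf // subrr val_ge0.
Qed.

Lemma kinv0 : kinv 0 = 0.
Proof.
have h0 : null (repr (0 : completion)) by apply/pi_eq0; rewrite reprK.
by apply/pi_eq0; rewrite /cinv; case: pselect => // _; apply/pi_eq0.
Qed.

HB.instance Definition _ := GRing.ComNzRing_isField.Build completion kmulV kinv0.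


Lemma stable_unique s m n : stable s m -> stable s n -> m = n.
Proof.
move=> [N hN] [M hM].
have [_ <-] := hN (maxn N M) (leq_maxl _ _); by have [_ <-] := hM (maxn N M) (leq_maxr _ _).
Qed.

Lemma stable_equiv s t m : stable s m -> null (fun i => t i - s i) -> stable t m.
Proof.
move=> [N hN] h; have [M hM] := h (m + 1); exists (maxn N M) => i.
rewrite geq_max => /andP[i1 i2]; have [si vi] := hN i i1.
have := @val_perturb _ _ Hv (s i) (t i - s i) si.
by rewrite addrCA subrr addr0 vi; apply; apply: hM.
Qed.

Definition kval (x : completion) : int :=
  if pselect (exists m, stable (repr x) m) is left h then sval (cid h) else 0.

Lemma kval_stable (s : cauchy) m : stable s m -> kval (\pi_completion s) = m.
Proof.
move=> hs; have hr := stable_equiv hs (repr_pi s).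
rewrite /kval; case: pselect => [h|]; last by case; exists m.
by case: cid => n /= hn; apply: stable_unique hn hr.
Qed.

Lemma kval_ge (s : cauchy) m : val_ge kval m (\pi_completion s) <->
  exists N : nat, forall i, (N <= i)%N -> val_ge v m (s i).
Proof.
have [hs|hs] := pselect (null s).
  have -> : \pi_completion s = 0 by apply/pi_eq0.
  by rewrite val_ge0; split=> // _; apply: hs.
have [n sn] := stable_val hs; have [N hN] := sn.
rewrite /val_ge (kval_stable sn); split.
  case/orP => [/eqP/pi_eq0 //|le]; exists N => i /hN[si ->].
  by rewrite le orbT.
move=> [M hM]; apply/orP; right.
have [si vi] := hN (maxn N M) (leq_maxl _ _).
by have := hM (maxn N M) (leq_maxr _ _); rewrite (negPf si) vi.
Qed.

Lemma kconst_zmod : zmod_morphism kconst.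
Proof.
move=> x y; rewrite /kconst -[RHS]/(kadd (kconst x) (kopp (kconst y))) /kconst koppE kaddE.
by apply/pi_eq; apply: null_zero => i /=; rewrite subrr.
Qed.

Lemma kconst_monoid : monoid_morphism kconst.
Proof.
split=> // x y; rewrite -[RHS]/(kmul (kconst x) (kconst y)) /kconst kmulE.
by apply/pi_eq; apply: null_zero => i /=; rewrite subrr.
Qed.

HB.instance Definition _ := GRing.isZmodMorphism.Build F completion kconst kconst_zmod.
HB.instance Definition _ := GRing.isMonoidMorphism.Build F completion kconst kconst_monoid.

Lemma kval_const x : x != 0 -> kval (kconst x) = v x.
Proof. by move=> x0; apply: kval_stable; exists 0%N. Qed.

Lemma kval_Z : Z_valuation kval.
Proof.
have rep (x : completion) : x != 0 -> exists s m, x = \pi_completion s /\ stable s m.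
  move=> x0; have nn : ~ null (repr x).
    by move=> /pi_eq0 /eqP; rewrite reprK (negPf x0).
  by have [m hm] := stable_val nn; exists (repr x), m; rewrite reprK.
split.
- move=> x y /rep[s [m [-> hs]]] /rep[t [n [-> ht]]].
  rewrite -[_ * _]/(kmul _ _) kmulE (kval_stable hs) (kval_stable ht).
  apply: kval_stable; have [N hN] := hs; have [M hM] := ht.
  exists (maxn N M) => i; rewrite geq_max => /andP[/hN[si vi] /hM[ti wi]] /=.
  by rewrite mulf_neq0 // valM // vi wi.
- move=> m x y; rewrite -[x]reprK -[y]reprK => /kval_ge[N hN] /kval_ge[M hM].
  rewrite -[_ + _]/(kadd _ _) kaddE; apply/kval_ge.
  exists (maxn N M) => i; rewrite geq_max => /andP[i1 i2].
  by apply: (val_geD Hv); [apply: hN | apply: hM].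
- move=> m; have [x x0 vx] : exists2 x, x != 0 & v x = m by case: Hv => _ _; apply.
  by exists (kconst x); rewrite ?kval_const // fmorph_eq0.
Qed.

Lemma kconst_dense m y : exists x, val_ge kval m (y - kconst x).
Proof.
elim/quotW: y => s; have [N hN] := cauchyP s m; exists (s N).
rewrite -[_ - _]/(kadd _ (kopp (kconst _))) /kconst koppE kaddE; apply/kval_ge.
by exists N => i Ni /=; apply: hN.
Qed.

Lemma completion_complete s : cauchy_seq kval s -> exists l, converges kval s l.
Proof.
move=> hs; have /choice[a ha] i : exists x, val_ge kval i%:Z (s i - kconst x).
  exact: kconst_dense.
have hK := kval_Z.
have ca : cauchy_seq v a.
  move=> m; have [N hN] := hs m; exists (maxn N `|m|%N) => i j.
  rewrite !geq_max => /andP[i1 i2] /andP[j1 j2].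
  have : val_ge kval m (kconst (a i - a j)).
    have -> : kconst (a i - a j) = (s i - s j) - (s i - kconst (a i)) + (s j - kconst (a j)).
      rewrite rmorphB; ring.
    apply: (val_geD hK); [apply: (val_geB hK); first exact: hN |];
      by apply: (val_geW _ (ha _)); lia.
  have [->|ne] := eqVneq (a i - a j) 0; first by rewrite val_ge0.
  by rewrite !val_ge_neq0 ?fmorph_eq0 // kval_const.
exists (\pi_completion (Cauchy ca)) => m.
have [N hN] := ca m; exists (maxn N `|m|%N) => i; rewrite geq_max => /andP[i1 i2].
rewrite -[s i](subrK (kconst (a i))) -addrA; apply: (val_geD hK).
  by apply: (val_geW _ (ha _)); lia.
rewrite -[_ - _]/(kadd _ (kopp _)) /kconst koppE kaddE; apply/kval_ge.
by exists N => j hj /=; apply: hN.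
Qed.

End Completion.

Theorem completion_exists (F : fieldType) (v : F -> int) : Z_valuation v ->
  exists (K : fieldType) (w : K -> int) (iota : {rmorphism F -> K}),
    is_completion v w iota.
Proof.
move=> Hv; exists (completion Hv), (@kval _ _ Hv), (@kconst _ _ Hv); split.
- exact: kval_Z.
- exact: kval_const.
- exact: kconst_dense.
- exact: completion_complete.
Qed.

(** * Hensel's lemma for squares *)

Section Hensel.
Variables (K : fieldType) (w : K -> int).
Hypotheses (Hw : Z_valuation w) (two : 2%:R != 0 :> K) (w2 : w 2%:R = 0).
Hypothesis complete : forall s, cauchy_seq w s -> exists l, converges w s l.

Fixpoint sqrt_iter (a : K) n : K :=
  if n is n'.+1 then sqrt_iter a n' + (a - sqrt_iter a n' ^+ 2) / 2%:R else 1.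

Lemma half_val m x : val_ge w m x -> val_ge w m (x / 2%:R).
Proof.
move=> hx; rewrite -[m]addr0; apply: (val_geM Hw) => //.
by rewrite val_ge_neq0 ?invr_neq0 // valV // w2 oppr0.
Qed.

(** Newton's iteration with the derivative 2u replaced by 2 gains one order at each step. *)
Lemma hensel_square d : val_ge w 1 d -> exists u, u ^+ 2 = 1 + d.
Proof.
move=> hd; pose u := sqrt_iter (1 + d); pose e n := 1 + d - u n ^+ 2.
have uS n : u n.+1 = u n + e n / 2%:R by [].
have step n : val_ge w n.+1%:Z (e n) /\ val_ge w 1 (u n - 1).
  elim: n => [|n [he hu]].
    by rewrite /e /u /= expr1n subrr val_ge0 [1 + d]addrC addrK.
  have w1 : val_ge w 1 (e n) by apply: val_geW he; lia.
  split.
    have -> : e n.+1 = - ((u n - 1) * e n) - (e n / 2%:R) * (e n / 2%:R).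
      by rewrite /e uS /e; field.
    have -> : n.+2%:Z = 1 + n.+1%:Z :> int by lia.
    apply: (val_geB Hw); first by rewrite (val_geN Hw); apply: (val_geM Hw).
    by apply: (val_geM Hw); apply: half_val.
  by rewrite uS addrAC; apply: (val_geD Hw) => //; apply: half_val.
have incr m n : (m <= n)%N -> val_ge w m%:Z (u n - u m).
  elim: n => [|n IH]; first by rewrite leqn0 => /eqP ->; rewrite subrr val_ge0.
  rewrite leq_eqVlt => /orP[/eqP ->|]; first by rewrite subrr val_ge0.
  rewrite ltnS => mn; rewrite uS addrAC; apply: (val_geD Hw); first exact: IH.
  by apply: half_val; apply: val_geW (step n).1; lia.
have [l hl] : exists l, converges w u l.
  apply: complete => m; exists `|m|%N => i j hi hj.
  have -> : u i - u j = (u i - u `|m|%N) - (u j - u `|m|%N) by ring.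
  by apply: (val_geB Hw); apply: (val_geW _ (incr _ _ _)) => //; lia.
exists l; apply/eqP; rewrite -subr_eq0; apply/eqP; apply: (val_ge_all) => m.
have [N hN] := hl `|m|%:Z.
pose i := maxn N `|m|%N.
have hi : val_ge w `|m|%:Z (u i - l) by apply: hN; rewrite leq_maxl.
have ei : val_ge w m (e i).
  apply: val_geW (step i).1; have := leq_maxr N `|m|%N; rewrite -/i; lia.
have ui : val_ge w 0 (u i).
  rewrite -[u i](subrK 1); apply: (val_geD Hw); first by apply: val_geW (step i).2.
  by rewrite val_ge_neq0 ?oner_eq0 // val1.
have -> : l ^+ 2 - (1 + d) = - ((u i - l) * (2%:R * u i - (u i - l))) - e i.
  by rewrite /e; ring.
apply: (val_geB Hw) => //; rewrite (val_geN Hw) -[m]addr0.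
apply: (val_geM Hw); first by apply: val_geW hi; lia.
apply: (val_geB Hw); last by apply: val_geW hi; lia.
have -> : 2%:R * u i = u i + u i by ring.
exact: (val_geD Hw).
Qed.

Lemma close_square x y : x != 0 -> val_ge w (w x + 1) (y - x) ->
  exists u, u != 0 /\ y = x * u ^+ 2.
Proof.
move=> x0 h; have [|u hu] := @hensel_square ((y - x) / x).
  apply: (@val_geW _ _ _ (w x + 1 - w x)); first by lia.
  by apply: (val_geM Hw) => //; rewrite val_ge_neq0 ?invr_neq0 // valV.
exists u; have yx : y = x * u ^+ 2 by rewrite hu mulrDr mulr1 mulrC divfK // addrC subrK.
split=> //; apply: contraTneq h => u0.
rewrite yx u0 expr0n mulr0 sub0r (val_geN Hw) val_ge_neq0 //; lia.
Qed.

End Hensel.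

(** * Local isotropy *)

(** Isotropy over the completion, expressed by approximations in F itself, so that it
    does not refer to a particular completion. *)
Definition locally_isotropic (F : fieldType) (v : F -> int) (a : seq F) := forall N : int,
  exists (x : nat -> F) (k : nat), [/\ (k < size a)%N, x k = 1 &
    val_ge v N (\sum_(i < size a) a`_i * x i ^+ 2)].

Section LocalIsotropy.
Variables (F K : fieldType) (v : F -> int) (w : K -> int) (iota : {rmorphism F -> K}).
Hypothesis vw : forall x, x != 0 -> w (iota x) = v x.

Lemma val_ge_iota m x : val_ge w m (iota x) = val_ge v m x.
Proof.
have [->|x0] := eqVneq x 0; first by rewrite rmorph0 !val_ge0.
by rewrite !val_ge_neq0 ?fmorph_eq0 // vw.
Qed.

Hypothesis Hw : Z_valuation w.

(** An approximate zero with coordinate k equal to 1 is made exact by changing that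
    coordinate only, to the square root of an element close to 1. *)
Lemma locally_isotropic_complete (a : seq F) :
  2%:R != 0 :> F -> v 2%:R = 0 ->
  (forall s, cauchy_seq w s -> exists l, converges w s l) ->
  all (predC1 0) a -> locally_isotropic v a -> iso (map iota a).
Proof.
move=> two v2 compl /allP a0 loc.
have twoK : 2%:R != 0 :> K by rewrite -(rmorph_nat iota) fmorph_eq0.
have w2 : w 2%:R = 0 by rewrite -(rmorph_nat iota) vw.
pose N : int := 1 + \sum_(i < size a) `|v a`_i|.
have [x [k [hk xk hx]]] := loc N.
have ak : a`_k != 0 by apply: (a0 a`_k); apply: mem_nth.
have hN : v a`_k + 1 <= N.
  rewrite addrC lerD2l (bigD1 (Ordinal hk)) //= -[X in X <= _]addr0.
  by apply: lerD; [apply: ler_norm | apply: sumr_ge0].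
set q := \sum_(i < _) _ in hx.
have iak : iota a`_k != 0 by rewrite fmorph_eq0.
have [|u [u0 hu]] := @close_square _ _ Hw twoK w2 compl (iota a`_k) (iota (a`_k - q)) iak.
  by rewrite -rmorphB addrAC subrr add0r rmorphN (val_geN Hw) val_ge_iota vw // (val_geW hN).
exists (fun i => if i == k then u else iota (x i)); split.
  by exists k; rewrite size_map eqxx.
rewrite size_map (bigD1 (Ordinal hk)) //= eqxx (nth_map 0) // -hu.
rewrite (eq_bigr (fun i : 'I_(size a) => iota (a`_i * x i ^+ 2))); last first.
  move=> i; rewrite -val_eqE /= => /negPf ->.
  by rewrite (nth_map 0) // rmorphM rmorphXn.
rewrite -rmorph_sum -rmorphD -[RHS](rmorph0 iota); congr (iota _).
by rewrite /q (bigD1 (Ordinal hk)) //= xk expr1n mulr1 opprD addrA subrr sub0r addNr.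
Qed.

Lemma finite_val_bound n (y : nat -> K) :
  exists B : nat, forall i, (i < n)%N -> val_ge w (- B%:Z) (y i).
Proof.
elim: n => [|n [B hB]]; first by exists 0%N.
exists (B + `|w (y n)|)%N => i; rewrite ltnS leq_eqVlt => /orP[/eqP ->|/hB].
  have [->|y0] := eqVneq (y n) 0; first by rewrite val_ge0.
  by rewrite val_ge_neq0 //; lia.
by apply: val_geW; lia.
Qed.

Lemma iso_locally_isotropic (a : seq F) :
  (forall (m : int) (y : K), exists x : F, val_ge w m (y - iota x)) ->
  iso (map iota a) -> locally_isotropic v a.
Proof.
move=> dense [y [[k [hk yk]] ey]] N; rewrite size_map in hk ey.
pose z i := y i / y k.
have zk : z k = 1 by rewrite /z divff.
have ez : \sum_(i < size a) iota a`_i * z i ^+ 2 = 0.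
  apply: (mulfI (expf_neq0 2 yk)); rewrite mulr0 -[RHS]ey mulr_sumr.
  apply: eq_bigr => i _; rewrite (nth_map 0) // /z expr_div_n.
  by rewrite mulrCA [_ * (_ / _)]mulrC divfK // expf_neq0.
have [B hB] := finite_val_bound (size a) z.
have [A hA] := finite_val_bound (size a) (fun i => iota a`_i).
pose M : int := `|N| + A%:Z + B%:Z.
have /choice[x0 hx0] i : exists x, val_ge w M (z i - iota x) by apply: dense.
pose x i := if i == k then 1 else x0 i.
have hx i : val_ge w M (z i - iota (x i)).
  by rewrite /x; case: eqP => [->|_]; rewrite ?zk ?rmorph1 ?subrr ?val_ge0.
exists x, k; split=> //; first by rewrite /x eqxx.
rewrite -val_ge_iota.
have -> : iota (\sum_(i < size a) a`_i * x i ^+ 2) =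
    \sum_(i < size a) (iota (a`_i * x i ^+ 2) - iota a`_i * z i ^+ 2).
  by rewrite sumrB ez subr0 rmorph_sum.
apply: (val_ge_sum Hw) => i.
have -> : iota (a`_i * x i ^+ 2) - iota a`_i * z i ^+ 2 =
   - (iota a`_i * ((z i - iota (x i)) * (z i + z i - (z i - iota (x i))))).
  rewrite rmorphM rmorphXn /=; ring.
rewrite (val_geN Hw); have : N <= - A%:Z + (M + - B%:Z) by rewrite /M; lia.
move/val_geW; apply; apply: (val_geM Hw); first exact: hA.
apply: (val_geM Hw) => //; apply: (val_geB Hw).
  by apply: (val_geD Hw); apply: hB.
by apply: val_geW (hx i); rewrite /M; lia.
Qed.

End LocalIsotropy.

Lemma locally_isotropic_transfer (F : fieldType) (v : F -> int) (a b : seq F) :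
  Z_valuation v -> 2%:R != 0 :> F -> v 2%:R = 0 -> all (predC1 0) a ->
  (forall (K : fieldType) (iota : {rmorphism F -> K}), iso (map iota a) -> iso (map iota b)) ->
  locally_isotropic v a -> locally_isotropic v b.
Proof.
move=> Hv two v2 a0 ab loc.
have [K [w [iota [Hw vw dense compl]]]] := completion_exists Hv.
by apply: (iso_locally_isotropic vw Hw dense); apply: ab; apply: (locally_isotropic_complete vw Hw).
Qed.

Lemma locally_isotropic_comp (F G : fieldType) (s : {rmorphism F -> G}) (v : G -> int) (a : seq F) :
  locally_isotropic (v \o s) a -> locally_isotropic v (map s a).
Proof.
move=> loc N; have [x [k [hk xk hx]]] := loc N.
exists (s \o x), k; split; rewrite ?size_map //= ?xk ?rmorph1 //.
rewrite (eq_bigr (fun i : 'I_(size a) => s (a`_i * x i ^+ 2))); last first.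
  by move=> i _; rewrite (nth_map 0) // rmorphM rmorphXn.
by rewrite -rmorph_sum; move: hx; rewrite /val_ge fmorph_eq0.
Qed.

Lemma iso_morph (F G : fieldType) (s : {rmorphism F -> G}) (a : seq F) :
  iso a -> iso (map s a).
Proof.
move=> [x [[k [hk xk]] e]]; exists (s \o x); split.
  by exists k; rewrite size_map /= fmorph_eq0.
rewrite size_map -[RHS](rmorph0 s) -e rmorph_sum; apply: eq_bigr => i _.
by rewrite (nth_map 0) // rmorphM rmorphXn.
Qed.

Lemma Z_valuation_comp (F G : fieldType) (s : {rmorphism F -> G}) (v : G -> int) :
  Z_valuation v -> (exists2 x, x != 0 & v (s x) = 1) -> Z_valuation (v \o s).
Proof.
move=> Hv [x x0 vx]; split.
- by move=> y z y0 z0 /=; rewrite rmorphM valM ?fmorph_eq0.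
- move=> m y z.
  have e t : val_ge (v \o s) m t = val_ge v m (s t) by rewrite /val_ge fmorph_eq0.
  by rewrite !e rmorphD; apply: (val_geD Hv).
- move=> m; case: m => n.
    by exists (x ^+ n); rewrite ?expf_neq0 //= rmorphXn valX ?fmorph_eq0 // vx; lia.
  exists (x ^- n.+1); rewrite ?invr_neq0 ?expf_neq0 //= fmorphV rmorphXn.
  by rewrite valV ?expf_neq0 ?fmorph_eq0 // valX ?fmorph_eq0 // vx; lia.
Qed.

(** * Valuations of the rational function field *)

Section RationalValuations.
Variables (E F : fieldType) (emb : {rmorphism {poly E} -> F}).
Hypothesis frF : fraction_field emb.
Implicit Types (v : F -> int) (p g : {poly E}).

Definition trivial_on_constants v :=
  Z_valuation v /\ forall c : E, c != 0 -> v (emb c%:P) = 0.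

Definition padic p v := [/\ trivial_on_constants v, forall g, ~~ (p %| g) -> v (emb g) = 0
  & v (emb p) = 1].

Let emb0 g : (emb g == 0) = (g == 0) := emb_eq0 frF g.

Let emb_neq0 g : g != 0 -> emb g != 0.
Proof. by rewrite emb0. Qed.

Lemma prime_power_part p g : irreducible_poly p -> g != 0 ->
  exists k h, g = p ^+ k * h /\ ~~ (p %| h).
Proof.
move=> [sp _]; have [n] := ubnP (size g); elim: n g => // n IH g sg g0.
have [pg|ng] := boolP (p %| g); last by exists 0%N, g; rewrite expr0 mul1r.
have /dvdpP[h e] := pg.
have h0 : h != 0 by apply: contraNneq g0 => h0; rewrite e h0 mul0r.
have p0 : p != 0 by rewrite -size_poly_gt0 (ltn_trans _ sp).
have [|k [h' [eh nh]]] := IH h _ h0.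
  move: sg; rewrite e size_mul // ltnS; have : (0 < size h)%N by rewrite size_poly_gt0.
  by move: (size h) (size p) sp => a b; clear; lia.
by exists k.+1, h'; rewrite e eh mulrC exprS mulrA.
Qed.

Lemma padic_val p v k h : padic p v -> irreducible_poly p -> ~~ (p %| h) ->
  v (emb (p ^+ k * h)) = k%:Z.
Proof.
move=> [[Hv _] nd vp] irr nh.
have p0 := emb_neq0 (irredp_neq0 irr).
have h0 : emb h != 0 :> F.
  by apply: emb_neq0; apply: contraNneq nh => ->; rewrite dvdp0.
by rewrite rmorphM rmorphXn (valM Hv) ?expf_neq0 // nd // addr0 (valX Hv) // vp; lia.
Qed.

(** The exponent of p in a polynomial, extended to quotients. *)
Lemma padic_exists p : irreducible_poly p -> exists v, padic p v.
Proof.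
move=> irr; have p0 := irredp_neq0 irr.
have np1 : ~~ (p %| 1) by rewrite dvdp1; case: irr => sp _; rewrite gtn_eqF.
have /choice[mu hmu] g : exists k : nat, g != 0 -> exists h, g = p ^+ k * h /\ ~~ (p %| h).
  have [->|g0] := eqVneq g 0; first by exists 0%N.
  by have [k [h ?]] := prime_power_part irr g0; exists k => _; exists h.
have muU g k h : ~~ (p %| h) -> g = p ^+ k * h -> mu g = k.
  move=> nh e; have g0 : g != 0.
    rewrite e mulf_neq0 ?expf_neq0 //; by apply: contraNneq nh => ->; rewrite dvdp0.
  have [h' [e' nh']] := hmu g g0.
  have aux a b (x y : {poly E}) : ~~ (p %| y) -> p ^+ a * x = p ^+ b * y -> (a <= b)%N.
    move=> ny exy; rewrite leqNgt; apply/negP => lt.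
    have ey : p * (p ^+ (a - b.+1) * x) = y.
      apply: (mulfI (expf_neq0 b p0)); rewrite -exy -[in RHS](subnKC lt) exprD exprSr.
      by rewrite !mulrA.
    by move: ny; rewrite -ey dvdp_mulr.
  by apply/eqP; rewrite eqn_leq (aux _ _ h' h) ?(aux _ _ h h') // -?e -?e'.
have muM g h : g != 0 -> h != 0 -> mu (g * h) = (mu g + mu h)%N.
  move=> g0 h0; have [g' [eg ng]] := hmu g g0; have [h' [eh nh]] := hmu h h0.
  apply: (@muU _ _ (g' * h')); last by rewrite {1}eg {1}eh exprD mulrACA.
  by apply/negP => /(irreducible_dvdM irr); rewrite (negPf ng) (negPf nh).
have muN g : ~~ (p %| g) -> mu g = 0%N by move=> ng; apply: (muU _ _ g); rewrite ?expr0 ?mul1r.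
have muD g h (m : nat) : g != 0 -> h != 0 -> g + h != 0 ->
    (m <= mu g)%N -> (m <= mu h)%N -> (m <= mu (g + h)%R)%N.
  move=> g0 h0 gh0 mg mh; have [g' [eg _]] := hmu g g0; have [h' [eh _]] := hmu h h0.
  have [k' [ek nk]] := hmu _ gh0; rewrite leqNgt; apply/negP => lt.
  have pg : p ^+ m %| g by rewrite eg dvdp_mulr // dvdp_exp2l.
  have ph : p ^+ m %| h by rewrite eh dvdp_mulr // dvdp_exp2l.
  have := dvdp_add pg ph; rewrite ek.
  have -> : p ^+ m = p ^+ mu (g + h) * (p * p ^+ (m - (mu (g + h)%R).+1)).
    by rewrite -exprS -exprD addnS -addSn subnKC.
  rewrite dvdp_mul2l ?expf_neq0 // => d; move: nk.
  by rewrite (dvdp_trans _ d) // dvdp_mulr.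
have /choice[num /choice[den hnd]] x : exists a b : {poly E}, b != 0 /\ x = emb a / emb b.
  exact: frF.2.
pose v x : int := (mu (num x))%:Z - (mu (den x))%:Z.
have vE a b : a != 0 -> b != 0 -> v (emb a / emb b) = (mu a)%:Z - (mu b)%:Z.
  move=> a0 b0; set x := _ / _; have [d0 e] := hnd x.
  have n0 : num x != 0.
    have x0 : x != 0 by rewrite mulf_neq0 ?invr_eq0 ?emb0.
    by apply: contraNneq x0 => z; rewrite e z rmorph0 mul0r.
  move/eqP: e; rewrite eqr_div ?emb0 // -!rmorphM (inj_eq frF.1) => /eqP e.
  by have := congr1 mu e; rewrite !muM // /v; lia.
have vT a : a != 0 -> v (emb a) = (mu a)%:Z.
  move=> a0; rewrite -[emb a]divr1 -(rmorph1 emb) vE ?oner_eq0 // (muN 1) ?subr0 //.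
have repr x : x != 0 -> exists a b, [/\ a != 0, b != 0 & x = emb a / emb b].
  move=> x0; have [a [b [b0 e]]] := frF.2 x; exists a, b; split=> //.
  by apply: contraNneq x0 => a0; rewrite e a0 rmorph0 mul0r.
have mup : mu p = 1%N.
  by apply: (muU _ _ 1); rewrite ?mulr1 ?expr1.
exists v; split; last by rewrite vT // mup.
  split; last first.
    move=> c c0; rewrite vT ?polyC_eq0 // muN //.
    apply/negP => /dvdp_leq; rewrite polyC_eq0 c0 size_polyC c0 => /(_ isT).
    by case: irr => sp _; rewrite leqNgt sp.
  split.
  - move=> x y /repr[a [b [a0 b0 ->]]] /repr[c [d [c0 d0 ->]]].
    rewrite mulf_div -!rmorphM !vE ?mulf_neq0 // !muM //; lia.
  - move=> m x y hx hy.
    have [x0|x0] := eqVneq x 0; first by rewrite x0 add0r.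
    have [y0|y0] := eqVneq y 0; first by rewrite y0 addr0.
    have [s0|s0] := eqVneq (x + y) 0; first by rewrite s0 val_ge0.
    move: hx hy; rewrite !val_ge_neq0 //; move: s0.
    have [a [b [a0 b0 ->]]] := repr x x0; have [c [d [c0 d0 ->]]] := repr y y0.
    have -> : emb a / emb b + emb c / emb d =
              emb (a * d + c * b) / emb (b * d).
      by rewrite addf_div ?emb0 // rmorphD !rmorphM.
    rewrite mulf_eq0 invr_eq0 !emb0 => /norP[n0 _].
    rewrite !vE ?mulf_neq0 // muM // => h1 h2.
    pose k := (minn (mu a + mu d) (mu c + mu b))%N.
    have : (k <= mu (a * d + c * b)%R)%N.
      by apply: muD; rewrite ?mulf_neq0 // muM // ?geq_minl ?geq_minr.
    move: h1 h2; rewrite /k; clear; move: (mu a) (mu b) (mu c) (mu d) (mu _) => m1 m2 m3 m4 m5; lia.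
  - have muX k : mu (p ^+ k) = k by apply: (muU _ k 1); rewrite ?mulr1.
    move=> [k|k].
      by exists (emb (p ^+ k)); rewrite ?emb0 ?vT ?expf_neq0 // muX.
    exists (emb 1 / emb (p ^+ k.+1)).
      by rewrite rmorph1 div1r invr_eq0 emb0 expf_neq0.
    by rewrite vE ?expf_neq0 ?oner_eq0 // muX (muN 1) // NegzE sub0r.
move=> g ng; have g0 : g != 0 by apply: contraNneq ng => ->; rewrite dvdp0.
by rewrite vT // muN.
Qed.

Lemma padic_ge0 p v g : irreducible_poly p -> padic p v -> val_ge v 0 (emb g).
Proof.
move=> irr hv; have [->|g0] := eqVneq g 0; first by rewrite rmorph0 val_ge0.
have [k [h [e nh]]] := prime_power_part irr g0.
by rewrite val_ge_neq0 ?emb0 // e (padic_val _ hv).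
Qed.

Lemma padic_dvd p v g : irreducible_poly p -> padic p v ->
  val_ge v 1 (emb g) = (p %| g).
Proof.
move=> irr hv; have [->|g0] := eqVneq g 0; first by rewrite rmorph0 val_ge0 dvdp0.
have [k [h [e nh]]] := prime_power_part irr g0.
rewrite val_ge_neq0 ?emb0 // {1}e (padic_val _ hv) //.
case: k e => [|k] e; first by rewrite e expr0 mul1r (negPf nh).
by rewrite e exprS -mulrA dvdp_mulr.
Qed.

Lemma padic_unique p v v' x : irreducible_poly p -> padic p v -> padic p v' ->
  x != 0 -> v x = v' x.
Proof.
move=> irr hv hv' x0; have [a [b [b0 e]]] := frF.2 x.
have a0 : a != 0 by apply: contraNneq x0 => a0; rewrite e a0 rmorph0 mul0r.
have [k [h [ea na]]] := prime_power_part irr a0.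
have [l [h' [eb nb]]] := prime_power_part irr b0.
have [[[Hv _] _ _] [[Hv' _] _ _]] := (hv, hv').
by rewrite e !valM ?invr_eq0 ?emb0 // !valV ?emb0 // ea eb !(padic_val _ _ irr).
Qed.

Lemma padic_reduce p v x : irreducible_poly p -> padic p v -> val_ge v 0 x ->
  exists g, val_ge v 1 (x - emb g).
Proof.
move=> irr hv hx; have [[Hv _] nd vp] := hv.
have [->|x0] := eqVneq x 0; first by exists 0; rewrite rmorph0 subr0 val_ge0.
have [a [b [b0 e]]] := frF.2 x.
have a0 : a != 0 by apply: contraNneq x0 => a0; rewrite e a0 rmorph0 mul0r.
have [k [h [ea na]]] := prime_power_part irr a0.
have [l [h' [eb nb]]] := prime_power_part irr b0.
have p0 := emb_neq0 (irredp_neq0 irr).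
have h'0 : emb h' != 0 :> F by apply: emb_neq0; apply: contraNneq nb => ->; rewrite dvdp0.
have lk : (l <= k)%N.
  move: hx; rewrite val_ge_neq0 // e (valM Hv) ?invr_eq0 ?emb0 //.
  by rewrite (valV Hv) ?emb0 // ea eb !(padic_val _ hv) //; lia.
have ex : x = emb (p ^+ (k - l) * h) / emb h'.
  have ee : emb (p ^+ (k - l) * h) * emb b = emb a * emb h'.
    rewrite -!rmorphM ea eb -[in RHS](subnK lk) exprD; congr (emb _); ring.
  by apply/eqP; rewrite e eqr_div ?emb0 ?b0 // -?emb0 ?h'0 // -ee mulrC.
have [u hu] : exists u, p %| h' * u - 1.
  by apply: inverse_mod; rewrite irreducible_coprime.
exists (p ^+ (k - l) * h * u).
have -> : x - emb (p ^+ (k - l) * h * u) = - (emb (p ^+ (k - l) * h) / emb h' * emb (h' * u - 1)).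
  rewrite ex rmorphB !rmorphM rmorph1 /=; field; exact: h'0.
rewrite (val_geN Hv) -ex -[1]add0r; apply: (val_geM Hv) => //.
by rewrite (padic_dvd _ irr hv).
Qed.

(** If X has no pole, the polynomials of positive valuation form a prime ideal; p is
    an element of least degree in it. *)
Lemma valuation_cases v : trivial_on_constants v ->
  v (emb 'X) < 0 \/ exists p, irreducible_poly p /\ padic p v.
Proof.
move=> [Hv vc]; have [vX|vX] := ltP (v (emb 'X)) 0; [by left | right].
have vX' : val_ge v 0 (emb 'X) by rewrite val_ge_neq0 ?emb0 ?polyX_eq0.
have pos g : val_ge v 0 (emb g).
  elim/poly_ind: g => [|g c IH]; first by rewrite rmorph0 val_ge0.
  rewrite rmorphD rmorphM; apply: (val_geD Hv).
    by rewrite -[0]addr0; apply: (val_geM Hv).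
  have [->|c0] := eqVneq c 0; first by rewrite rmorph0 val_ge0.
  by rewrite val_ge_neq0 ?emb0 ?polyC_eq0 // vc.
pose Q n := `[< exists g, [/\ g != 0, val_ge v 1 (emb g) & size g = n] >].
have exQ : exists n, Q n.
  have [x x0 vx] : exists2 x, x != 0 & v x = 1 by case: Hv => _ _; apply.
  have [a [b [b0 e]]] := frF.2 x.
  have a0 : a != 0 by apply: contraNneq x0 => a0; rewrite e a0 rmorph0 mul0r.
  exists (size a); apply/asboolP; exists a; split=> //.
  have := pos b; rewrite !val_ge_neq0 ?emb0 //; move: vx.
  rewrite e (valM Hv) ?invr_eq0 ?emb0 // (valV Hv) ?emb0 // => h1 h2.
  by rewrite -[v (emb a)](subrK (v (emb b))) h1 lerDl.
case: (ex_minnP exQ) => n /asboolP[p [p0 vp sp]] hmin.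
have dvd g : (p %| g) = val_ge v 1 (emb g).
  apply/idP/idP => [/dvdpP[u ->]|vg].
    by rewrite rmorphM -[1]add0r; apply: (val_geM Hv).
  rewrite (divp_eq g p) dvdp_addr ?dvdp_mull //.
  have vr : val_ge v 1 (emb (g %% p)).
    have -> : g %% p = g - (g %/ p) * p.
      by apply/eqP; rewrite eq_sym subr_eq addrC -divp_eq.
    rewrite rmorphB rmorphM; apply: (val_geB Hv) => //.
    by rewrite -[1]add0r; apply: (val_geM Hv).
  have [-> //|r0] := eqVneq (g %% p) 0.
  have : (n <= size (g %% p)%R)%N by apply: hmin; apply/asboolP; exists (g %% p).
  by rewrite leqNgt -sp ltn_modp p0.
have irr : irreducible_poly p.
  split.
    rewrite ltnNge; apply/negP => /size1_polyC e; move: vp p0; rewrite e polyC_eq0 => vp c0.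
    by move: vp; rewrite val_ge_neq0 ?emb0 ?polyC_eq0 // vc.
  move=> q sq qp; have /dvdpP[u e] := qp.
  have [q0 u0] : q != 0 /\ u != 0.
    by split; apply: contraNneq p0 => z; rewrite e z ?mulr0 ?mul0r.
  have : val_ge v 1 (emb u) || val_ge v 1 (emb q).
    have := vp; have := pos q; have := pos u; rewrite e rmorphM !val_ge_neq0 ?mulf_neq0 ?emb0 //.
    by rewrite (valM Hv) ?emb0 // ; lia.
  rewrite -!dvd => /orP[pu|pq]; last by apply/andP.
  have := dvdp_leq u0 pu; rewrite e size_mul // => le; case/negP: sq.
  have : (0 < size q)%N by rewrite size_poly_gt0.
  have : (0 < size u)%N by rewrite size_poly_gt0.
  by move: le; move: (size u) (size q) => k l; clear; case: l => [|[|l]] //; lia.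
exists p; split=> //; have nd g : ~~ (p %| g) -> v (emb g) = 0.
  move=> ng; have g0 : g != 0 by apply: contraNneq ng => ->; rewrite dvdp0.
  move: ng; rewrite dvd; have := pos g; rewrite !val_ge_neq0 ?emb0 //; lia.
split=> //; have [x x0 vx] : exists2 x, x != 0 & v x = 1 by case: Hv => _ _; apply.
have [a [b [b0 e]]] := frF.2 x.
have a0 : a != 0 by apply: contraNneq x0 => a0; rewrite e a0 rmorph0 mul0r.
have [k [h [ea na]]] := prime_power_part irr a0.
have [l [h' [eb nb]]] := prime_power_part irr b0.
have vP c m d : c != 0 -> c = p ^+ m * d -> ~~ (p %| d) -> v (emb c) = v (emb p) *+ m.
  move=> c0 -> nd'; have d0 : d != 0 by apply: contraNneq nd' => ->; rewrite dvdp0.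
  by rewrite rmorphM rmorphXn (valM Hv) ?expf_neq0 ?emb0 // (valX Hv) ?emb0 // (nd d) ?addr0.
move: vx; rewrite e (valM Hv) ?invr_eq0 ?emb0 // (valV Hv) ?emb0 // (vP _ _ _ a0 ea na) (vP _ _ _ b0 eb nb).
have : 1 <= v (emb p) by move: vp; rewrite val_ge_neq0 ?emb0.
move: (v (emb p)) => z z1; rewrite -[z *+ k]mulr_natr -[z *+ l]mulr_natr -mulrBr => ez.
have : (z %| 1)%Z by apply/dvdzP; exists (k%:R - l%:R); rewrite mulrC.
by rewrite dvdz1; lia.
Qed.

End RationalValuations.

(** * Poles and Moebius transformations *)

Section Pole.
Variables (E K : fieldType) (j : {rmorphism E -> K}) (w : K -> int).
Hypotheses (Hw : Z_valuation w) (wc : forall c : E, c != 0 -> w (j c) = 0).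

Lemma val_ge_const c : val_ge w 0 (j c).
Proof.
have [->|c0] := eqVneq c 0; first by rewrite rmorph0 val_ge0.
by rewrite val_ge_neq0 ?fmorph_eq0 // wc.
Qed.

(** At a pole of y the leading term of g(y) dominates. *)
Lemma pole_value y (g : {poly E}) : w y < 0 -> y != 0 -> g != 0 ->
  exists d, val_ge w 1 d /\
    (map_poly j g).[y] = j (lead_coef g) * y ^+ (size g).-1 * (1 + d).
Proof.
move=> wy y0 g0; set n := (size g).-1.
have lc0 : j (lead_coef g) != 0 by rewrite fmorph_eq0 lead_coef_eq0.
have yn : y ^+ n != 0 by rewrite expf_neq0.
pose r := \sum_(i < n) j g`_i * y ^+ i.
have hr : val_ge w (w y *+ n + 1) r.
  apply: (val_ge_sum Hw) => i; apply: (@val_geW _ _ _ (0 + w y *+ i)).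
    rewrite add0r; move: (nat_of_ord i) (ltn_ord i) => k kn.
    by rewrite -[n](subnKC kn) addSn mulrS mulrnDr; have := mulrn_wle0 (n - k.+1) (ltW wy); lia.
  apply: (val_geM Hw); first exact: val_ge_const.
  by rewrite val_ge_neq0 ?expf_neq0 // (valX Hw).
exists (r / (j (lead_coef g) * y ^+ n)); split.
  apply: (@val_geW _ _ _ (w y *+ n + 1 - w (j (lead_coef g) * y ^+ n))).
    by rewrite (valM Hw) // (valX Hw) // wc ?lead_coef_eq0 // add0r addrAC subrr add0r.
  by apply: (val_geM Hw) => //; rewrite val_ge_neq0 ?invr_eq0 ?mulf_neq0 // (valV Hw) ?mulf_neq0.
rewrite mulrDr mulr1 [X in _ + X]mulrC divfK ?mulf_neq0 //.
rewrite horner_coef size_map_poly -(prednK (_ : 0 < size g)%N) ?size_poly_gt0 //.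
rewrite big_ord_recr /= coef_map /= -lead_coefE addrC; congr (_ + _).
by apply: eq_bigr => i _; rewrite coef_map.
Qed.

Lemma pole_transcendental y : w y < 0 -> y != 0 ->
  injective (horner_eval y \o map_poly j).
Proof.
move=> wy y0 a b /= e; apply/eqP; rewrite -subr_eq0; apply: contraT => ab.
have [d [hd e']] := pole_value wy y0 ab.
move: e; rewrite /horner_eval => /eqP; rewrite -subr_eq0 -hornerN -hornerD -rmorphN -rmorphD /= e'.
have w1 : val_ge w (w 1 + 1) d by rewrite (val1 Hw) add0r.
have [d1 _] := val_perturb Hw (oner_neq0 K) w1.
by rewrite !mulf_eq0 fmorph_eq0 lead_coef_eq0 expf_eq0 (negPf ab) (negPf y0) (negPf d1) andbF.
Qed.

End Pole.

Section Moebius.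
Variables (E F : fieldType) (emb : {rmorphism {poly E} -> F}).
Hypothesis frF : fraction_field emb.
Let emb0 g : (emb g == 0) = (g == 0) := emb_eq0 frF g.
Let c2F : {rmorphism E -> F} := emb \o polyC.

Lemma rational_morph_ext (K : fieldType) (f g : {rmorphism F -> K}) :
  f (emb 'X) = g (emb 'X) -> (forall c, f (emb c%:P) = g (emb c%:P)) -> f =1 g.
Proof.
move=> eX ec; apply: (fraction_field_ext frF); elim/poly_ind => [|a c IH].
  by rewrite !rmorph0.
by rewrite !rmorphD !rmorphM IH eX ec.
Qed.

(** An element with a pole is transcendental over E, so X may be sent to it. *)
Lemma substitution y v : trivial_on_constants emb v -> v y < 0 -> y != 0 ->
  exists s : {rmorphism F -> F}, s (emb 'X) = y /\ forall c, s (emb c%:P) = emb c%:P.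
Proof.
move=> [Hv vc] vy y0.
have inj := @pole_transcendental _ _ c2F _ Hv vc _ vy y0.
have [s hs] := fraction_field_lift frF inj.
exists s; split=> [|c]; rewrite hs /= ?map_polyX ?map_polyC /horner_eval ?hornerX ?hornerC //.
Qed.

Lemma moebius t : exists s r : {rmorphism F -> F},
  [/\ s (emb 'X) = emb t%:P + (emb 'X)^-1, r (emb 'X) = (emb 'X - emb t%:P)^-1,
      (forall c, s (emb c%:P) = emb c%:P) /\ (forall c, r (emb c%:P) = emb c%:P),
      cancel s r & cancel r s].
Proof.
have irrX : irreducible_poly ('X : {poly E}).
  by rewrite -['X]subr0 -polyC0; apply: irredp_XsubC.
have irrt : irreducible_poly ('X - t%:P) by apply: irredp_XsubC.
have [v [vt nd vX]] := padic_exists frF irrX; have [Hv vc] := vt.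
have [u [ut nd' ut1]] := padic_exists frF irrt; have [Hu uc] := ut.
have X0 : emb 'X != 0 by rewrite emb0 polyX_eq0.
have T0 : emb 'X - emb t%:P != 0 by rewrite -rmorphB emb0 polyXsubC_eq0.
have v1 : v (emb 'X)^-1 = -1 by rewrite (valV Hv) // vX.
have h : val_ge v (v (emb 'X)^-1 + 1) (emb t%:P).
  by rewrite v1 addNr; apply: (val_ge_const (j := c2F)).
have [s0 sv] := val_perturb Hv (invr_neq0 X0) h.
have [||s [sX sc]] := @substitution (emb t%:P + (emb 'X)^-1) v vt.
- by rewrite addrC sv v1.
- by rewrite addrC.
have [||r [rX rc]] := @substitution (emb 'X - emb t%:P)^-1 u ut.
- by rewrite (valV Hu) // -rmorphB ut1.
- by rewrite invr_eq0.
exists s, r; split=> //.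
- apply: (@rational_morph_ext F (r \o s) idfun) => [|c] /=; last by rewrite sc rc.
  by rewrite sX rmorphD rc fmorphV rX invrK addrC subrK.
- apply: (@rational_morph_ext F (s \o r) idfun) => [|c] /=; last by rewrite rc sc.
  by rewrite rX fmorphV rmorphB sX sc addrAC subrr add0r invrK.
Qed.

Lemma omega_comp v (s r : {rmorphism F -> F}) :
  trivial_on_constants emb v -> (forall c, s (emb c%:P) = emb c%:P) -> cancel r s ->
  trivial_on_constants emb (v \o s).
Proof.
move=> [Hv vc] sc rs; split; last by move=> c c0 /=; rewrite sc vc.
apply: Z_valuation_comp => //.
have [x x0 vx] : exists2 x, x != 0 & v x = 1 by case: Hv => _ _; apply.
by exists (r x); rewrite ?fmorph_eq0 ?rs.
Qed.

Lemma constant_val v c : trivial_on_constants emb v -> val_ge v 0 (emb c%:P).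
Proof. by move=> [Hv vc]; apply: (val_ge_const (j := c2F)). Qed.

Lemma two_val v : trivial_on_constants emb v -> 2%:R != 0 :> E ->
  (2%:R != 0 :> F) /\ v 2%:R = 0.
Proof.
move=> [Hv vc] two.
have e : 2%:R = emb (2%:R)%:P by rewrite polyCMn !rmorph_nat.
by rewrite e emb0 polyC_eq0 vc.
Qed.

End Moebius.

(** * Common values and vector products *)

Section DiagonalForms.
Variable K : fieldType.
Implicit Types (a b c d x y z : K) (s : seq K).

Lemma iso_consP a s : iso (a :: s) <->
  exists x (y : nat -> K), (x != 0 \/ exists i, (i < size s)%N /\ y i != 0) /\
    a * x ^+ 2 + \sum_(i < size s) s`_i * y i ^+ 2 = 0.
Proof.
split=> [[x [[i [hi xi]] e]]|[x [y [h e]]]].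
  exists (x 0%N), (fun i => x i.+1); split; last by rewrite -[RHS]e big_ord_recl.
  by case: i hi xi => [|i] hi xi; first left; last by right; exists i.
exists (fun i => if i is i'.+1 then y i' else x); split.
  by case: h => [x0|[i [hi yi]]]; first exists 0%N; last exists i.+1.
by rewrite big_ord_recl.
Qed.

Lemma iso_cons a s : iso s -> iso (a :: s).
Proof.
move=> [y [[i hi] e]]; apply/iso_consP; exists 0, y; split; first by right; exists i.
by rewrite expr0n mulr0 add0r.
Qed.


Lemma iso_subseq s t : subseq s t -> iso s -> iso t.
Proof.
suff ext : subseq s t -> forall y : nat -> K, exists y' : nat -> K,
    \sum_(i < size t) t`_i * y' i ^+ 2 = \sum_(i < size s) s`_i * y i ^+ 2 /\
    ((exists i, (i < size s)%N /\ y i != 0) -> exists i, (i < size t)%N /\ y' i != 0).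
  move=> /ext h [y [hy e]]; have [y' [e' h']] := h y.
  by exists y'; split; [exact: h' | rewrite e'].
elim: t s => [|b t IH] s.
  by move=> /eqP -> y; exists y.
case: s => [_ y|a s /=].
  exists (fun=> 0); split; last by case=> i [].
  by rewrite big_ord0 big1 // => i _; rewrite expr0n mulr0.
case: eqP => [->|_] sub y.
  have [y' [e h]] := IH s sub (y \o succn).
  exists (fun i => if i is i'.+1 then y' i' else y 0%N); split.
    by rewrite !big_ord_recl /= e.
  case=> [[|i] [hi yi]]; first by exists 0%N.
  by have [i' hi'] := h (ex_intro _ i (conj hi yi)); exists i'.+1.
have [y' [e h]] := IH (a :: s) sub y.
exists (fun i => if i is i'.+1 then y' i' else 0); split.
  by rewrite big_ord_recl /= expr0n mulr0 add0r e.
by move=> /h[i hi]; exists i.+1.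
Qed.

Definition scaled x y := exists k, k != 0 /\ y = x * k ^+ 2.

Lemma iso_scaled s t : size s = size t ->
  (forall i, (i < size s)%N -> scaled s`_i t`_i) -> iso s -> iso t.
Proof.
elim: s t => [|a s IH] [|b t] //= [st] h.
have [k [k0 e]] := h 0%N isT.
have h' i : (i < size s)%N -> scaled s`_i t`_i by move=> hi; apply: (h i.+1).
move=> {IH}; move: e => /= -> {b h}.
have /choice[l hl] i : exists l, l != 0 /\ ((i < size s)%N -> t`_i = s`_i * l ^+ 2).
  have [hi|hi] := ltnP i (size s); last by exists 1; rewrite oner_neq0.
  by have [l [l0 e]] := h' i hi; exists l.
move=> /iso_consP[x [y [nz e]]]; apply/iso_consP; exists (x / k), (fun i => y i / l i); split.
  case: nz => [x0|[i [hi yi]]]; first by left; rewrite mulf_neq0 ?invr_eq0.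
  by right; exists i; rewrite -st mulf_neq0 ?invr_eq0 //; case: (hl i).
rewrite -st -[RHS]e exprMn mulrACA exprVn -mulrA mulfV ?expf_neq0 // mulr1; congr (_ + _).
apply: eq_bigr => i _; have [l0 ->] := hl i; last by [].
by rewrite exprMn exprVn mulrACA -mulrA mulfV ?expf_neq0 // mulr1.
Qed.

Lemma scaled_refl x : scaled x x.
Proof. by exists 1; rewrite oner_neq0 expr1n mulr1. Qed.

Lemma scaled_sym x y : scaled x y -> scaled y x.
Proof.
move=> [k [k0 ->]]; exists k^-1; rewrite invr_eq0 k0; split=> //.
by rewrite exprVn mulfK ?expf_neq0.
Qed.

Lemma iso_hyperbolic a c : iso [:: a; - (a * c ^+ 2)].
Proof.
by apply/iso2P; exists c, 1; rewrite oner_neq0 orbT; split=> //; ring.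
Qed.

(** Take for y the value of <a1,a2> at a zero.  If it is 0, then <a1,a2> or the other form is
    isotropic and represents everything, so any value of its companion will do. *)
Lemma iso_split a1 a2 b s : a1 != 0 -> b != 0 -> iso [:: a1, a2, b & s] ->
  exists y, [/\ y != 0, iso [:: a1; a2; - y] & iso [:: y, b & s]].
Proof.
move=> a10 b0 /iso_consP[x1 [y]].
rewrite big_ord_recl /=; set T := \sum_(i < _) _ => -[nz e].
have eT : T = \sum_(i < size (b :: s)) (b :: s)`_i * (y \o succn) i ^+ 2 by [].
have [y0|y0] := eqVneq (a1 * x1 ^+ 2 + a2 * y 0%N ^+ 2) 0; last first.
  exists (a1 * x1 ^+ 2 + a2 * y 0%N ^+ 2); split=> //.
    by apply/iso3P; exists x1, (y 0%N), 1; rewrite oner_neq0 !orbT; split=> //; ring.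
  apply/iso_consP; exists 1, (y \o succn); split; first by left; rewrite oner_neq0.
  by rewrite -eT expr1n mulr1 -addrA.
have [[z1 z2]|nz2] := pselect (x1 = 0 /\ y 0%N = 0).
  exists a1; split=> //; first by rewrite -[a1 in X in [:: _; _; X]]mulr1 -(expr1n _ 2);
    apply: iso_subseq (iso_hyperbolic a1 1); rewrite /= eqxx; case: eqP => //= _; rewrite eqxx.
  apply: iso_cons; exists (y \o succn); rewrite -eT; split; last first.
    by move: e; rewrite addrA y0 add0r.
  by case: nz => [|[[|i] [hi]]]; rewrite ?z1 ?z2 ?eqxx // => yi; exists i.
exists (- b); rewrite oppr_eq0 b0; split=> //.
  apply/iso3P; exists x1, (y 0%N), 0; split; last by rewrite y0 expr0n mulr0 addr0.
  by apply/negP => /negP; rewrite !negb_or !negbK => /and3P[/eqP ? /eqP ? _]; apply: nz2.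
apply: (@iso_subseq [:: - b; b]); first by rewrite /= !eqxx sub0seq.
by apply/iso2P; exists 1, 1; rewrite oner_neq0; split=> //; ring.
Qed.

Lemma iso_join a1 a2 y s : y != 0 -> iso [:: a1; a2; - y] -> iso (y :: s) -> iso [:: a1, a2 & s].
Proof.
move=> y0 /iso3P[x1 [x2 [x3 [nz e]]]] hs.
have [z3|z3] := eqVneq x3 0.
  apply: (@iso_subseq [:: a1; a2]); first by rewrite /= !eqxx sub0seq.
  apply/iso2P; exists x1, x2; split; first by move: nz; rewrite z3 eqxx orbF.
  by rewrite -e z3 expr0n mulr0 addr0.
have /iso_consP[x [z [nz' e']]] := hs; have [x0|x0] := eqVneq x 0.
  do 2 apply: iso_cons; exists z; case: nz' => [|h]; first by rewrite x0 eqxx.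
  by split=> //; rewrite -[RHS]e' x0 expr0n mulr0 add0r.
have nz12 : (x1 != 0) || (x2 != 0).
  apply: contraT; rewrite negb_or !negbK => /andP[/eqP z1 /eqP z2]; move/eqP: e.
  rewrite z1 z2 expr0n !mulr0 !add0r mulf_eq0 oppr_eq0 expf_eq0 /=.
  by rewrite (negPf y0) (negPf z3).
apply/iso_consP; exists (x * x1), (fun i => if i is i'.+1 then x3 * z i' else x * x2).
split.
  case/orP: nz12 => h; first by left; rewrite mulf_neq0.
  by right; exists 0%N; rewrite mulf_neq0.
rewrite big_ord_recl /= [X in _ + (_ + X)](_ : _ = x3 ^+ 2 * (- (y * x ^+ 2))); last first.
  have -> : - (y * x ^+ 2) = \sum_(i < size s) s`_i * z i ^+ 2.
    by apply/eqP; rewrite eq_sym -addr_eq0 addrC e'.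
  by rewrite mulr_sumr; apply: eq_bigr => i _ /=; ring.
have -> : a1 * (x * x1) ^+ 2 + (a2 * (x * x2) ^+ 2 + x3 ^+ 2 * - (y * x ^+ 2)) =
  x ^+ 2 * (a1 * x1 ^+ 2 + a2 * x2 ^+ 2 + - y * x3 ^+ 2) by ring.
by rewrite e mulr0.
Qed.

(** s^2 - f is the norm of s + sqrt f, and multiplication of x + y sqrt f by it turns a
    representation of g by the norm form into one of h. *)
Lemma conic_swap (f g h c s : K) : f != 0 -> g != 0 -> h != 0 -> c != 0 ->
  s ^+ 2 - f = g * h * c ^+ 2 -> iso [:: 1; - f; - g] -> iso [:: 1; - f; - h].
Proof.
move=> f0 g0 h0 c0 e /iso3P[x [y [z [nz q]]]]; apply/iso3P.
exists (s * x + f * y), (x + s * y), (g * c * z); split.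
  apply: contraT; rewrite !negb_or !negbK !mulf_eq0 (negPf g0) (negPf c0) /=.
  move=> /and3P[/eqP e1 /eqP e2 /eqP e3].
  have : (s ^+ 2 - f) * y = s * (x + s * y) - (s * x + f * y) by ring.
  rewrite e1 e2 mulr0 subrr => /eqP; rewrite e !mulf_eq0 (negPf g0) (negPf h0) (negPf c0) /= => /eqP y0.
  by move: nz e2; rewrite y0 e3 mulr0 addr0 eqxx !orbF => /eqP.
have -> : 1 * (s * x + f * y) ^+ 2 + - f * (x + s * y) ^+ 2 + - h * (g * c * z) ^+ 2 =
  (s ^+ 2 - f) * (1 * x ^+ 2 + - f * y ^+ 2 + - g * z ^+ 2) +
   g * z ^+ 2 * (s ^+ 2 - f - g * h * c ^+ 2) by ring.
by rewrite q e subrr !mulr0 addr0.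
Qed.

(** The vector product of two vectors orthogonal for phi = <a,b,c> has value
    abc phi(x) phi(y); this is how a zero of phi over K(sqrt(abcd)) gives one of
    <a,b,c,d> over K. *)
Lemma quadratic_descent (L : fieldType) (j : {rmorphism K -> L}) (r : L) a b c d :
  2%:R != 0 :> K -> a != 0 -> b != 0 -> c != 0 ->
  r ^+ 2 = j (a * b * c * d) -> nonsquare (a * b * c * d) ->
  (forall e, exists x y, e = j x + j y * r) ->
  iso (map j [:: a; b; c]) -> iso [:: a; b; c; d].
Proof.
move=> two a0 b0 c0 er ns split_r /iso3P[x [y [z [nz e]]]].
have [x1 [x2 ex]] := split_r x; have [y1 [y2 ey]] := split_r y; have [z1 [z2 ez]] := split_r z.
set D := a * b * c * d in er ns.
pose p1 := a * x1 ^+ 2 + b * y1 ^+ 2 + c * z1 ^+ 2.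
pose p2 := a * x2 ^+ 2 + b * y2 ^+ 2 + c * z2 ^+ 2.
pose q := a * x1 * x2 + b * y1 * y2 + c * z1 * z2.
have [e1 e2] : p1 + D * p2 = 0 /\ 2%:R * q = 0.
  apply: (sqrt_independent er ns); rewrite -[RHS]e ex ey ez /p1 /p2 /q /=.
  rewrite rmorphD [j (D * _)]rmorphM -er !(rmorphD, rmorphM, rmorphXn, rmorph1) /=; ring.
have q0 : q = 0 by move/eqP: e2; rewrite mulf_eq0 (negPf two) => /eqP.
have [p20|p20] := eqVneq p2 0.
  apply: (@iso_subseq [:: a; b; c]); first by rewrite /= !eqxx.
  have [n2|] := boolP [|| x2 != 0, y2 != 0 | z2 != 0]; first by apply/iso3P; exists x2, y2, z2.
  rewrite !negb_or !negbK => /and3P[/eqP x20 /eqP y20 /eqP z20].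
  apply/iso3P; exists x1, y1, z1; split; last by move: e1; rewrite p20 mulr0 addr0.
  by move: nz; rewrite ex ey ez x20 y20 z20 rmorph0 mul0r !addr0 !fmorph_eq0.
apply/iso4P; exists (b * c * (y1 * z2 - z1 * y2)), (c * a * (z1 * x2 - x1 * z2)),
  (a * b * (x1 * y2 - y1 * x2)), (a * b * c * p2); split.
  by rewrite (mulf_neq0 (mulf_neq0 (mulf_neq0 a0 b0) c0) p20) !orbT.
have -> : a * (b * c * (y1 * z2 - z1 * y2)) ^+ 2 + b * (c * a * (z1 * x2 - x1 * z2)) ^+ 2 +
  c * (a * b * (x1 * y2 - y1 * x2)) ^+ 2 + d * (a * b * c * p2) ^+ 2 =
  a * b * c * ((p1 + D * p2) * p2 - q ^+ 2) by rewrite /p1 /p2 /q /D; ring.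
by rewrite e1 q0 mul0r expr0n subrr mulr0.
Qed.

(** A zero shows that phi = <a,b,c> takes the value -abc k^2 at some vector.  On the plane
    orthogonal to it phi has determinant -1 up to squares: for u in this plane and n its
    vector product with the given vector, n + abc k u is isotropic. *)
Lemma disc_square_subform (a b c d s : K) : a != 0 -> b != 0 -> c != 0 -> d != 0 ->
  a * b * c * d = s ^+ 2 -> iso [:: a; b; c; d] -> iso [:: a; b; c].
Proof.
move=> a0 b0 c0 d0 es /iso4P[x [y [z [w [nz e]]]]]; pose D := a * b * c.
have D0 : D != 0 by rewrite !mulf_neq0.
have s0 : s != 0 by apply: contraTneq (mulf_neq0 D0 d0) => s0; rewrite es s0 expr0n eqxx.
have [w0|w0] := eqVneq w 0.
  apply/iso3P; exists x, y, z; split; first by move: nz; rewrite w0 eqxx orbF.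
  by rewrite -[RHS]e w0; ring.
(* u is a nonzero vector orthogonal to (x, y, z), and n is their vector product. *)
suff [u1 [u2 [u3 [nu eu]]]] : exists u1 u2 u3, [|| u1 != 0, u2 != 0 | u3 != 0] /\
    a * x * u1 + b * y * u2 + c * z * u3 = 0.
  pose k := s * w / D.
  have ek : a * x ^+ 2 + b * y ^+ 2 + c * z ^+ 2 = - (D * k ^+ 2).
    have -> : D * k ^+ 2 = d * w ^+ 2.
      transitivity (s ^+ 2 * w ^+ 2 / D); first by rewrite /k; field.
      by rewrite -es -/D; field.
    by apply/eqP; rewrite -addr_eq0 e.
  have k0 : k != 0 by rewrite !mulf_neq0 ?invr_eq0.
  pose Q u v t := a * u ^+ 2 + b * v ^+ 2 + c * t ^+ 2.
  have [Q0|Q0] := eqVneq (Q u1 u2 u3) 0; first by apply/iso3P; exists u1, u2, u3.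
  pose n1 := b * c * (y * u3 - z * u2); pose n2 := c * a * (z * u1 - x * u3).
  pose n3 := a * b * (x * u2 - y * u1).
  have en : Q n1 n2 n3 = - (D * k) ^+ 2 * Q u1 u2 u3.
    transitivity (D * ((a * x ^+ 2 + b * y ^+ 2 + c * z ^+ 2) * Q u1 u2 u3 -
      (a * x * u1 + b * y * u2 + c * z * u3) ^+ 2)); first by rewrite /Q /n1 /n2 /n3 /D; ring.
    by rewrite eu ek; ring.
  apply/iso3P; exists (n1 + D * k * u1), (n2 + D * k * u2), (n3 + D * k * u3); split.
    apply: contraT; rewrite !negb_or !negbK !addr_eq0 => /and3P[/eqP h1 /eqP h2 /eqP h3].
    case/eqP: Q0; have : D * k * Q u1 u2 u3 = 0.
      transitivity (- (a * n1 * u1 + b * n2 * u2 + c * n3 * u3)).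
        by rewrite h1 h2 h3 /Q; ring.
      by rewrite /n1 /n2 /n3; ring.
    by move/eqP; rewrite mulf_eq0 (negPf (mulf_neq0 D0 k0)) => /eqP.
  transitivity (Q n1 n2 n3 + (D * k) ^+ 2 * Q u1 u2 u3 +
     2%:R * (D * k) * (a * n1 * u1 + b * n2 * u2 + c * n3 * u3)); first by rewrite /Q; ring.
  by rewrite en /n1 /n2 /n3; ring.
have [x0|x0] := eqVneq x 0; first by exists 1, 0, 0; rewrite oner_neq0 x0; split=> //; ring.
by exists (b * y), (- (a * x)), 0; rewrite oppr_eq0 (mulf_neq0 a0 x0) orbT; split=> //; ring.
Qed.
End DiagonalForms.

(** * Square-free parts and descent for ternary forms *)

Section SquareFree.
Variable E : fieldType.
Implicit Types f g p s : {poly E}.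

Lemma square_free_part g : g != 0 ->
  exists m c, [/\ g = m * c ^+ 2, square_free m & c != 0].
Proof.
have [n] := ubnP (size g); elim: n g => // n IH g sg g0.
have [sq|] := pselect (square_free g).
  by exists g, 1; rewrite expr1n mulr1 oner_neq0.
move=> /existsNP[x /existsNP[y /not_implyP[e nu]]].
have [x0 y0] : x != 0 /\ y != 0.
  by split; apply: contraNneq g0 => z; rewrite e z ?mulr0 // expr0n mul0r.
have sx : (1 < size x)%N.
  rewrite ltnNge; apply/negP => /size1_polyC; move: (x`_0) => c ex; case: nu.
  have c0 : c != 0 by rewrite -polyC_eq0 -ex.
  by rewrite ex poly_unitE coefC size_polyC unitfE c0.
have [|m [c [em sm c0]]] := IH y _ y0.
  have : (0 < size y)%N by rewrite size_poly_gt0.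
  move: sg; rewrite e expr2 !size_mul ?mulf_neq0 //; move: sx.
  by move: (size x) (size y) => k l; clear; lia.
exists m, (x * c); split; rewrite ?mulf_neq0 //.
by rewrite e em exprMn; ring.
Qed.

Lemma square_free_irreducible g p : square_free g -> irreducible_poly p -> ~~ (p ^+ 2 %| g).
Proof.
move=> sq [sp _]; apply/negP => /dvdpP[y e]; have := sq p y; rewrite mulrC e => /(_ erefl).
by rewrite poly_unitE; case: eqP sp => // ->.
Qed.

Lemma square_mod f g : square_free g ->
  (forall p, irreducible_poly p -> p %| g -> exists s, p %| s ^+ 2 - f) ->
  exists s, g %| s ^+ 2 - f.
Proof.
have [n] := ubnP (size g); elim: n g => // n IH g sn sq loc.
have g0 := square_free_neq0 sq.
have [sg|sg] := leqP (size g) 1%N.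
  have g1 : g %= 1 by rewrite -size_poly_eq1 eqn_leq sg size_poly_gt0.
  by exists 0; rewrite (eqp_dvdl _ g1) dvd1p.
have [p [irr /dvdpP[h e]]] := irreducible_factor sg.
have [h0 p0] : h != 0 /\ p != 0.
  by split; apply: contraNneq g0 => z; rewrite e z ?mulr0 ?mul0r.
have np : ~~ (p %| h).
  apply: contra (square_free_irreducible sq irr) => ph.
  by rewrite e expr2 dvdp_mul.
have [|||s hs] := IH h.
- have : (0 < size h)%N by rewrite size_poly_gt0.
  move: sn; rewrite e size_mul //; case: (irr) => sp _; move: sp.
  by move: (size p) (size h) => k l; clear; lia.
- by move=> x y ex; apply: (sq x (y * p)); rewrite e ex mulrA.
- by move=> q irrq qh; apply: loc => //; rewrite e dvdp_mulr.
have [s' hs'] := loc p irr ltac:(by rewrite e dvdp_mulIr).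
have cop : coprimep h p by rewrite irreducible_coprime.
have [t [t1 t2]] := chinese_poly s s' cop; exists t.
have step d r : d %| t - r -> d %| r ^+ 2 - f -> d %| t ^+ 2 - f.
  move=> d1 d2; have -> : t ^+ 2 - f = (t - r) * (t + r) + (r ^+ 2 - f) by ring.
  by rewrite dvdp_add // dvdp_mulr.
by rewrite e Gauss_dvdp // (step _ _ t1 hs) (step _ _ t2 hs').
Qed.

End SquareFree.

Section Legendre.
Variables (E F : fieldType) (emb : {rmorphism {poly E} -> F}).
Hypotheses (frF : fraction_field emb) (two : 2%:R != 0 :> E) (con : conics_isotropic E).
Let emb0 g : (emb g == 0) = (g == 0) := emb_eq0 frF g.

Lemma locally_isotropic_completion v a : trivial_on_constants emb v -> all (predC1 0) a -> locally_isotropic v a ->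
  exists (K : fieldType) (w : K -> int) (iota : {rmorphism F -> K}),
    is_completion v w iota /\ iso (map iota a).
Proof.
move=> tv a0 loc; have [K [w [iota [Hw vw dense compl]]]] := completion_exists tv.1.
have [two_F v2] := two_val frF tv two.
exists K, w, iota; split; first by split.
exact: (locally_isotropic_complete vw Hw).
Qed.

(** In the completion x^2 - f y^2 = g z^2.  The order of the right hand side is odd, so
    it cannot cancel against an even one, and f is congruent to (x / y)^2. *)
Lemma legendre_local p v (f g : {poly E}) : irreducible_poly p -> padic emb p v ->
  f != 0 -> g != 0 -> p %| g -> ~~ (p ^+ 2 %| g) ->
  locally_isotropic v [:: 1; - emb f; - emb g] -> exists s, p %| s ^+ 2 - f.
Proof.
move=> irr hv f0 g0 pg npg loc.
have [pf|npf] := boolP (p %| f).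
  by exists 0; rewrite expr0n sub0r dvdpNr.
have tv : trivial_on_constants emb v by case: hv.
have [|K [w [iota [[Hw vw dense _]]]]] := locally_isotropic_completion tv _ loc.
  by rewrite /= !oppr_eq0 !emb0 oner_neq0 f0 g0.
rewrite /= rmorph1 !rmorphN => /iso3P[x [y [z [nz e]]]].
have vf : w (iota (emb f)) = 0.
  by rewrite vw ?emb0 //; case: hv => _ nd _; apply: nd.
have vg : w (iota (emb g)) = 1.
  have [h eg] := dvdpP _ _ pg.
  have nph : ~~ (p %| h) by apply: contra npg => ph; rewrite eg expr2 dvdp_mul.
  by rewrite vw ?emb0 // eg mulrC -[p]expr1 (padic_val frF 1 hv irr nph).
set f' := iota (emb f) in e vf; set g' := iota (emb g) in e vg.
have f'0 : f' != 0 by rewrite fmorph_eq0 emb0.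
have g'0 : g' != 0 by rewrite fmorph_eq0 emb0.
have e1 : x ^+ 2 - f' * y ^+ 2 = g' * z ^+ 2.
  by apply/eqP; rewrite -subr_eq0; apply/eqP; rewrite -[RHS]e; ring.
have wg t : t != 0 -> w (g' * t ^+ 2) = 1 + w t *+ 2.
  by move=> t0; rewrite (valM Hw) ?expf_neq0 // (valX Hw) // vg.
have y0 : y != 0.
  apply/eqP => y0; move: e1 nz; rewrite y0 eqxx expr0n mulr0 subr0 /= => e1 nz.
  have z0 : z != 0.
    apply/eqP => z0; move/eqP: e1; rewrite z0 expr0n mulr0 expf_eq0 /= => x0.
    by move: nz; rewrite x0 z0 eqxx.
  have x0 : x != 0.
    apply/eqP => x0; move/eqP: e1; rewrite x0 expr0n eq_sym mulf_eq0 expf_eq0 /=.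
    by rewrite (negPf g'0) (negPf z0).
  by have := congr1 w e1; rewrite wg // (valX Hw) //; move: (w x) (w z); clear; lia.
pose s := x / y; pose t := z / y.
have e2 : s ^+ 2 - f' = g' * t ^+ 2.
  transitivity ((x ^+ 2 - f' * y ^+ 2) / y ^+ 2); first by rewrite /s; field.
  by rewrite e1 /t; field.
have ws : val_ge w 0 s /\ val_ge w 1 (s ^+ 2 - f').
  have [t0|t0] := eqVneq t 0.
    have es : s ^+ 2 = f' by apply/eqP; rewrite -subr_eq0 e2 t0 expr0n mulr0.
    rewrite es subrr val_ge0; split=> //.
    have s0 : s != 0 by apply: contraNneq f'0 => s0; rewrite -es s0 expr0n.
    by have := congr1 w es; rewrite val_ge_neq0 // (valX Hw) // vf; move: (w s); clear; lia.
  have n0 : g' * t ^+ 2 != 0 by rewrite mulf_neq0 ?expf_neq0.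
  have [tn|tp] := ltP (w t) 0; last first.
    rewrite e2 [val_ge w 1 _]val_ge_neq0 // wg //; split; last by move: tp; move: (w t); clear; lia.
    have [->|s0] := eqVneq s 0; first exact: val_ge0.
    have hs : val_ge w 0 (s ^+ 2).
      rewrite -[s ^+ 2](subrK f') e2; apply: (val_geD Hw).
        by rewrite val_ge_neq0 // wg //; move: tp; move: (w t); clear; lia.
      by rewrite val_ge_neq0 // vf.
    by move: hs; rewrite !val_ge_neq0 ?expf_neq0 // (valX Hw) //; move: (w s); clear; lia.
  have [|s0 ws] := @val_perturb _ _ Hw (g' * t ^+ 2) f' n0.
    by rewrite val_ge_neq0 // vf wg //; move: tn; move: (w t); clear; lia.
  have es : s ^+ 2 = g' * t ^+ 2 + f' by rewrite -e2 subrK.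
  move: s0 ws; rewrite -es wg // expf_eq0 /= => s0; rewrite (valX Hw) //.
  by move: (w s) (w t); clear; lia.
have [x' hx'] := dense 1 s.
have hx0 : val_ge v 0 x'.
  rewrite -(val_ge_iota vw) -[iota x'](subrK s); apply: (val_geD Hw); last by case: ws.
  by rewrite (val_ge_sym Hw); apply: val_geW hx'.
have [r hr] := padic_reduce frF irr hv hx0; exists r.
have hsr : val_ge w 1 (s - iota (emb r)).
  rewrite -[s](subrK (iota x')) -addrA; apply: (val_geD Hw) => //.
  by rewrite -rmorphB (val_ge_iota vw).
rewrite -(padic_dvd frF _ irr hv) -(val_ge_iota vw) !rmorphB !rmorphXn /=.
have -> : iota (emb r) ^+ 2 - iota (emb f) =
   (s ^+ 2 - f') - (s - iota (emb r)) * (2%:R * s - (s - iota (emb r))) by rewrite -/f'; ring.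
apply: (val_geB Hw); first by case: ws.
rewrite -[1]addr0; apply: (val_geM Hw) => //.
have s1 : val_ge w 0 (s - iota (emb r)) by apply: val_geW hsr.
apply: (val_geB Hw) => //; rewrite mulr_natl mulr2n.
by apply: (val_geD Hw); case: ws.
Qed.

(** Descent on the degrees: f is a square s^2 modulo g, with s of smaller degree than g, and
    by [conic_swap] g may be replaced with the square-free part of (s^2 - f) / g. *)
Lemma legendre_square_free (f g : {poly E}) : square_free f -> square_free g ->
  (forall p v, irreducible_poly p -> padic emb p v -> locally_isotropic v [:: 1; - emb f; - emb g]) ->
  iso [:: 1; - emb f; - emb g].
Proof.
have swap (K : fieldType) (a b c : K) : iso [:: a; b; c] -> iso [:: a; c; b].
  move=> /iso3P[x [y [z [nz e]]]]; apply/iso3P; exists x, z, y; rewrite -[RHS]e; split; last by ring.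
  by move: nz; do 3 case: (_ != 0).
have [n] := ubnP (size f + size g); elim: n f g => // n IH f g sn sf sg loc.
have f0 := square_free_neq0 sf; have g0 := square_free_neq0 sg.
have two_F : 2%:R != 0 :> F.
  by rewrite -(rmorph_nat (emb \o polyC)) /= emb0 polyC_eq0.
wlog le : f g sn sf sg f0 g0 loc / (size f <= size g)%N => [hw|].
  have [le|le] := leqP (size f) (size g); first exact: hw.
  apply: (swap); apply: hw => //; [by rewrite addnC | | exact: ltnW].
  move=> p v irr hv; have [tv _ _] := hv; have [_ v2] := two_val frF tv two.
  apply: locally_isotropic_transfer (loc p v irr hv) => //; first exact: tv.1.
    by rewrite /= !oppr_eq0 !emb0 oner_neq0 f0 g0.
  by move=> K iota; apply: (swap).
have [s1|s1] := leqP (size g) 1%N.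
  rewrite (size1_polyC s1) (size1_polyC (leq_trans le s1)).
  have := iso_morph (emb \o polyC) (con 1 (- f`_0) (- g`_0)).
  by rewrite /= !polyCN !rmorphN !rmorph1.
have [s0 hs0] : exists s, g %| s ^+ 2 - f.
  apply: square_mod => // p irr pg; have [v hv] := padic_exists frF irr.
  apply: (legendre_local irr hv f0 g0 pg) (loc p v irr hv).
  exact: square_free_irreducible.
pose s := s0 %% g; have hs : g %| s ^+ 2 - f.
  have -> : s ^+ 2 - f = (s0 ^+ 2 - f) - g * (s0 %/ g) * (s0 + s).
    by rewrite {1 3}(divp_eq s0 g) -/s; ring.
  by rewrite dvdp_sub // -mulrA dvdp_mulr.
have ss : (size s < size g)%N by rewrite ltn_modp.
have [z|nz] := eqVneq (s ^+ 2 - f) 0.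
  apply/iso3P; exists (emb s), 1, 0; rewrite oner_neq0 orbT; split=> //.
  by rewrite expr1n mul1r expr0n mulr0 addr0 mulr1 -rmorphXn -rmorphB /= z rmorph0.
have /dvdpP[h' eh'] := hs; have h'0 : h' != 0 by apply: contraNneq nz => z; rewrite eh' z mul0r.
have [h [c [eh sh c0]]] := square_free_part h'0; have h0 := square_free_neq0 sh.
have eq : emb s ^+ 2 - emb f = emb g * emb h * emb c ^+ 2.
  by rewrite -!rmorphXn -!rmorphM -rmorphB /= eh' eh; congr (emb _); ring.
have eq' : emb s ^+ 2 - emb f = emb h * emb g * emb c ^+ 2 by rewrite eq [emb g * _]mulrC.
have sizeh : (size h < size g)%N.
  have : (size (s ^+ 2 - f)%R <= maxn (size s + size s).-1 (size f))%N.
    by rewrite (leq_trans (size_polyD _ _)) // size_polyN geq_max !leq_max size_mul_leq leqnn orbT.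
  rewrite eh' eh expr2 !size_mul ?mulf_neq0 //.
  have : (0 < size c)%N by rewrite size_poly_gt0.
  have : (0 < size h)%N by rewrite size_poly_gt0.
  by move: s1 ss le; move: (size h) (size c) (size s) (size f) (size g); clear; lia.
apply: (conic_swap _ _ _ _ eq'); rewrite ?emb0 //.
apply: IH => //; first by move: sn sizeh; move: (size h) (size f) (size g); clear; lia.
move=> p v irr hv; have [tv _ _] := hv; have [_ v2] := two_val frF tv two.
apply: locally_isotropic_transfer (loc p v irr hv) => //; first exact: tv.1.
  by rewrite /= !oppr_eq0 !emb0 oner_neq0 f0 g0.
move=> K iota; rewrite /= !rmorphN !rmorph1.
apply: (conic_swap (c := iota (emb c)) (s := iota (emb s))); rewrite ?fmorph_eq0 ?emb0 //.
by move: (congr1 iota eq); rewrite !(rmorphB, rmorphM, rmorphXn) /=.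
Qed.

End Legendre.

(** * Legendre's theorem *)

Section Scaling.
Variable K : fieldType.

Lemma scaled_morph (L : fieldType) (j : {rmorphism K -> L}) x y :
  scaled x y -> scaled (j x) (j y).
Proof.
by move=> [k [k0 ->]]; exists (j k); rewrite fmorph_eq0 k0 rmorphM rmorphXn.
Qed.

Lemma iso_mulr (k : K) s : k != 0 -> iso s -> iso (map ( *%R k) s).
Proof.
move=> k0 [x [nz e]]; exists x; rewrite size_map; split=> //.
rewrite -[RHS](mulr0 k) -[X in _ = k * X]e mulr_sumr; apply: eq_bigr => i _.
by rewrite (nth_map 0) // mulrA.
Qed.

Lemma iso_normalize (a b c : K) : a != 0 ->
  iso [:: a; b; c] <-> iso [:: 1; a * b; a * c].
Proof.
move=> a0; split=> [/(iso_mulr a0)|/(iso_mulr a0)] /=.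
  apply: iso_scaled => // -[|[|[|]]] //= _; try exact: scaled_refl.
  by exists a^-1; rewrite invr_eq0; split=> //; field.
apply: iso_scaled => // -[|[|[|]]] //= _.
- by exists 1; rewrite oner_neq0; split=> //; ring.
- by exists a^-1; rewrite invr_eq0; split=> //; field.
by exists a^-1; rewrite invr_eq0; split=> //; field.
Qed.

End Scaling.

Section Legendre.
Variables (E F : fieldType) (emb : {rmorphism {poly E} -> F}).
Hypotheses (frF : fraction_field emb) (two : 2%:R != 0 :> E).
Let emb0 g : (emb g == 0) = (g == 0) := emb_eq0 frF g.

Lemma two_frac : 2%:R != 0 :> F.
Proof. by rewrite -(rmorph_nat (emb \o polyC)) /= emb0 polyC_eq0. Qed.

Lemma square_free_class x : x != 0 -> exists f, square_free f /\ scaled (emb f) x.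
Proof.
have [a [b [b0 ->]]] := frF.2 x => x0.
have a0 : a != 0 by apply: contraNneq x0 => ->; rewrite rmorph0 mul0r.
have [m [c [e sm c0]]] := square_free_part (mulf_neq0 a0 b0).
exists m; split=> //; exists (emb c / emb b).
rewrite mulf_neq0 ?invr_eq0 ?emb0 //; split=> //.
rewrite exprMn mulrA -rmorphXn -rmorphM -e rmorphM /=; field.
by rewrite emb0.
Qed.

Lemma locally_isotropic_morph v (a b : seq F) : trivial_on_constants emb v -> all (predC1 0) a ->
  (forall (K : fieldType) (iota : {rmorphism F -> K}), iso (map iota a) -> iso (map iota b)) ->
  locally_isotropic v a -> locally_isotropic v b.
Proof.
move=> tv a0 h; have [two_F v2] := two_val frF tv two.
exact: locally_isotropic_transfer tv.1 two_F v2 a0 h.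
Qed.

Lemma locally_isotropic_scaled v (a b : seq F) : trivial_on_constants emb v -> all (predC1 0) a ->
  size a = size b -> (forall i, (i < size a)%N -> scaled a`_i b`_i) ->
  locally_isotropic v a -> locally_isotropic v b.
Proof.
move=> tv a0 sab h; apply: locally_isotropic_morph => // K iota.
apply: iso_scaled; rewrite ?size_map // => i hi.
by rewrite !(nth_map 0) -?sab //; apply/scaled_morph/h.
Qed.

Lemma legendre : conics_isotropic E -> forall a b c : F, a != 0 -> b != 0 -> c != 0 ->
  (forall p v, irreducible_poly p -> padic emb p v -> locally_isotropic v [:: a; b; c]) ->
  iso [:: a; b; c].
Proof.
move=> con a b c a0 b0 c0 loc; apply/(iso_normalize _ _ a0).
have [|f [sf hf]] := @square_free_class (- (a * b)); first by rewrite oppr_eq0 mulf_neq0.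
have [|g [sg hg]] := @square_free_class (- (a * c)); first by rewrite oppr_eq0 mulf_neq0.
have scN x y : scaled x (- y) -> scaled (- x) y.
  by move=> [k [k0 e]]; exists k; split=> //; rewrite mulNr -e opprK.
have h i : (i < 3)%N -> scaled [:: 1; - emb f; - emb g]`_i [:: 1; a * b; a * c]`_i.
  by case: i => [|[|[|]]] //= _; [exact: scaled_refl | exact: scN | exact: scN].
apply: (@iso_scaled _ [:: 1; - emb f; - emb g] [:: 1; a * b; a * c] erefl h); apply: (legendre_square_free frF two con) => // p v irr hv.
have tv : trivial_on_constants emb v by case: hv.
have n0 : all (predC1 0) [:: 1; a * b; a * c] by rewrite /= oner_neq0 !mulf_neq0.
apply: (locally_isotropic_scaled tv n0) => //; first by move=> i hi; apply/scaled_sym/h.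
apply: (locally_isotropic_morph tv _ _ (loc p v irr hv)); first by rewrite /= a0 b0 c0.
move=> K iota /=; have ia0 : iota a != 0 by rewrite fmorph_eq0.
by move/(iso_normalize _ _ ia0); rewrite /= rmorph1 !rmorphM.
Qed.

(** In [legendre] there is no condition at infinity.  A Moebius transformation moves this
    exception to an arbitrary rational point. *)
Lemma legendre_at t : conics_isotropic E -> forall a b c : F, a != 0 -> b != 0 -> c != 0 ->
  (forall v, trivial_on_constants emb v -> v (emb ('X - t%:P)) <= 0 -> locally_isotropic v [:: a; b; c]) ->
  iso [:: a; b; c].
Proof.
move=> con a b c a0 b0 c0 loc.
have [s [r [sX rX [sc rc] sr rs]]] := moebius frF t.
have -> : [:: a; b; c] = map r (map s [:: a; b; c]) by rewrite /= !sr.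
apply/iso_morph/legendre; rewrite ?fmorph_eq0 // => p v irr hv.
have tv : trivial_on_constants emb v by case: hv.
apply: (@locally_isotropic_comp _ _ s v [:: a; b; c]); apply: loc; first exact: omega_comp sc rs.
rewrite /= rmorphB rmorphB sX sc addrAC subrr add0r (valV tv.1) ?emb0 ?polyX_eq0 //.
by have := padic_ge0 frF 'X irr hv; rewrite val_ge_neq0 ?emb0 ?polyX_eq0 // oppr_le0.
Qed.

Lemma finite_place v t : trivial_on_constants emb v -> 0 < v (emb ('X - t%:P)) ->
  exists p, [/\ irreducible_poly p, padic emb p v & p %| 'X - t%:P].
Proof.
move=> tv pos; have X0 : emb 'X != 0 by rewrite emb0 polyX_eq0.
have [vX|[p [irr hv]]] := valuation_cases frF tv.
  have [|_ e] := @val_perturb _ _ tv.1 (emb 'X) (- emb t%:P) X0.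
    rewrite (val_geN tv.1); apply: val_geW (constant_val _ tv).
    by move: vX; move: (v _); clear; lia.
  by move: pos; rewrite rmorphB e; move: vX; move: (v _); clear; lia.
exists p; split=> //; rewrite -(padic_dvd frF _ irr hv) val_ge_neq0 ?emb0 ?polyXsubC_eq0 //.
Qed.

Lemma completion_morph v (a : seq F) : trivial_on_constants emb v ->
  (forall (K : fieldType) (w : K -> int) (iota : {rmorphism F -> K}),
     is_completion v w iota ->
     (forall x y : K, x != 0 -> val_ge w (w x + 1) (y - x) -> scaled x y) -> iso (map iota a)) ->
  locally_isotropic v a.
Proof.
move=> tv h; have [K [w [iota [Hw vw dense compl]]]] := completion_exists tv.1.
apply: (iso_locally_isotropic vw Hw dense); apply: (h K w) => [|x y x0 hxy]; first by split.
have [two_F v2] := two_val frF tv two.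
apply: (close_square Hw) => //; first by rewrite -(rmorph_nat iota) fmorph_eq0.
by rewrite -(rmorph_nat iota) vw.
Qed.

(** Up to squares the coefficients are, locally at t, their values at t. *)
Lemma locally_isotropic_specialize v t (s : seq {poly E}) : trivial_on_constants emb v ->
  0 < v (emb ('X - t%:P)) -> (forall a, a \in s -> a.[t] != 0) ->
  iso [seq a.[t] | a <- s] -> locally_isotropic v (map emb s).
Proof.
move=> tv pos ns hs; have [p [irr hv pt]] := finite_place tv pos.
apply: completion_morph => // K w iota [Hw vw _ _] close.
have := iso_morph (iota \o (emb \o polyC)) hs.
apply: iso_scaled; rewrite ?size_map // => i hi.
rewrite !(nth_map 0) ?size_map // -?map_comp; set a := s`_i.
have at0 : a.[t] != 0 by apply: ns; rewrite mem_nth.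
have e0 : emb (a.[t])%:P != 0 by rewrite emb0 polyC_eq0.
apply: close; first by rewrite /= fmorph_eq0.
rewrite /= vw // (tv.2 _ at0) add0r -rmorphB (val_ge_iota vw) -rmorphB (padic_dvd frF _ irr hv).
apply: dvdp_trans pt _; rewrite dvdp_XsubCl /root hornerD hornerN hornerC subrr //.
Qed.

End Legendre.

(** * Lists of distinct primes *)

Section PrimeLists.
Variable E : fieldType.
Implicit Types p q a : {poly E}.
Implicit Types S : seq {poly E}.

Definition distinct_primes S :=
  (forall q, q \in S -> irreducible_poly q) /\ pairwise (@coprimep E) S.

Lemma prime_divisors a : a != 0 -> exists S,
  [/\ distinct_primes S, forall q, q \in S -> q %| a &
      forall p, irreducible_poly p -> p %| a -> exists2 q, q \in S & p %= q].
Proof.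
have [n] := ubnP (size a); elim: n a => // n IH a sa a0.
have [s1|s1] := leqP (size a) 1%N.
  exists [::]; split=> // p [sp _] /(dvdp_leq a0) le.
  by have := leq_trans le s1; rewrite leqNgt sp.
have [p [irr pa]] := irreducible_factor s1.
have [k [h [e ph]]] := prime_power_part irr a0.
have h0 : h != 0 by apply: contraNneq ph => ->; rewrite dvdp0.
have p0 := irredp_neq0 irr.
have [|S [[irrS cop] divS full]] := IH h _ h0.
  case: k e => [|k] e; first by by case/negP: ph; rewrite -[h]mul1r -[1](expr0 p) -e.
  have : (size (p ^+ k * h)%R < n)%N.
    move: sa; rewrite e exprS -mulrA [size (p * _)]size_mul ?mulf_neq0 ?expf_neq0 //.
    have : (0 < size (p ^+ k * h)%R)%N by rewrite size_poly_gt0 mulf_neq0 ?expf_neq0.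
    by case: irr => sp _; move: sp; move: (size p) (size (p ^+ k * h)%R) => i j; clear; lia.
  apply: leq_ltn_trans; apply: dvdp_leq; first by rewrite mulf_neq0 ?expf_neq0.
  by rewrite dvdp_mull.
exists (p :: S); split.
- split=> [q|/=]; first by rewrite inE => /orP[/eqP ->|/irrS].
  rewrite cop andbT; apply/allP => q qS; rewrite coprimep_sym irreducible_coprime //.
  apply: contra ph => pq; exact: dvdp_trans pq (divS q qS).
- by move=> q; rewrite inE => /orP[/eqP -> //|/divS qh]; rewrite e dvdp_mull.
move=> q irrq; rewrite e => /(irreducible_dvdM irrq)/orP[qp|qh].
  exists p; first exact: mem_head.
  have {}qp : q %| p.
    by elim: (k) qp => [|i IHi]; [rewrite expr0 dvdp1; case: irrq; case: eqP => // -> |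
      rewrite exprS => /(irreducible_dvdM irrq)/orP[]].
  by case: irr => _; apply=> //; case: irrq => sq _; rewrite gtn_eqF.
by have [q' q'S eq'] := full q irrq qh; exists q' => //; rewrite inE q'S orbT.
Qed.

Lemma chinese_seq S (b : {poly E} -> {poly E}) : pairwise (@coprimep E) S ->
  exists c, forall q, q \in S -> q %| c - b q.
Proof.
elim: S => [|p S IH] /=; first by exists 0.
move=> /andP[/allP copS /IH[c hc]].
have cop : coprimep p (\prod_(q <- S) q).
  elim: S copS {IH hc} => [|q S IH] copS; first by rewrite big_nil coprimep1.
  rewrite big_cons coprimepMr copS ?mem_head // IH // => r rS.
  by apply: copS; rewrite inE rS orbT.
have [d [d1 d2]] := chinese_poly (b p) c cop; exists d => q.
rewrite inE => /orP[/eqP -> //|qS]; rewrite -[d - b q](subrK (c - b q)) dvdp_add ?hc //.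
have -> : d - b q - (c - b q) = d - c by ring.
by apply: dvdp_trans d2; rewrite (big_rem q qS) /= dvdp_mulr.
Qed.

Lemma radical_prod S : distinct_primes S -> radical (\prod_(q <- S) q).
Proof.
move=> [irr]; elim: S irr => [|p S IH] irr /=.
  by move=> _; rewrite big_nil; apply: radical_unit; rewrite size_poly1.
move=> /andP[/allP copS pw]; rewrite big_cons; apply: radical_mul.
- elim: S copS {IH irr pw} => [|q S IH] copS; first by rewrite big_nil coprimep1.
  rewrite big_cons coprimepMr copS ?mem_head // IH // => r rS.
  by apply: copS; rewrite inE rS orbT.
- by apply/radical_irreducible/irr/mem_head.
by apply: IH => // q qS; apply: irr; rewrite inE qS orbT.
Qed.

Lemma prime_list_uniq S : distinct_primes S -> uniq S.
Proof.
move=> [irr]; elim: S irr => //= p S IH irr /andP[/allP copS pw]; rewrite IH //; last first.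
  by move=> q qS; apply: irr; rewrite inE qS orbT.
rewrite andbT; apply/negP => /copS; rewrite coprimepp.
by have [sp _] := irr p (mem_head _ _); rewrite gtn_eqF.
Qed.

End PrimeLists.

(** * Local square classes *)

Section Local.
Variables (E F : fieldType) (emb : {rmorphism {poly E} -> F}).
Hypotheses (frF : fraction_field emb) (two : 2%:R != 0 :> E).
Hypothesis pac : pseudo_algebraically_closed E.
Let emb0 g : (emb g == 0) = (g == 0) := emb_eq0 frF g.

Lemma locally_isotropic_local v (a b : seq F) : trivial_on_constants emb v -> all (predC1 0) a ->
  (forall (K : fieldType) (w : K -> int) (iota : {rmorphism F -> K}),
     is_completion v w iota ->
     (forall x y : K, x != 0 -> val_ge w (w x + 1) (y - x) -> scaled x y) ->
     iso (map iota a) -> iso (map iota b)) ->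
  locally_isotropic v a -> locally_isotropic v b.
Proof.
move=> tv a0 h loc; apply: (completion_morph frF two tv) => K w iota comp close.
apply: (h _ w) => //; have [two_F v2] := two_val frF tv two.
by case: comp => Hw vw _ compl; exact: (locally_isotropic_complete vw Hw).
Qed.

Lemma locally_isotropic_ext (v v' : F -> int) (a : seq F) : (forall x, x != 0 -> v x = v' x) ->
  locally_isotropic v a -> locally_isotropic v' a.
Proof.
move=> e loc N; have [x [k [hk xk hx]]] := loc N; exists x, k; split=> //.
by move: hx; rewrite /val_ge; case: eqVneq => //= n0; rewrite e.
Qed.

Section Completion.
Variables (p : {poly E}) (v : F -> int) (K : fieldType) (w : K -> int) (iota : {rmorphism F -> K}).
Hypotheses (irr : irreducible_poly p) (hv : padic emb p v) (comp : is_completion v w iota).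
Hypothesis close : forall x y : K, x != 0 -> val_ge w (w x + 1) (y - x) -> scaled x y.
Let Hw : Z_valuation w. Proof. by case: comp. Qed.
Let vw : forall x, x != 0 -> w (iota x) = v x. Proof. by case: comp. Qed.
Lemma close_mod a b : ~~ (p %| a) -> p %| b - a -> scaled (iota (emb a)) (iota (emb b)).
Proof.
move=> pa pab; have a0 : a != 0 by apply: contraNneq pa => ->; rewrite dvdp0.
apply: close; first by rewrite fmorph_eq0 emb0.
rewrite vw ?emb0 //; have [_ nd _] := hv; rewrite (nd _ pa).
by rewrite add0r -!rmorphB (val_ge_iota vw) (padic_dvd frF _ irr hv).
Qed.

(** Up to a square, y has order 0 or 1; the rest is a unit, which is close to a polynomial. *)
Lemma local_class (y : K) : y != 0 -> exists (e : bool) (u : {poly E}),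
  ~~ (p %| u) /\ scaled (iota (emb (p ^+ e * u))) y.
Proof.
move=> y0; pose e := odd `|w y|%N.
have pi0 : iota (emb p) != 0 by rewrite fmorph_eq0 emb0 (irredp_neq0 irr).
have wpi : w (iota (emb p)) = 1 by rewrite vw ?emb0 ?(irredp_neq0 irr) //; case: hv.
have [m hm] : exists m : int, w y + (e : nat)%:Z + m *+ 2 = 0.
  exists (- (((w y) + (e : nat)%:Z) %/ 2)%Z); rewrite /e; lia.
have [k k0 wk] : exists2 k, k != 0 & w k = m by case: Hw.
pose z := y * iota (emb p) ^+ e * k ^+ 2.
have z0 : z != 0 by rewrite !mulf_neq0 ?expf_neq0.
have wz : w z = 0.
  rewrite /z !(valM Hw) ?mulf_neq0 ?expf_neq0 // !(valX Hw) // wpi wk -[RHS]hm.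
  by move: (w y) (e : nat); clear; lia.
have [x hx] : exists x, val_ge w 1 (z - iota x) by case: comp => _ _ dense _; apply: dense.
have vx : val_ge v 0 x.
  rewrite -(val_ge_iota vw) -[iota x](subrK z); apply: (val_geD Hw); last by rewrite val_ge_neq0 ?wz.
  by rewrite (val_ge_sym Hw); apply: val_geW hx.
have [u hu] := padic_reduce frF irr hv vx.
have hz : val_ge w 1 (iota (emb u) - z).
  rewrite (val_ge_sym Hw) -[z](subrK (iota x)) -addrA; apply: (val_geD Hw) => //.
  by rewrite -rmorphB (val_ge_iota vw).
exists e, u; split.
  apply/negP; rewrite -(padic_dvd frF _ irr hv) -(val_ge_iota vw) => h.
  have : val_ge w 1 z by rewrite -[z](subKr (iota (emb u))); apply: (val_geB Hw).
  by rewrite val_ge_neq0 // wz.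
have : scaled z (iota (emb u)) by apply: close; rewrite // wz.
move=> [l [l0 eu]]; apply/scaled_sym; exists (iota (emb p) ^+ e * k * l).
rewrite !mulf_neq0 ?expf_neq0 //; split=> //.
by rewrite !rmorphM rmorphXn eu /z rmorphXn; ring.
Qed.

Lemma unit_conic_completion a b c : ~~ (p %| a) -> ~~ (p %| b) -> ~~ (p %| c) ->
  iso [seq iota (emb x) | x <- [:: a; b; c]].
Proof.
move=> pa pb pc; have [x [y [z [pz h]]]] := residue_conic pac two irr pa pb pc.
have [||l [l0 e]] := @close_mod (- (c * z ^+ 2)) (a * x ^+ 2 + b * y ^+ 2).
- rewrite dvdpNr; apply/negP => /(irreducible_dvdM irr); rewrite (negPf pc) /=.
  by rewrite expr2 => /(irreducible_dvdM irr); rewrite (negPf pz).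
- by rewrite opprK.
apply/iso3P; exists (iota (emb x)), (iota (emb y)), (iota (emb z) * l); split.
  rewrite (_ : iota (emb z) * l != 0) ?orbT // mulf_neq0 // fmorph_eq0 emb0.
  by apply: contraNneq pz => ->; rewrite dvdp0.
move: e; rewrite !(rmorphD, rmorphN, rmorphXn, rmorphM) /= => ->; ring.
Qed.

(** Among five coefficients three have orders of the same parity, and these form a conic with
    unit coefficients up to a common factor. *)
Lemma quinary_completion (s : seq K) : all (predC1 0) s -> (4 < size s)%N -> iso s.
Proof.
move=> s0 ss; have /choice[c hc] (y : K) : exists eu : bool * {poly E}, y != 0 ->
    ~~ (p %| eu.2) /\ scaled (iota (emb (p ^+ eu.1 * eu.2))) y.
  have [_|y0] := eqVneq y 0; first by exists (true, 0).
  by have [e [u h]] := local_class y0; exists (e, u).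
have key b : (2 < size [seq y <- s | (c y).1 == b])%N -> iso s.
  move=> big; apply: (iso_subseq (filter_subseq (fun y => (c y).1 == b) s)).
  have : all (fun y => (y != 0) && ((c y).1 == b)) [seq y <- s | (c y).1 == b].
    apply/allP => y; rewrite mem_filter => /andP[-> ys]; rewrite andbT.
    exact: (allP s0 _ ys).
  case: {ss}[seq _ <- s | _] big => [|y1 [|y2 [|y3 r]]] //= _.
  move=> /and4P[/andP[n1 /eqP b1] /andP[n2 /eqP b2] /andP[n3 /eqP b3] _].
  apply: (@iso_subseq _ [:: y1; y2; y3]); first by rewrite /= !eqxx sub0seq.
  have [p1 h1] := hc _ n1; have [p2 h2] := hc _ n2; have [p3 h3] := hc _ n3.
  have pb : iota (emb p) ^+ b != 0 by rewrite expf_neq0 // fmorph_eq0 emb0 (irredp_neq0 irr).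
  have := iso_mulr pb (unit_conic_completion p1 p2 p3); apply: iso_scaled => //.
  move: h1 h2 h3; rewrite b1 b2 b3 !rmorphM !rmorphXn => h1 h2 h3.
  by case=> [|[|[|]]].
have [|le] := ltnP 2 (size [seq y <- s | (c y).1 == true]); first exact: key.
apply: (key false); move: ss le; rewrite !size_filter.
rewrite -(count_predC (fun y => (c y).1 == true) s).
have -> : count (predC (fun y => (c y).1 == true)) s = count (fun y => (c y).1 == false) s.
  by apply: eq_count => y /=; case: (c y).1.
by move: (count _ s) (count _ s) => i j; clear; lia.
Qed.

End Completion.

Lemma unit_conic p v a b c : irreducible_poly p -> padic emb p v ->
  ~~ (p %| a) -> ~~ (p %| b) -> ~~ (p %| c) -> locally_isotropic v (map emb [:: a; b; c]).
Proof.
move=> irr hv pa pb pc; have [tv _ _] := hv.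
apply: (completion_morph frF two tv) => K w iota comp close.
by rewrite -map_comp; apply: (unit_conic_completion irr hv comp close).
Qed.

Lemma local_quinary p v (s : seq F) : irreducible_poly p -> padic emb p v ->
  all (predC1 0) s -> (4 < size s)%N -> locally_isotropic v s.
Proof.
move=> irr hv s0 ss; have [tv _ _] := hv.
apply: (completion_morph frF two tv) => K w iota comp close.
apply: (quinary_completion irr hv comp close); rewrite ?size_map //.
by rewrite all_map; apply: sub_all s0 => x /=; rewrite fmorph_eq0.
Qed.

End Local.

(** * Linking two forms by a common value *)

Section Linking.
Variables (E F : fieldType) (emb : {rmorphism {poly E} -> F}).
Hypotheses (frF : fraction_field emb) (two : 2%:R != 0 :> E).
Hypothesis pac : pseudo_algebraically_closed E.
Let emb0 g : (emb g == 0) = (g == 0) := emb_eq0 frF g.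

Lemma padic_eqp p q v : irreducible_poly p -> p %= q -> padic emb p v -> padic emb q v.
Proof.
move=> irrp pq [tv nd vp]; split=> // [g|].
  by rewrite -(eqp_dvdl _ pq); apply: nd.
have p0 := irredp_neq0 irrp.
have q0 : q != 0 by rewrite -size_poly_gt0 -(eqp_size pq) size_poly_gt0.
have /eqpP[[c d] /= /andP[c0 d0] e] := pq.
have := congr1 (v \o emb) e; rewrite /= -!mul_polyC !rmorphM /=.
by rewrite !(valM tv.1) ?emb0 ?polyC_eq0 // (tv.2 _ c0) (tv.2 _ d0) !add0r vp => <-.
Qed.

Lemma irreducible_dvd_prod (p : {poly E}) S (f : {poly E} -> {poly E}) : irreducible_poly p ->
  p %| \prod_(q <- S) f q -> exists2 q, q \in S & p %| f q.
Proof.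
move=> irr; elim: S => [|q S IH].
  by rewrite big_nil dvdp1; case: irr; case: eqP => // ->.
rewrite big_cons => /(irreducible_dvdM irr)/orP[pq|/IH[r rS pr]]; first by exists q; rewrite ?mem_head.
by exists r; rewrite // inE rS orbT.
Qed.

(** Let g0 be the product of the primes q with e q odd.  By [square_class_value] there is a
    linear factor t - X whose class modulo all the primes of S makes g = g0 (t - X) have
    the prescribed classes; t is the only zero of g that is not prescribed. *)
Lemma prescribe_classes S (e : {poly E} -> bool) (u : {poly E} -> {poly E}) (h : {poly E}) :
  distinct_primes S -> (forall q, q \in S -> ~~ (q %| u q)) -> h != 0 ->
  exists t g, [/\ g != 0, h.[t] != 0,
    forall p, irreducible_poly p -> p %| g -> (exists2 q, q \in S & p %| q) \/ p %| 'X - t%:P &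
    forall q v (K : fieldType) (w : K -> int) (iota : {rmorphism F -> K}),
      q \in S -> padic emb q v -> is_completion v w iota ->
      (forall x y : K, x != 0 -> val_ge w (w x + 1) (y - x) -> scaled x y) ->
      scaled (iota (emb (q ^+ e q * u q))) (iota (emb g))].
Proof.
move=> dS qu h0; have [irrS pwS] := dS.
pose g0 := \prod_(q <- S) q ^+ e q; pose k q := \prod_(r <- rem q S) r ^+ e r.
have g0E q : q \in S -> g0 = q ^+ e q * k q by move=> qS; rewrite /g0 (big_rem q qS).
have uS := prime_list_uniq dS.
have kq q : q \in S -> ~~ (q %| k q).
  move=> qS; apply/negP => /(irreducible_dvd_prod (irrS q qS))[r rS].
  have {}rS : r != q /\ r \in S by move: rS; rewrite mem_rem_uniq // inE => /andP[].
  case: rS => rq rS; have [irrq irrr] := (irrS q qS, irrS r rS).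
  case: (e r); last by rewrite expr0 dvdp1; case: irrq; case: eqP => // ->.
  rewrite expr1; apply/negP; rewrite -irreducible_coprime //.
  elim: (S) (pwS) qS rS => //= p S' IH /andP[/allP cop pw]; rewrite !inE.
  move=> /orP[/eqP ep|qS] /orP[/eqP er|rS].
  - by move: rq; rewrite ep er eqxx.
  - by rewrite coprimep_sym ep cop.
  - by rewrite er cop.
  exact: IH.
have [alpha halpha] := chinese_seq (fun q => u q * k q) pwS.
have na q : q \in S -> ~~ (q %| alpha).
  move=> qS; apply/negP => qa; have := dvdp_sub qa (halpha q qS).
  rewrite opprB addrC subrK => /(irreducible_dvdM (irrS q qS)).
  by rewrite (negPf (qu q qS)) (negPf (kq q qS)).
pose M := \prod_(q <- S) q; have radM : radical M := radical_prod dS.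
have copa : coprimep alpha M.
  rewrite /M; elim: (S) na (irrS) => [|q S' IH] na irr; first by rewrite big_nil coprimep1.
  rewrite big_cons coprimepMr (irreducible_coprime _ (irr q (mem_head _ _))) na ?mem_head //=.
  by apply: IH => r rS; [apply: na | apply: irr]; rewrite inE rS orbT.
have [t [z [Mt ht hz]]] := square_class_value pac two radM copa h0.
have qt q : q \in S -> ~~ (q %| t%:P - 'X).
  move=> qS; rewrite -(irreducible_coprime _ (irrS q qS)).
  by apply: coprimep_dvdl (_ : coprimep (t%:P - 'X) M); [rewrite /M (big_rem q qS) dvdp_mulr | rewrite coprimep_linear].
have tX : t%:P - 'X != 0 by rewrite -oppr_eq0 opprB polyXsubC_eq0.
exists t, (g0 * (t%:P - 'X)); split=> //.
- rewrite mulf_neq0 // /g0 prodf_seq_neq0; apply/allP => q qS /=.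
  by rewrite expf_neq0 // (irredp_neq0 (irrS q qS)).
- move=> p irr /(irreducible_dvdM irr)/orP[|pt]; last by right; rewrite -dvdpNr opprB.
  move=> /(irreducible_dvd_prod irr)[q qS pq]; left; exists q => //.
  by move: pq; case: (e q) => //; rewrite expr0 => /dvdp_trans-> //; rewrite dvd1p.
move=> q v K w iota qS hv comp close; have irr := irrS q qS.
have qz : ~~ (q %| z).
  apply: contra (qt q qS) => qz; have qM : q %| M by rewrite /M (big_rem q qS) dvdp_mulr.
  have := dvdp_trans qM hz; rewrite dvdp_subl //.
  by rewrite dvdp_mull // expr2 dvdp_mulr.
have [k0 z0] : k q != 0 /\ z != 0.
  by split; [apply: contraNneq (kq q qS) | apply: contraNneq qz] => ->; rewrite dvdp0.
have : scaled (iota (emb (u q * (k q * z) ^+ 2))) (iota (emb (k q * (t%:P - 'X)))).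
  apply: (close_mod frF irr hv comp close).
    apply/negP => /(irreducible_dvdM irr); rewrite (negPf (qu q qS)) /= expr2.
    move/(irreducible_dvdM irr); rewrite orbb => /(irreducible_dvdM irr).
    by rewrite (negPf qz) (negPf (kq q qS)).
  have qM : q %| M by rewrite /M (big_rem q qS) dvdp_mulr.
  have -> : k q * (t%:P - 'X) - u q * (k q * z) ^+ 2 =
     k q * ((t%:P - 'X - alpha * z ^+ 2) + (alpha - u q * k q) * z ^+ 2) by ring.
  by rewrite dvdp_mull // dvdp_add ?dvdp_mulr ?halpha // (dvdp_trans qM hz).
move=> [l [l0 el]]; exists (iota (emb (k q * z)) * l).
rewrite mulf_neq0 ?fmorph_eq0 ?emb0 ?mulf_neq0 //; split=> //.
rewrite (g0E q qS) -mulrA rmorphM rmorphM el [emb (_ * u q)]rmorphM.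
rewrite [emb (u q * _)]rmorphM rmorphXn !(rmorphM iota) rmorphXn; ring.
Qed.

(** At each prime dividing a coefficient choose a common value of <a1,a2> and of the
    negative of the other form; g is taken in these classes.  Elsewhere <a1,a2,-g> has unit
    coefficients, except at the zero t of g, and [legendre_at] admits one exception. *)
Lemma linking (a1 a2 b : {poly E}) (s : seq {poly E}) : a1 != 0 -> a2 != 0 -> b != 0 -> (forall a, a \in s -> a != 0) ->
  (forall v, trivial_on_constants emb v -> v (emb 'X) < 0 -> locally_isotropic v (map emb [:: a1; a2])) ->
  (forall p v, irreducible_poly p -> padic emb p v -> locally_isotropic v (map emb [:: a1, a2, b & s])) ->
  exists t g, [/\ g != 0, forall a, a \in b :: s -> a.[t] != 0,
    iso (map emb [:: a1; a2; - g]) &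
    forall p v, irreducible_poly p -> padic emb p v ->
      locally_isotropic v (map emb [:: g, b & s]) \/
      (forall a, a \in b :: s -> ~~ (p %| a)) /\ (~~ (p %| g) \/ p %| 'X - t%:P)].
Proof.
move=> a10 a20 b0 s0 loc_inf loc.
have bs0 a : a \in b :: s -> a != 0 by rewrite inE => /orP[/eqP ->|/s0].
pose A := a1 * a2 * \prod_(a <- b :: s) a.
have A0 : A != 0 by rewrite !mulf_neq0 // prodf_seq_neq0; apply/allP => a /bs0.
have dA a : a \in b :: s -> a %| A.
  by move=> aS; rewrite dvdp_mull // (big_rem a aS) dvdp_mulr.
have [S [dS divS fullS]] := prime_divisors A0.
have all0 : all (predC1 0) (map emb [:: a1, a2, b & s]).
  apply/allP => x /mapP[a]; rewrite !inE => h ->; rewrite /= emb0.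
  by case/or4P: h => [/eqP -> | /eqP -> | /eqP -> | /s0].
have /choice[cl hcl] q : exists eu : bool * {poly E}, q \in S ->
    ~~ (q %| eu.2) /\ (forall v, padic emb q v ->
      locally_isotropic v [:: emb a1; emb a2; - emb (q ^+ eu.1 * eu.2)] /\
      locally_isotropic v [:: emb (q ^+ eu.1 * eu.2), emb b & map emb s]).
  have [qS|_] := boolP (q \in S); last by exists (true, 0).
  have irr := dS.1 q qS; have [v0 hv0] := padic_exists frF irr.
  have [tv _ _] := hv0; have [two_F v2] := two_val frF tv two.
  have [K [w [iota [Hw vw dense compl]]]] := completion_exists tv.1.
  have comp : is_completion v0 w iota by split.
  have close x y : x != 0 -> val_ge w (w x + 1) (y - x) -> scaled x y.
    move=> x0 hxy; apply: (close_square Hw) => //; first by rewrite -(rmorph_nat iota) fmorph_eq0.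
    by rewrite -(rmorph_nat iota) vw.
  have := locally_isotropic_complete vw Hw two_F v2 compl all0 (loc q v0 irr hv0).
  move=> /=; move/iso_split; rewrite !fmorph_eq0 !emb0 => /(_ a10 b0)[y [y0 h1 h2]].
  have [e [u [qu hy]]] := local_class frF two irr hv0 comp close y0.
  exists (e, u) => _; split=> //= v hv.
  suff [l1 l2] : locally_isotropic v0 [:: emb a1; emb a2; - emb (q ^+ e * u)] /\
      locally_isotropic v0 [:: emb (q ^+ e * u), emb b & map emb s].
    by split; [apply: locally_isotropic_ext l1 | apply: locally_isotropic_ext l2] => x x0; apply: (padic_unique frF irr).
  split; apply: (iso_locally_isotropic vw Hw dense).
    apply: iso_scaled h1 => // -[|[|[|]]] //= _; try exact: scaled_refl.
    have [l [l0 el]] := scaled_sym hy.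
    by exists l; split=> //; rewrite rmorphN el mulNr.
  apply: iso_scaled h2; first by rewrite /= !size_map.
  by case=> [_|i _] /=; [exact: scaled_sym | exact: scaled_refl].
have [t [g [g0 At pg hg]]] := prescribe_classes (fun q => (cl q).1)
  dS (fun q qS => (hcl q qS).1) A0.
have ne a : a \in b :: s -> a.[t] != 0.
  move=> /dA /dvdpP[c ec]; apply: contraNneq At => at0.
  by rewrite ec hornerM at0 mulr0.
have ramified p v : irreducible_poly p -> padic emb p v -> p %| A ->
    locally_isotropic v (map emb [:: a1; a2; - g]) /\ locally_isotropic v (map emb [:: g, b & s]).
  move=> irr hv /(fullS p irr)[q qS pq]; have irrq := dS.1 q qS.
  have {}hv := padic_eqp irr pq hv; have [tv _ _] := hv.
  have [qu loc_q] := hcl q qS; have [l1 l2] := loc_q v hv.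
  have c0 : emb (q ^+ (cl q).1 * (cl q).2) != 0.
    rewrite emb0 mulf_neq0 ?expf_neq0 ?(irredp_neq0 irrq) //.
    by apply: contraNneq qu => ->; rewrite dvdp0.
  split.
    apply: (locally_isotropic_local frF two tv _ _ l1) => [|K w iota comp close /=].
      by rewrite /= oppr_eq0 c0 !emb0 a10 a20.
    apply: iso_scaled => // -[|[|[|]]] //= _; try exact: scaled_refl.
    have [l [l0 el]] := hg q v K w iota qS hv comp close.
    by exists l; split=> //; rewrite !rmorphN el mulNr.
  apply: (locally_isotropic_local frF two tv _ _ l2) => [|K w iota comp close /=].
    apply/allP => x; rewrite in_cons => /orP[/eqP -> //|].
    by rewrite -[_ :: _]/(map emb (b :: s)) => /mapP[a /bs0 a0 ->]; rewrite /= emb0.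
  apply: iso_scaled; first by rewrite /= !size_map.
  case=> [_|i _] /=; last exact: scaled_refl.
  exact: hg qS hv comp close.
have unramified p : irreducible_poly p -> ~~ (p %| A) -> ~~ (p %| g) \/ p %| 'X - t%:P.
  move=> irr pA; have [pdg|] := boolP (p %| g); last by left.
  have [[q qS pq]|] := pg p irr pdg; last by right.
  by case/negP: pA; apply: dvdp_trans pq (divS q qS).
exists t, g; split=> //.
  apply: (legendre_at frF two (pac_conics pac two) (t := t)); rewrite ?emb0 ?oppr_eq0 // => v tv vt.
  have [vX|[p [irr hv]]] := valuation_cases frF tv.
    have l := loc_inf v tv vX.
    apply: (locally_isotropic_morph frF two tv _ _ l); first by rewrite /= !emb0 a10 a20.
    by move=> K iota; apply: iso_subseq; rewrite /= !eqxx.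
  have [pA|pA] := boolP (p %| A); first by case: (ramified p v irr hv pA).
  have [npg|pt] := unramified p irr pA; last first.
    move: pt; rewrite -(padic_dvd frF _ irr hv) val_ge_neq0 ?emb0 ?polyXsubC_eq0 // => h.
    by have := le_trans h vt.
  apply: (unit_conic frF two pac irr hv) => //; last by rewrite dvdpNr.
    by apply: contra pA; rewrite /A -mulrA => ?; rewrite dvdp_mulr.
  by apply: contra pA; rewrite /A mulrAC => ?; rewrite dvdp_mull.
move=> p v irr hv; have [pA|pA] := boolP (p %| A); first by left; case: (ramified p v irr hv pA).
right; split; last exact: unramified.
by move=> a /dA aA; apply: contra pA => pa; apply: dvdp_trans pa aA.
Qed.

End Linking.

(** * Quaternary forms of non-constant discriminant *)

(** If <b,c> represents e then it is isometric to <e,bce>. *)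
Lemma binary_change (K : fieldType) (a b c d x y : K) :
  b * x ^+ 2 + c * y ^+ 2 != 0 ->
  iso [:: a; b; c; d] <->
  iso [:: a; b * x ^+ 2 + c * y ^+ 2; d; b * c * (b * x ^+ 2 + c * y ^+ 2)].
Proof.
set e := b * _ + _ => e0; split=> /iso4P[p [q [r [s [nz eq]]]]]; apply/iso4P.
  exists p, ((b * x * q + c * y * r) / e), s, ((x * r - y * q) / e); split.
    apply: contraT; rewrite !negb_or !negbK => /and4P[/eqP p0 h1 /eqP s0 h2].
    move: h1 h2; rewrite !mulf_eq0 invr_eq0 (negPf e0) !orbF => /eqP h1 /eqP h2.
    have q0 : q = 0.
      apply: (mulfI e0); rewrite mulr0.
      transitivity (x * (b * x * q + c * y * r) - c * y * (x * r - y * q)); first by rewrite /e; ring.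
      by rewrite h1 h2; ring.
    have r0 : r = 0.
      apply: (mulfI e0); rewrite mulr0.
      transitivity (y * (b * x * q + c * y * r) + b * x * (x * r - y * q)); first by rewrite /e; ring.
      by rewrite h1 h2; ring.
    by move: nz; rewrite p0 q0 r0 s0 eqxx.
  rewrite -[RHS]eq /e; field; exact: e0.
exists p, (x * q - c * y * s), (y * q + b * x * s), r; split; last by rewrite -[RHS]eq /e; ring.
apply: contraT; rewrite !negb_or !negbK => /and4P[/eqP p0 /eqP h1 /eqP h2 /eqP r0].
have q0 : q = 0.
  apply: (mulfI e0); rewrite mulr0.
  transitivity (b * x * (x * q - c * y * s) + c * y * (y * q + b * x * s)); first by rewrite /e; ring.
  by rewrite h1 h2; ring.
have s0 : s = 0.
  apply: (mulfI e0); rewrite mulr0.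
  transitivity (x * (y * q + b * x * s) - y * (x * q - c * y * s)); first by rewrite /e; ring.
  by rewrite h1 h2; ring.
by move: nz; rewrite p0 q0 r0 s0 eqxx.
Qed.

Lemma conic_value (K : fieldType) (a b c : K) : conics_isotropic K -> 2%:R != 0 :> K ->
  a != 0 -> b != 0 -> exists x y, a * x ^+ 2 + b * y ^+ 2 = c.
Proof.
move=> con two a0 b0; have /iso3P[x [y [z [nz e]]]] := con a b (- c).
have [z0|z0] := eqVneq z 0; last first.
  exists (x / z), (y / z); apply: (mulIf (expf_neq0 2 z0)).
  transitivity (a * x ^+ 2 + b * y ^+ 2); first by field.
  by apply/eqP; rewrite -subr_eq0 -mulNr e.
(* Now <a,b> is isotropic; the vector below comes from (u + 1)^2 - (u - 1)^2 = 4 u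
   with u = c / (4 a x^2). *)
have {}e : a * x ^+ 2 + b * y ^+ 2 = 0 by rewrite -[RHS]e z0; ring.
have x0 : x != 0.
  apply/eqP => x0; move: e nz; rewrite x0 z0 eqxx orbF /= expr0n mulr0 add0r => /eqP.
  by rewrite mulf_eq0 (negPf b0) expf_eq0 /= => /eqP ->; rewrite eqxx.
exists (x * (c / (4%:R * a * x ^+ 2) + 1)), (y * (c / (4%:R * a * x ^+ 2) - 1)).
have four : 4%:R != 0 :> K by rewrite -[4%N]/(2 * 2)%N natrM mulf_neq0.
have -> : b * (y * (c / (4%:R * a * x ^+ 2) - 1)) ^+ 2 =
  (a * x ^+ 2 + b * y ^+ 2) * (c / (4%:R * a * x ^+ 2) - 1) ^+ 2 -
   a * x ^+ 2 * (c / (4%:R * a * x ^+ 2) - 1) ^+ 2 by ring.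
by rewrite e; field; rewrite four a0 x0.
Qed.

Section Quaternary.
Variables (E F : fieldType) (emb : {rmorphism {poly E} -> F}).
Hypotheses (frF : fraction_field emb) (two : 2%:R != 0 :> E).
Hypothesis pac : pseudo_algebraically_closed E.
Let emb0 g : (emb g == 0) = (g == 0) := emb_eq0 frF g.

(** Link <a1,a2> with <a3,a4>: then [legendre_at] also applies to <g,a3,a4>. *)
Lemma quaternary_hyperbolic_at_infinity (a1 a2 a3 a4 : {poly E}) :
  a1 != 0 -> a2 != 0 -> a3 != 0 -> a4 != 0 ->
  (forall v, trivial_on_constants emb v -> v (emb 'X) < 0 ->
     locally_isotropic v (map emb [:: a1; a2]) /\ locally_isotropic v (map emb [:: a3; a4])) ->
  (forall v, trivial_on_constants emb v -> locally_isotropic v (map emb [:: a1; a2; a3; a4])) ->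
  iso (map emb [:: a1; a2; a3; a4]).
Proof.
move=> a10 a20 a30 a40 inf loc.
have [|||t [g [g0 _ iso1 hg]]] := @linking _ _ _ frF two pac a1 a2 a3 [:: a4] a10 a20 a30.
- by move=> a; rewrite inE => /eqP ->.
- by move=> v tv vX; case: (inf v tv vX).
- by move=> p v irr [tv _ _]; apply: loc.
apply: (@iso_join _ _ _ (emb g)); rewrite ?emb0 //; first by move: iso1; rewrite /= rmorphN.
apply: (legendre_at frF two (pac_conics pac two) (t := t)); rewrite ?emb0 // => v tv vt.
have [vX|[p [irr hv]]] := valuation_cases frF tv.
  have [_ l] := inf v tv vX; apply: (locally_isotropic_morph frF two tv _ _ l).
    by rewrite /= !emb0 a30 a40.
  by move=> K iota; apply: iso_cons.
have [//|[nd [npg|pt]]] := hg p v irr hv.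
  by apply: (unit_conic frF two pac irr hv) => //; apply: nd; rewrite !inE eqxx ?orbT.
move: pt; rewrite -(padic_dvd frF _ irr hv) val_ge_neq0 ?emb0 ?polyXsubC_eq0 // => h.
by have := le_trans h vt.
Qed.

(** The substitution X -> t + 1/X, followed by a choice of polynomials in the
    square classes, moves the point t to infinity. *)
Lemma move_to_infinity t : exists G : {poly E} -> {poly E},
  [/\ forall a, a != 0 -> G a != 0,
      forall l, (forall a, a \in l -> a != 0) -> iso (map emb (map G l)) -> iso (map emb l),
      forall l v, trivial_on_constants emb v -> v (emb 'X) < 0 ->
        (forall a, a \in l -> a.[t] != 0) -> iso [seq a.[t] | a <- l] ->
        locally_isotropic v (map emb (map G l)) &
      forall l, (forall a, a \in l -> a != 0) ->
        (forall v, trivial_on_constants emb v -> locally_isotropic v (map emb l)) ->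
        forall v, trivial_on_constants emb v -> locally_isotropic v (map emb (map G l))].
Proof.
have [s [r [sX rX [sc rc] sr rs]]] := moebius frF t.
have /choice[G hG] a : exists g, a != 0 -> g != 0 /\ scaled (emb g) (s (emb a)).
  have [_|a0] := eqVneq a 0; first by exists 0.
  have [|g [sg hg]] := @square_free_class _ _ _ frF (s (emb a)); first by rewrite fmorph_eq0 emb0.
  by exists g => _; rewrite (square_free_neq0 sg).
have back l v : trivial_on_constants emb v -> (forall a, a \in l -> a != 0) ->
    locally_isotropic (v \o s) (map emb l) -> locally_isotropic v (map emb (map G l)).
  move=> tv l0 /locally_isotropic_comp; apply: (locally_isotropic_scaled frF two tv).
  - by rewrite -map_comp; apply/allP => x /mapP[a /l0 a0 ->]; rewrite /= fmorph_eq0 emb0.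
  - by rewrite !size_map.
  move=> i; rewrite !size_map => hi; rewrite !(nth_map 0) ?size_map //.
  by apply/scaled_sym; apply: (hG _ _).2; apply/l0/mem_nth.
exists G; split.
- by move=> a /hG[].
- move=> l l0 hl; have -> : map emb l = map r (map s (map emb l)).
    by rewrite -map_comp; symmetry; rewrite -[RHS]map_id; apply: eq_map => x /=; rewrite sr.
  apply: iso_morph; apply: iso_scaled hl; first by rewrite !size_map.
  move=> i; rewrite !size_map => hi; rewrite !(nth_map 0) ?size_map //.
  by apply: (hG _ _).2; apply/l0/mem_nth.
- move=> l v tv vX lt hl.
  have tvs := omega_comp tv sc rs.
  apply: back => //; first by move=> a /lt; apply: contraNneq => ->; rewrite horner0.
  apply: (locally_isotropic_specialize frF two tvs _ lt hl).
  rewrite /= rmorphB rmorphB sX sc addrAC subrr add0r (valV tv.1) ?emb0 ?polyX_eq0 //.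
  by rewrite oppr_gt0.
by move=> l l0 loc v tv; apply: back => //; apply/loc/(omega_comp tv sc rs).
Qed.

(** At a point t where the discriminant is a nonzero square, write the form as
    <b1,e,b4,b2 b3 e> with e(t) = -b1(t).  Both <b1,e> and <b4,b2 b3 e> are hyperbolic at t,
    which is then moved to infinity. *)
Lemma quaternary_nonconstant (b1 b2 b3 b4 m c : {poly E}) :
  b1 != 0 -> b2 != 0 -> b3 != 0 -> b4 != 0 ->
  b1 * b2 * b3 * b4 = m * c ^+ 2 -> square_free m -> (1 < size m)%N ->
  (forall v, trivial_on_constants emb v -> locally_isotropic v (map emb [:: b1; b2; b3; b4])) ->
  iso (map emb [:: b1; b2; b3; b4]).
Proof.
move=> b10 b20 b30 b40 eD sm s1 loc.
have h0 : b1 * b2 * b3 * b4 != 0 by rewrite !mulf_neq0.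
have [t [y [ht my]]] := square_value pac two sm s1 h0.
have eDt : b1.[t] * b2.[t] * b3.[t] * b4.[t] = (y * c.[t]) ^+ 2.
  by rewrite -!hornerM eD hornerM horner_exp my exprMn.
move: ht; rewrite !hornerM !mulf_eq0 !negb_or => /andP[/andP[/andP[t1 t2] t3] t4].
have [x1 [x2 ex]] := conic_value (- b1.[t]) (pac_conics pac two) two t2 t3.
pose e := b2 * x1%:P ^+ 2 + b3 * x2%:P ^+ 2; pose f := b2 * b3 * e.
have et : e.[t] = - b1.[t] by rewrite -ex /e -!rmorphXn /= hornerD !hornerM !hornerC.
have ft : f.[t] = - (b1.[t] * b2.[t] * b3.[t]) by rewrite /f !hornerM et; ring.
have e0 : e != 0 by apply: contraNneq t1 => e0; rewrite -oppr_eq0 -et e0 horner0.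
have f0 : f != 0 by rewrite !mulf_neq0.
have change (K : fieldType) (j : {rmorphism {poly E} -> K}) : j e != 0 ->
    iso (map j [:: b1; b2; b3; b4]) <-> iso (map j [:: b1; e; b4; f]).
  move=> je; rewrite /= /f !(rmorphM j) /e !(rmorphD, rmorphM, rmorphXn) /=.
  by apply: binary_change; move: je; rewrite /e !(rmorphD, rmorphM, rmorphXn).
apply/change; first by rewrite emb0.
have [G [G0 Giso Ginf Gloc]] := move_to_infinity t.
have l0 a : a \in [:: b1; e; b4; f] -> a != 0.
  by rewrite !inE => /or4P[] /eqP ->.
apply: (Giso _ l0); apply: quaternary_hyperbolic_at_infinity; rewrite ?G0 //.
  move=> v tv vX; split; [apply: (Ginf [:: b1; e]) | apply: (Ginf [:: b4; f])] => //.
  - by move=> a; rewrite !inE => /orP[] /eqP -> //; rewrite et oppr_eq0.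
  - by rewrite /= et; apply/iso2P; exists 1, 1; rewrite oner_neq0; split=> //; ring.
  - by move=> a; rewrite !inE => /orP[] /eqP -> //; rewrite ft oppr_eq0 !mulf_neq0.
  rewrite /= ft; apply/iso2P; exists (y * c.[t]), b4.[t]; rewrite t4 orbT; split=> //.
  by rewrite -eDt; ring.
apply: (Gloc _ l0) => v tv; apply: (locally_isotropic_morph frF two tv _ _ (loc v tv)).
  by rewrite /= !emb0 b10 b20 b30 b40.
move=> K iota; rewrite -!(map_comp iota emb) => h.
by apply/(change K (iota \o emb)); rewrite //= fmorph_eq0 emb0.
Qed.

End Quaternary.

(** * Quaternary forms of constant discriminant *)

Section QuadraticExtension.
Variables (F K : fieldType) (j : {rmorphism F -> K}) (u : F) (r : K).
Hypotheses (er : r ^+ 2 = j u) (ns : nonsquare u).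

Definition spanned (z : K) := exists x y, z = j x + j y * r.

Lemma spannedM z z' : spanned z -> spanned z' -> spanned (z * z').
Proof.
move=> [x [y ->]] [x' [y' ->]]; exists (x * x' + y * y' * u), (x * y' + y * x').
by rewrite !(rmorphD, rmorphM) -er; ring.
Qed.

Lemma spannedV z : spanned z -> spanned z^-1.
Proof.
move=> [x [y ->]]; have [n0|n0] := eqVneq (x ^+ 2 - u * y ^+ 2) 0.
  have y0 : y = 0.
    apply/eqP; apply: contraT => y0; case: (ns (x := x / y)).
    have e : x ^+ 2 = u * y ^+ 2 by apply/eqP; rewrite -subr_eq0 n0.
    by rewrite exprMn e exprVn mulfK ?expf_neq0.
  move/eqP: n0; rewrite y0 expr0n mulr0 subr0 expf_eq0 /= => /eqP ->.
  by exists 0, 0; rewrite rmorph0 mul0r addr0 invr0.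
have jn : j x ^+ 2 - j u * j y ^+ 2 != 0.
  by rewrite -!rmorphXn -rmorphM -rmorphB fmorph_eq0.
exists (x / (x ^+ 2 - u * y ^+ 2)), (- y / (x ^+ 2 - u * y ^+ 2)).
rewrite !fmorph_div rmorphN !(rmorphB, rmorphXn, rmorphM) /=.
have e : (j x + j y * r) * (j x - j y * r) = j x ^+ 2 - j u * j y ^+ 2 by rewrite -er; ring.
have z0 : j x + j y * r != 0 by apply: contraNneq jn => z0; rewrite -e z0 mul0r.
apply: (mulfI z0); rewrite mulfV //.
transitivity ((j x + j y * r) * (j x - j y * r) / (j x ^+ 2 - j u * j y ^+ 2)).
  by rewrite e mulfV.
by rewrite mulNr; ring.
Qed.

End QuadraticExtension.

Section ConstantDiscriminant.
Variables (E F : fieldType) (emb : {rmorphism {poly E} -> F}).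
Hypotheses (frF : fraction_field emb) (two : 2%:R != 0 :> E).
Hypothesis pac : pseudo_algebraically_closed E.
Let emb0 g : (emb g == 0) = (g == 0) := emb_eq0 frF g.

Lemma conics_isotropic_quadratic (K : fieldType) (j : {rmorphism E -> K}) (r : K) u :
  nonsquare u -> r ^+ 2 = j u -> (forall z, spanned j r z) -> conics_isotropic K.
Proof.
move=> ns er sp; have su : size ('X^2 - u%:P : {poly E}) = 3 by rewrite size_XnsubC.
apply: (@conics_isotropic_extension _ pac two ('X^2 - u%:P) _ j r).
- apply: cubic_irreducible; first by rewrite su.
  by move=> x; apply/negP=> /rootP; rewrite !hornerE => /eqP; rewrite subr_eq0 => /eqP; apply: ns.
- by rewrite rmorphB /= map_polyXn map_polyC /root !hornerE er subrr.
move=> z; have [x [y ->]] := sp z; exists (x%:P + y *: 'X).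
by rewrite rmorphD /= map_polyZ map_polyX map_polyC !hornerE addrC.
Qed.

Lemma nonsquare_constant u : nonsquare u -> nonsquare (emb u%:P).
Proof.
move=> ns x; have [a [b [b0 ->]]] := frF.2 x; move=> e.
have {}e : a ^+ 2 = u%:P * b ^+ 2.
  apply: frF.1; rewrite rmorphXn rmorphM rmorphXn -e exprMn exprVn -mulrA mulVf ?mulr1 //.
  by rewrite expf_neq0 // emb0.
have lb0 : lead_coef b != 0 by rewrite lead_coef_eq0.
case: (ns (lead_coef a / lead_coef b)); rewrite exprMn exprVn.
have := congr1 lead_coef e; rewrite !expr2 !lead_coefM lead_coefC => ->.
by rewrite -expr2 mulfK // mulf_neq0.
Qed.

Section Extension.
Variables (u : E) (E' : fieldType) (j : {rmorphism E -> E'}) (r : E').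
Hypotheses (ns : nonsquare u) (er : r ^+ 2 = j u) (sp : forall z, spanned j r z).
Variables (F' : fieldType) (emb' : {rmorphism {poly E'} -> F'}) (frF' : fraction_field emb').
Variable iota : {rmorphism F -> F'}.
Hypothesis iotaE : forall g, iota (emb g) = emb' (map_poly j g).

Lemma split_poly (g : {poly E'}) : exists a b : {poly E},
  [/\ g = map_poly j a + map_poly j b * r%:P, (size a <= size g)%N & (size b <= size g)%N].
Proof.
have /choice[x /choice[y hxy]] := sp.
exists (\poly_(i < size g) x g`_i), (\poly_(i < size g) y g`_i); split; try exact: size_poly.
apply/polyP => i; rewrite coefD coefMC !coef_map !coef_poly.
case: ltnP => hi; first by rewrite -hxy.
have z : 0 = j 0 + j 0 * r by rewrite rmorph0 mul0r addr0.
by rewrite nth_default //; exact: z.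
Qed.

Lemma spanned_fraction z : spanned iota (emb' r%:P) z.
Proof.
have er' : emb' r%:P ^+ 2 = iota (emb u%:P).
  by rewrite iotaE map_polyC /= -er -!rmorphXn.
have sp' g : spanned iota (emb' r%:P) (emb' g).
  have [a [b [-> _ _]]] := split_poly g; exists (emb a), (emb b).
  by rewrite rmorphD rmorphM !iotaE.
have [a [b [_ ->]]] := frF'.2 z.
apply: (spannedM er') => //; apply: (spannedV er') => //.
exact: nonsquare_constant.
Qed.

(** The restriction still takes the value 1: write p = a + b sqrt u.  If p does not divide
    its conjugate, use the norm a^2 - u b^2 of p; otherwise p divides a and b, so it is one of
    them up to a constant. *)
Lemma restrict_valuation p v : irreducible_poly p -> padic emb' p v ->
  trivial_on_constants emb (v \o iota).
Proof.
move=> irr hv; have [tv nd vp] := hv; have p0 := irredp_neq0 irr.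
split; last first.
  by move=> c c0 /=; rewrite iotaE map_polyC tv.2 // fmorph_eq0.
apply: Z_valuation_comp; first exact: tv.1.
have [a [b [ep sa sb]]] := split_poly p.
pose q := map_poly j a - map_poly j b * r%:P.
have [pq|pq] := boolP (p %| q); last first.
  exists (emb (a ^+ 2 - u%:P * b ^+ 2)).
    rewrite emb0; apply: contraNneq pq => z; rewrite (_ : q = 0) ?dvdp0 //.
    apply: (mulfI p0); rewrite mulr0.
    transitivity (map_poly j (a ^+ 2 - u%:P * b ^+ 2)); last by rewrite z rmorph0.
    rewrite {1}ep /q rmorphB rmorphXn rmorphM rmorphXn /= map_polyC /= -er rmorphXn /=; ring.
  rewrite iotaE; transitivity (v (emb' (p * q))).
    congr (v (emb' _)); rewrite {1}ep /q rmorphB rmorphXn rmorphM rmorphXn /= map_polyC /= -er rmorphXn /=; ring.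
  rewrite rmorphM (valM tv.1) ?(emb_eq0 frF') // ?vp ?nd ?addr0 //.
  by apply: contraNneq pq => ->; rewrite dvdp0.
have two' : (2%:R : E') != 0 by rewrite -(rmorph_nat j) fmorph_eq0.
have pa : p %| map_poly j a.
  rewrite -(@dvdpZr _ 2%:R) //.
  have -> : 2%:R *: map_poly j a = p + q by rewrite {1}ep /q scaler_nat mulr2n; ring.
  by rewrite dvdp_add.
have pb : p %| map_poly j b.
  have r0 : r != 0.
    by apply: contra_notN (ns (x := 0)) => /eqP r0; move/eqP: er; rewrite r0 !expr0n /= eq_sym fmorph_eq0 => /eqP.
  rewrite -(@dvdpZr _ r) // -mul_polyC mulrC.
  have -> : map_poly j b * r%:P = p - map_poly j a by rewrite {1}ep; ring.
  by rewrite dvdp_sub.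
have [c [c0 sc pc]] : exists c : {poly E}, [/\ c != 0, (size c <= size p)%N & p %| map_poly j c].
  have [a0|a0] := eqVneq a 0; last by exists a.
  exists b; split=> //; apply: contraNneq p0 => b0.
  by rewrite ep a0 b0 !rmorph0 mul0r addr0.
exists (emb c); rewrite ?emb0 // iotaE.
have c0' : map_poly j c != 0 by rewrite map_poly_eq0.
have eqpc : p %= map_poly j c.
  by rewrite -(dvdp_size_eqp pc) eqn_leq (dvdp_leq c0' pc) size_map_poly sc.
by have [_ _] := padic_eqp frF' irr eqpc hv.
Qed.

(** Over E(sqrt u) the discriminant is a square, so <a1,a2,a3> is locally isotropic, hence
    isotropic by Legendre's theorem; [quadratic_descent] brings this back to E. *)
Lemma quaternary_descent (a1 a2 a3 a4 : F) c :
  conics_isotropic E' ->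
  a1 != 0 -> a2 != 0 -> a3 != 0 -> a4 != 0 -> c != 0 ->
  a1 * a2 * a3 * a4 = emb u%:P * c ^+ 2 ->
  (forall v, trivial_on_constants emb v -> locally_isotropic v [:: a1; a2; a3; a4]) ->
  iso [:: a1; a2; a3; a4].
Proof.
move=> con' a10 a20 a30 a40 c0 eD loc.
have two' : (2%:R : E') != 0 by rewrite -(rmorph_nat j) fmorph_eq0.
pose s := emb' r%:P * iota c.
have es : s ^+ 2 = iota (a1 * a2 * a3 * a4).
  by rewrite eD exprMn rmorphM rmorphXn iotaE map_polyC /= -er -!rmorphXn.
have nsD : nonsquare (a1 * a2 * a3 * a4).
  move=> x e; case: (nonsquare_constant ns (x := x / c)).
  by rewrite exprMn e eD exprVn mulfK ?expf_neq0.
apply: (quadratic_descent (j := iota) (r := s)) => //; first exact: two_frac frF two.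
  move=> z; have [x [y ->]] := spanned_fraction z; exists x, (y / c).
  by rewrite fmorph_div /s [_ * iota c]mulrC mulrA divfK // fmorph_eq0.
apply: (legendre frF' two' con'); rewrite ?fmorph_eq0 // => p v irr hv.
have [tv _ _] := hv; have := locally_isotropic_comp (loc _ (restrict_valuation irr hv)).
apply: (locally_isotropic_morph frF' two' tv); first by rewrite /= !fmorph_eq0 a10 a20 a30 a40.
move=> K i /=; apply: (@disc_square_subform _ _ _ _ _ (i s)); rewrite ?fmorph_eq0 //.
by rewrite -!rmorphM -es rmorphXn.
Qed.

End Extension.

Lemma quaternary_constant (a1 a2 a3 a4 : F) u c :
  a1 != 0 -> a2 != 0 -> a3 != 0 -> a4 != 0 -> c != 0 ->
  a1 * a2 * a3 * a4 = emb u%:P * c ^+ 2 ->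
  (forall v, trivial_on_constants emb v -> locally_isotropic v [:: a1; a2; a3; a4]) ->
  iso [:: a1; a2; a3; a4].
Proof.
move=> a10 a20 a30 a40 c0 eD loc.
have [ns|/existsNP[s /contrapT es]] := pselect (nonsquare u); last first.
  apply: (@iso_subseq _ [:: a1; a2; a3]); first by rewrite /= !eqxx.
  apply: (legendre frF two (pac_conics pac two)) => // p v irr [tv _ _].
  apply: (locally_isotropic_morph frF two tv _ _ (loc v tv)); first by rewrite /= a10 a20 a30 a40.
  move=> K i /=; apply: (@disc_square_subform _ _ _ _ _ (i (emb s%:P * c))); rewrite ?fmorph_eq0 //.
  by rewrite -!rmorphM -rmorphXn eD exprMn -es !rmorphXn.
have [E' [j [r [er sp]]]] := adjoin_sqrt ns.
have [F' [emb' frF']] : exists (F' : fieldType) (emb' : {rmorphism {poly E'} -> F'}),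
    fraction_field emb'.
  by exists {fraction {poly E'}}, (@tofrac {poly E'}); exact: tofrac_fraction_field.
have inj : injective (emb' \o map_poly j).
  by apply: inj_comp frF'.1 _ => a b /=; apply: map_poly_inj.
have [iota hi] := fraction_field_lift frF inj.
apply: (quaternary_descent ns er sp frF' hi) eD loc => //.
exact: conics_isotropic_quadratic ns er sp.
Qed.

Theorem quaternary_local_global (a1 a2 a3 a4 : F) :
  a1 != 0 -> a2 != 0 -> a3 != 0 -> a4 != 0 ->
  (forall v, trivial_on_constants emb v -> locally_isotropic v [:: a1; a2; a3; a4]) ->
  iso [:: a1; a2; a3; a4].
Proof.
move=> a10 a20 a30 a40 loc.
have cls x : x != 0 -> exists f, f != 0 /\ scaled (emb f) x.
  by move=> /(square_free_class frF)[f [/square_free_neq0 f0 hf]]; exists f.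
have [b1 [b10 h1]] := cls _ a10; have [b2 [b20 h2]] := cls _ a20.
have [b3 [b30 h3]] := cls _ a30; have [b4 [b40 h4]] := cls _ a40.
have h i : (i < 4)%N -> scaled (map emb [:: b1; b2; b3; b4])`_i [:: a1; a2; a3; a4]`_i.
  by case: i => [|[|[|[|]]]].
apply: (@iso_scaled _ (map emb [:: b1; b2; b3; b4]) [:: a1; a2; a3; a4] erefl h).
have {}loc v : trivial_on_constants emb v -> locally_isotropic v (map emb [:: b1; b2; b3; b4]).
  move=> tv; apply: (locally_isotropic_scaled frF two tv _ _ _ (loc v tv)) => //.
    by rewrite /= a10 a20 a30 a40.
  by move=> i hi; apply/scaled_sym/h.
have D0 : b1 * b2 * b3 * b4 != 0 by rewrite !mulf_neq0.
have [m [c [eD sm c0]]] := square_free_part D0.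
have [s1|s1] := ltnP 1 (size m).
  exact: (quaternary_nonconstant frF two pac b10 b20 b30 b40 eD sm s1).
rewrite (size1_polyC s1) in eD.
apply: (@quaternary_constant _ _ _ _ m`_0 (emb c)); rewrite ?emb0 //.
by rewrite -!rmorphM eD rmorphM rmorphXn.
Qed.

End ConstantDiscriminant.

(** * Quinary forms *)

Section Quinary.
Variables (E F : fieldType) (emb : {rmorphism {poly E} -> F}).
Hypotheses (frF : fraction_field emb) (two : 2%:R != 0 :> E).
Hypothesis pac : pseudo_algebraically_closed E.
Let emb0 g : (emb g == 0) = (g == 0) := emb_eq0 frF g.

(** Link <a1,a2> with <a3,a4,a5>.  Then <g,a3,a4,a5> is isotropic by the local-global principle
    in dimension four: at the primes controlled by g its local isotropy was arranged, and
    elsewhere <a3,a4,a5> is a conic with unit coefficients. *)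
Lemma quinary_hyperbolic_at_infinity (a1 a2 a3 a4 a5 : {poly E}) :
  a1 != 0 -> a2 != 0 -> a3 != 0 -> a4 != 0 -> a5 != 0 ->
  (forall v, trivial_on_constants emb v -> v (emb 'X) < 0 ->
     locally_isotropic v (map emb [:: a1; a2]) /\ locally_isotropic v (map emb [:: a3; a4; a5])) ->
  iso (map emb [:: a1; a2; a3; a4; a5]).
Proof.
move=> a10 a20 a30 a40 a50 inf.
have [|||t [g [g0 _ iso1 hg]]] := @linking _ _ _ frF two pac a1 a2 a3 [:: a4; a5] a10 a20 a30.
- by move=> a; rewrite !inE => /orP[] /eqP ->.
- by move=> v tv vX; case: (inf v tv vX).
- move=> p v irr hv; apply: (local_quinary frF two pac irr hv) => //.
  by rewrite /= !emb0 a10 a20 a30 a40 a50.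
apply: (@iso_join _ _ _ (emb g)); rewrite ?emb0 //; first by move: iso1; rewrite /= rmorphN.
apply: (quaternary_local_global frF two pac); rewrite ?emb0 // => v tv.
have sub l : locally_isotropic v l -> all (predC1 0) l -> locally_isotropic v (emb g :: l).
  by move=> hl l0; apply: (locally_isotropic_morph frF two tv l0 _ hl) => K iota; apply: iso_cons.
have [vX|[p [irr hv]]] := valuation_cases frF tv.
  by apply: sub (inf v tv vX).2 _; rewrite /= !emb0 a30 a40 a50.
have [//|[nd _]] := hg p v irr hv.
apply: (sub (map emb [:: a3; a4; a5])); last by rewrite /= !emb0 a30 a40 a50.
by apply: (unit_conic frF two pac irr hv); apply: nd; rewrite !inE eqxx ?orbT.
Qed.

Lemma quinary_nonconstant (b1 b2 b3 b4 b5 m c : {poly E}) :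
  b1 != 0 -> b2 != 0 -> b3 != 0 -> b4 != 0 -> b5 != 0 ->
  - (b1 * b2) = m * c ^+ 2 -> square_free m -> (1 < size m)%N ->
  iso (map emb [:: b1; b2; b3; b4; b5]).
Proof.
move=> b10 b20 b30 b40 b50 eD sm s1.
have h0 : b1 * b2 * b3 * b4 * b5 != 0 by rewrite !mulf_neq0.
have [t [y [ht my]]] := square_value pac two sm s1 h0.
have eDt : - (b1.[t] * b2.[t]) = (y * c.[t]) ^+ 2.
  by rewrite -hornerM -hornerN eD hornerM horner_exp my exprMn.
move: ht; rewrite !hornerM !mulf_eq0 !negb_or => /andP[/andP[/andP[/andP[t1 t2] t3] t4] t5].
have [G [G0 Giso Ginf Gloc]] := move_to_infinity frF two t.
have l0 a : a \in [:: b1; b2; b3; b4; b5] -> a != 0.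
  by rewrite !inE => /or4P[| | |/orP[]] /eqP ->.
apply: (Giso _ l0); apply: quinary_hyperbolic_at_infinity; rewrite ?G0 //.
move=> v tv vX; split; [apply: (Ginf [:: b1; b2]) | apply: (Ginf [:: b3; b4; b5])] => //.
- by move=> a; rewrite !inE => /orP[] /eqP ->.
- apply/iso2P; exists (y * c.[t]), b1.[t]; rewrite t1 orbT; split=> //.
  by rewrite -eDt; ring.
- by move=> a; rewrite !inE => /or3P[] /eqP ->.
exact: pac_conics.
Qed.

(** If -a1 a2 and -a1 a3 are both constant up to squares, then <a1,a2,a3> is a multiple of a
    conic over E; otherwise one of them takes a nonzero square value at a rational point. *)
Theorem quinary_isotropic (a1 a2 a3 a4 a5 : F) :
  a1 != 0 -> a2 != 0 -> a3 != 0 -> a4 != 0 -> a5 != 0 -> iso [:: a1; a2; a3; a4; a5].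
Proof.
move=> a10 a20 a30 a40 a50.
have cls x : x != 0 -> exists f, f != 0 /\ scaled (emb f) x.
  by move=> /(square_free_class frF)[f [/square_free_neq0 f0 hf]]; exists f.
have [b1 [b10 h1]] := cls _ a10; have [b2 [b20 h2]] := cls _ a20.
have [b3 [b30 h3]] := cls _ a30; have [b4 [b40 h4]] := cls _ a40.
have [b5 [b50 h5]] := cls _ a50.
have h i : (i < 5)%N -> scaled (map emb [:: b1; b2; b3; b4; b5])`_i [:: a1; a2; a3; a4; a5]`_i.
  by case: i => [|[|[|[|[|]]]]].
apply: (@iso_scaled _ (map emb [:: b1; b2; b3; b4; b5]) [:: a1; a2; a3; a4; a5] erefl h).
have [|m [c [em sm c0]]] := @square_free_part _ (- (b1 * b2)).
  by rewrite oppr_eq0 mulf_neq0.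
have [|m' [c' [em' sm' c'0]]] := @square_free_part _ (- (b1 * b3)).
  by rewrite oppr_eq0 mulf_neq0.
have [s1|s1] := ltnP 1 (size m).
  exact: (quinary_nonconstant b10 b20 b30 b40 b50 em sm s1).
have [s2|s2] := ltnP 1 (size m').
  have := quinary_nonconstant b10 b30 b20 b40 b50 em' sm' s2.
  move=> [x [[i [hi xi]] e]].
  pose sw k := if k == 1%N then 2%N else if k == 2%N then 1%N else k.
  exists (x \o sw); split.
    by exists (sw i); split; [case: i hi {xi} => [|[|[|[|[|]]]]] | case: i hi xi => [|[|[|[|[|]]]]]].
  by rewrite -[RHS]e !big_ord_recl !big_ord0 /=; ring.
apply: (@iso_subseq _ (map emb [:: b1; b2; b3])); first by rewrite /= !eqxx.
apply/iso_normalize; first by rewrite emb0.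
have := iso_morph (emb \o polyC) (pac_conics pac two 1 (- m`_0) (- m'`_0)).
rewrite (size1_polyC s1) in em; rewrite (size1_polyC s2) in em'.
apply: iso_scaled => // -[|[|[|]]] //= _.
- by rewrite rmorph1; exact: scaled_refl.
- exists (emb c); rewrite emb0; split=> //; move: (congr1 emb em).
  rewrite rmorphN [emb (_ * c ^+ 2)]rmorphM rmorphXn rmorphM polyCN rmorphN mulNr => <-.
  by rewrite opprK.
exists (emb c'); rewrite emb0; split=> //; move: (congr1 emb em').
rewrite rmorphN [emb (_ * c' ^+ 2)]rmorphM rmorphXn rmorphM polyCN rmorphN mulNr => <-.
by rewrite opprK.
Qed.

End Quinary.

(** * Diagonalisation *)

Section Diagonal.
Variable F : fieldType.
Hypothesis two : 2%:R != 0 :> F.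

Lemma nonzero_value n (A : 'M[F]_n.+1) : A^T = A -> A \in unitmx ->
  exists x : 'rV_n.+1, x *m A *m x^T != 0.
Proof.
move=> sA uA; apply: contrapT => h.
have q0 (x : 'rV_n.+1) : x *m A *m x^T = 0.
  by apply/eqP; apply: contraT => x0; case: h; exists x.
have b0 (x y : 'rV_n.+1) : x *m A *m y^T = 0.
  have : x *m A *m y^T + y *m A *m x^T = 0.
    have := q0 (x + y); rewrite linearD /= !mulmxDl !mulmxDr !q0 add0r addr0.
    by rewrite addrC.
  have tr11 (z : 'M[F]_1) : z^T = z by rewrite [z]mx11_scalar tr_scalar_mx.
  have -> : y *m A *m x^T = x *m A *m y^T.
    by rewrite -[LHS]tr11 !trmx_mul trmxK sA mulmxA.
  move/matrixP => e; apply/matrixP => i k; move: (e i k); rewrite !mxE -mulr2n => /eqP.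
  by rewrite -mulr_natr mulf_eq0 (negPf two) orbF => /eqP.
have A0 : A = 0.
  apply/matrixP => i k; have := b0 (delta_mx 0 i) (delta_mx 0 k).
  by rewrite trmx_delta -rowE -colE => /matrixP/(_ 0 0); rewrite !mxE.
by move: uA; rewrite A0 unitmxE det0 unitr0.
Qed.

Lemma first_vector n (x : 'rV[F]_n.+1) : x != 0 -> exists (P : 'M_n.+1) c,
  [/\ P \in unitmx, c != 0 & x = c *: row 0 P].
Proof.
move=> x0; exists (row_ebase x), (col_ebase x 0 0).
have rx : \rank x = 1%N by apply/eqP; rewrite rank_rV x0.
have e : x = col_ebase x 0 0 *: row 0 (row_ebase x).
  rewrite -[LHS](mulmx_ebase x) rx [col_ebase x]mx11_scalar mul_scalar_mx -scalemxAl mxE eqxx mulr1n.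
  congr (_ *: _); rewrite rowE; congr (_ *m _).
  by apply/matrixP => i k; rewrite !mxE ord1 /= eq_sym andbT.
split=> //; first exact: row_ebase_unit.
by apply: contraNneq x0 => c0; rewrite e c0 scale0r.
Qed.

(** One vector with nonzero value is completed to a basis, and its orthogonal complement has
    the Schur complement C as Gram matrix. *)
Lemma diagonalize n (A : 'M[F]_n) : A^T = A -> A \in unitmx ->
  exists (P : 'M_n) (d : 'rV_n), P \in unitmx /\ P *m A *m P^T = diag_mx d.
Proof.
elim: n A => [|n IH] A sA uA.
  by exists 1%:M, 0; rewrite unitmx1; split=> //; apply/matrixP => -[].
have [x qx] := nonzero_value sA uA.
have x0 : x != 0 by apply: contraNneq qx => ->; rewrite !mul0mx.
have [P [c [uP c0 ex]]] := first_vector x0.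
have [B defB] : exists B : 'M_(1 + n), B = P *m A *m P^T by exists (P *m A *m P^T).
have sB : B^T = B by rewrite defB !trmx_mul trmxK sA mulmxA.
have uB : B \in unitmx by rewrite defB !unitmx_mul unitmx_tr uP uA.
have b0 : B 0 0 != 0.
  apply: contraNneq qx => b0; rewrite ex linearZ /= -scalemxAr -!scalemxAl.
  have -> : row 0 P *m A *m (row 0 P)^T = (B 0 0)%:M.
    rewrite [LHS]mx11_scalar; congr (_%:M); rewrite defB mxE [RHS]mxE.
    apply: eq_bigr => k _; rewrite !mxE; congr (_ * _).
    by apply: eq_bigr => i _; rewrite !mxE.
  by rewrite b0 -scalemx1 scale0r !scaler0.
set b := B 0 0 in b0.
pose l := dlsubmx B; pose D := drsubmx B.
have eB : B = block_mx b%:M l^T l D.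
  rewrite -[LHS]submxK; congr (block_mx _ _ _ _).
    rewrite [ulsubmx B]mx11_scalar; congr (_%:M); rewrite [LHS]mxE [LHS]mxE.
    by apply: (f_equal2 (fun i k => B i k)); apply: val_inj.
  by rewrite /l -[ursubmx B]trmxK trmx_ursub sB.
pose L : 'M_(1 + n) := block_mx 1%:M 0 (- b^-1 *: l) 1%:M.
pose C := D - b^-1 *: (l *m l^T).
have eL : L *m B *m L^T = block_mx b%:M 0 0 C.
  rewrite eB /L tr_block_mx !mulmx_block !trmx0 !trmx1 !mul1mx !mul0mx !mulmx1 !mulmx0 !addr0.
  have e1 : - b^-1 *: l *m b%:M + l = 0.
    by rewrite mul_mx_scalar scalerA mulrN mulfV // scaleN1r addNr.
  have e2 : b%:M *m (- b^-1 *: l)^T + l^T = 0.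
    by rewrite mul_scalar_mx linearZ /= scalerA mulrN mulfV // scaleN1r addNr.
  by rewrite e1 e2 mul0mx add0r -scalemxAl scaleNr addrC.
have uL : L \in unitmx by rewrite unitmxE det_lblock !det1 mulr1 unitr1.
have uC : C \in unitmx.
  have : L *m B *m L^T \in unitmx by rewrite !unitmx_mul unitmx_tr uL uB.
  by rewrite eL !unitmxE det_ublock unitrM => /andP[].
have sC : C^T = C.
  have := congr1 trmx eL; rewrite !trmx_mul trmxK sB mulmxA eL tr_block_mx.
  by move/eq_block_mx => [_ _ _].
have [Q [d [uQ eQ]]] := IH C sC uC.
pose R : 'M_(1 + n) := block_mx 1%:M 0 0 Q.
have uR : R \in unitmx by rewrite /R unitmxE det_ublock det1 mul1r -unitmxE.
exists (R *m L *m P), (row_mx b%:M d); split; first by rewrite !unitmx_mul uP uL uR.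
rewrite !trmx_mul.
have -> : R *m L *m P *m A *m (P^T *m (L^T *m R^T)) = R *m (L *m B *m L^T) *m R^T.
  by rewrite defB !mulmxA.
rewrite eL /R tr_block_mx !mulmx_block !trmx0 trmx1 !mul1mx !mul0mx !mulmx1 !mulmx0 !addr0 !add0r.
rewrite eQ; transitivity (block_mx (diag_mx (b%:M : 'rV_1)) 0 0 (diag_mx d)); last by symmetry; exact: (diag_mx_row (b%:M : 'rV_1) d).
have -> : diag_mx (b%:M : 'rV_1) = b%:M by apply/matrixP => i k; rewrite !ord1 !mxE eqxx.
by rewrite mul0mx.
Qed.

End Diagonal.

(** * The local-global principle *)

Section DiagonalForm.
Variable F : fieldType.

Definition diag_seq n (d : 'rV[F]_n) : seq F := [seq d 0 i | i <- enum 'I_n].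

Lemma size_diag_seq n (d : 'rV[F]_n) : size (diag_seq d) = n.
Proof. by rewrite size_map size_enum_ord. Qed.

Lemma nth_diag_seq n (d : 'rV[F]_n) (i : 'I_n) : (diag_seq d)`_i = d 0 i.
Proof. by rewrite (nth_map i) ?size_enum_ord // nth_ord_enum. Qed.

Lemma isotropic_diag n (d : 'rV[F]_n) : isotropic (diag_mx d) <-> iso (diag_seq d).
Proof.
have sumE (x : nat -> F) : \sum_(i < size (diag_seq d)) (diag_seq d)`_i * x i ^+ 2 =
    \sum_(i < n) d 0 i * x i ^+ 2.
  rewrite -(big_mkord xpredT (fun i => (diag_seq d)`_i * x i ^+ 2)) size_diag_seq big_mkord.
  by apply: eq_bigr => i _; rewrite nth_diag_seq.
have qE (y : 'rV[F]_n) : y *m diag_mx d *m y^T = (\sum_(i < n) d 0 i * y 0 i ^+ 2)%:M.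
  apply/matrixP => i k; rewrite !ord1 !mxE eqxx mulr1n; apply: eq_bigr => l _.
  rewrite mul_mx_diag !mxE; ring.
split=> [[y y0 e]|[x [[i [hi xi]] e]]].
  have [i yi] : exists i, y 0 i != 0.
    apply: contrapT => h; case/eqP: y0; apply/rowP => i; rewrite mxE.
    by apply/eqP; apply: contraT => yi; case: h; exists i.
  pose x (k : nat) := if insub k is Some k' then y 0 k' else 0.
  have xE (k : 'I_n) : x k = y 0 k by rewrite /x valK.
  exists x; split; first by exists i; rewrite size_diag_seq ltn_ord xE.
  rewrite sumE; move: e; rewrite qE => /matrixP/(_ 0 0); rewrite !mxE eqxx mulr1n => e.
  by rewrite -[RHS]e; apply: eq_bigr => k _; rewrite xE.
move: hi; rewrite size_diag_seq => hi; exists (\row_(k < n) x k).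
  apply: contraNneq xi => /rowP/(_ (Ordinal hi)); rewrite !mxE => ->; exact: eqxx.
rewrite qE; move: e; rewrite sumE => e.
rewrite (eq_bigr (fun k : 'I_n => d 0 k * x k ^+ 2)) ?e ?raddf0 // => k _.
by rewrite mxE.
Qed.

Lemma isotropic_congr n (A P B : 'M[F]_n) : P \in unitmx -> P *m A *m P^T = B ->
  isotropic A <-> isotropic B.
Proof.
move=> uP <-; split=> [[x x0 e]|[x x0 e]].
  exists (x *m invmx P).
    by apply: contraNneq x0 => h; rewrite -[x](mulmxKV uP) h mul0mx.
  rewrite trmx_mul trmx_inv !mulmxA mulmxKV // -[_ *m P^T *m _]mulmxA mulmxV ?unitmx_tr //.
  by rewrite mulmx1.
exists (x *m P); first by apply: contraNneq x0 => h; rewrite -[x](mulmxK uP) h mul0mx.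
by rewrite trmx_mul !mulmxA in e *.
Qed.

End DiagonalForm.

Lemma map_diag_seq (F K : fieldType) (j : {rmorphism F -> K}) n (d : 'rV[F]_n) :
  map j (diag_seq d) = diag_seq (map_mx j d).
Proof. by rewrite /diag_seq -map_comp; apply: eq_map => i /=; rewrite mxE. Qed.

Lemma diagonal_form (F : fieldType) n (A : 'M[F]_n) : 2%:R != 0 :> F -> regular_form A ->
  exists a : seq F, [/\ size a = n, all (predC1 0) a &
    forall (K : fieldType) (j : {rmorphism F -> K}), isotropic (map_mx j A) <-> iso (map j a)].
Proof.
move=> two [sA uA]; have [P [d [uP e]]] := diagonalize two sA uA.
exists (diag_seq d); split; first exact: size_diag_seq.
  have : diag_mx d \in unitmx by rewrite -e !unitmx_mul unitmx_tr uP uA.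
  rewrite unitmxE det_diag unitfE => /prodf_neq0 d0; apply/allP => x /mapP[i _ ->].
  exact: d0.
move=> K j; rewrite map_diag_seq; have uP' : map_mx j P \in unitmx by rewrite map_unitmx.
have e' : map_mx j P *m map_mx j A *m (map_mx j P)^T = diag_mx (map_mx j d).
  by rewrite map_trmx -!map_mxM e map_diag_mx.
split=> [/(isotropic_congr uP' e')/isotropic_diag //|/isotropic_diag/(isotropic_congr uP' e')//].
Qed.

Section LocalGlobal.
Variables (E F : fieldType) (emb : {rmorphism {poly E} -> F}).
Hypotheses (frF : fraction_field emb) (two : 2%:R != 0 :> E).
Hypothesis pac : pseudo_algebraically_closed E.
Let emb0 g : (emb g == 0) = (g == 0) := emb_eq0 frF g.

Lemma iso_of_size_gt4 (a : seq F) : all (predC1 0) a -> (4 < size a)%N -> iso a.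
Proof.
case: a => [|a1 [|a2 [|a3 [|a4 [|a5 a]]]]] //= /and5P[a10 a20 a30 a40 /andP[a50 _]] _.
apply: (@iso_subseq _ [:: a1; a2; a3; a4; a5]); first by rewrite /= !eqxx sub0seq.
exact: (quinary_isotropic frF two pac).
Qed.

(** -ab is a square locally everywhere: its square-free part has even order at all primes,
    so it is a constant, and a square since it is one in the residue field at X = 0. *)
Lemma binary_local_global (a b : F) : a != 0 -> b != 0 ->
  (forall v, trivial_on_constants emb v -> locally_isotropic v [:: a; b]) -> iso [:: a; b].
Proof.
move=> a0 b0 loc.
have [|m [sm [k [k0 em]]]] := @square_free_class _ _ _ frF (- (a * b)).
  by rewrite oppr_eq0 mulf_neq0.
have m0 := square_free_neq0 sm.
have local_square v : trivial_on_constants emb v ->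
    exists (K : fieldType) (w : K -> int) (iota : {rmorphism F -> K}),
    is_completion v w iota /\ exists2 y, y != 0 & y ^+ 2 = iota (emb m).
  move=> tv; have [|K [w [iota [comp h]]]] := locally_isotropic_completion frF two tv _ (loc v tv).
    by rewrite /= a0 b0.
  exists K, w, iota; split=> //.
  move: h => /= /iso2P[x [y [nz e]]].
  have [a0' b0'] : iota a != 0 /\ iota b != 0 by rewrite !fmorph_eq0.
  have x0 : x != 0.
    apply/eqP => x0; move: e nz; rewrite x0 eqxx expr0n mulr0 add0r /= => /eqP.
    by rewrite mulf_eq0 (negPf b0') expf_eq0 /= => /eqP ->; rewrite eqxx.
  have y0 : y != 0.
    apply/eqP => y0; move/eqP: e; rewrite y0 expr0n mulr0 addr0.
    by rewrite mulf_eq0 (negPf a0') expf_eq0 (negPf x0).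
  exists (iota b * y / (x * iota k)); first by rewrite !mulf_neq0 ?invr_eq0 ?mulf_neq0 ?fmorph_eq0.
  have e2 : iota (emb m) * iota k ^+ 2 = - (iota a * iota b).
    by rewrite -rmorphXn -rmorphM -em rmorphN rmorphM.
  have ik0 : iota k != 0 by rewrite fmorph_eq0.
  apply: (mulIf (expf_neq0 2 ik0)); rewrite e2; apply: (mulIf (expf_neq0 2 x0)).
  transitivity (iota b * (iota b * y ^+ 2)); first by field; rewrite x0 ik0.
  have -> : iota b * y ^+ 2 = - (iota a * x ^+ 2) by apply/eqP; rewrite -addr_eq0 addrC e.
  ring.
have [s1|s1] := ltnP 1 (size m).
  have [p [irr pm]] := irreducible_factor s1.
  have [v hv] := padic_exists frF irr; have [tv _ _] := hv.
  have [K [w [iota [[Hw vw _ _] [y y0 ey]]]]] := local_square v tv.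
  have [h eh] := dvdpP _ _ pm.
  have nph : ~~ (p %| h).
    by apply: contra (square_free_irreducible sm irr) => ph; rewrite eh expr2 dvdp_mul.
  have := congr1 w ey; rewrite (valX Hw) // vw ?emb0 // eh mulrC -[p]expr1.
  by rewrite (padic_val frF 1 hv irr nph); move: (w y); clear; lia.
have irrX : irreducible_poly ('X : {poly E}) by rewrite -['X]subr0 -polyC0; apply: irredp_XsubC.
have [v hv] := padic_exists frF irrX; have [tv _ _] := hv.
have [K [w [iota [[Hw vw dense _] [y y0 ey]]]]] := local_square v tv.
have em0 := size1_polyC s1; have c0 : m`_0 != 0 by rewrite -polyC_eq0 -em0.
have wy : w y = 0.
  have := congr1 w ey; rewrite (valX Hw) // vw ?emb0 // em0 (tv.2 _ c0).
  by move: (w y); clear; lia.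
have [x hx] := dense 1 y.
have vx : val_ge v 0 x.
  rewrite -(val_ge_iota vw) -[iota x](subrK y); apply: (val_geD Hw); last by rewrite val_ge_neq0 ?wy.
  by rewrite (val_ge_sym Hw); apply: val_geW hx.
have [g hg] := padic_reduce frF irrX hv vx.
have hz : val_ge w 1 (y - iota (emb g)).
  rewrite -[y](subrK (iota x)) -addrA; apply: (val_geD Hw) => //.
  by rewrite -rmorphB (val_ge_iota vw).
have : 'X %| m - g ^+ 2.
  rewrite -(padic_dvd frF _ irrX hv) -(val_ge_iota vw) !rmorphB !rmorphXn /= -ey.
  have -> : y ^+ 2 - iota (emb g) ^+ 2 = (y - iota (emb g)) * (y + y - (y - iota (emb g))) by ring.
  rewrite -[1]addr0; apply: (val_geM Hw) => //; apply: (val_geB Hw); last exact: val_geW hz.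
  by apply: (val_geD Hw); rewrite val_ge_neq0 ?wy.
rewrite -['X]subr0 -polyC0 dvdp_XsubCl /root em0 !hornerE subr_eq0 => /eqP eg.
apply/iso2P; exists (emb (g.[0])%:P * k), a; rewrite a0 orbT; split=> //.
have -> : (emb (g.[0])%:P * k) ^+ 2 = - (a * b).
  by rewrite em em0 eg rmorphXn rmorphXn /= exprMn.
ring.
Qed.

Lemma diagonal_local_global (a : seq F) : all (predC1 0) a ->
  (forall v, trivial_on_constants emb v -> locally_isotropic v a) -> iso a.
Proof.
move=> a0 loc; have [|le] := ltnP 4 (size a); first exact: iso_of_size_gt4.
have irrX : irreducible_poly ('X : {poly E}) by rewrite -['X]subr0 -polyC0; apply: irredp_XsubC.
have [v [tv _ _]] := padic_exists frF irrX.
case: a a0 loc le => [|a1 [|a2 [|a3 [|a4 [|a5 a]]]]] //=.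
- by move=> _ /(_ v tv 0)[x [k []]].
- rewrite andbT => a10 /(_ v tv) loc _.
  have [|K [w [iota [_ [x [[[|i] [hi xi]] e]]]]]] := locally_isotropic_completion frF two tv _ loc.
  + by rewrite /= a10.
  + move: e; rewrite big_ord_recl big_ord0 addr0 => /eqP /=.
    by rewrite mulf_eq0 fmorph_eq0 (negPf a10) expf_eq0 /= (negPf xi).
  by [].
- by move=> /and3P[a10 a20 _] loc _; apply: binary_local_global.
- move=> /and4P[a10 a20 a30 _] loc _; apply: (legendre frF two (pac_conics pac two)) => //.
  by move=> p v' irr [tv' _ _]; apply: loc.
by move=> /and5P[a10 a20 a30 a40 _] loc _; apply: (quaternary_local_global frF two pac).
Qed.

Lemma local_global n (A : 'M[F]_n) : regular_form A ->
  (forall v, trivial_on_constants emb v ->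
   forall (K : fieldType) (w : K -> int) (iota : {rmorphism F -> K}),
     is_completion v w iota -> isotropic (map_mx iota A)) -> isotropic A.
Proof.
move=> regA loc; have [a [_ a0 h]] := diagonal_form (two_frac frF two) regA.
have hA : isotropic A <-> iso a.
  by have := h F idfun; rewrite map_mx_id_in ?map_id.
apply/hA/diagonal_local_global => // v tv.
have [K [w [iota comp]]] := completion_exists tv.1.
have [Hw vw dense _] := comp; apply: (iso_locally_isotropic vw Hw dense).
exact/h/(loc v tv K w).
Qed.

Lemma dimension_gt4_isotropic n (A : 'M[F]_n) : regular_form A -> (4 < n)%N -> isotropic A.
Proof.
move=> regA n4; have [a [sa a0 h]] := diagonal_form (two_frac frF two) regA.
have := h F idfun; rewrite map_mx_id_in ?map_id // => ->.
by apply: iso_of_size_gt4; rewrite ?sa.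
Qed.

End LocalGlobal.

(** * Norms of polynomials modulo f *)

Section Norms.
Variable E : fieldType.
Implicit Types f g a b : {poly E}.

Definition mul_matrix f a : 'M[E]_((size f).-1) :=
  \matrix_(i, j) ((a * 'X^i) %% f)`_j.

Lemma norm_modE f a : norm_mod f a = \det (mul_matrix f a).
Proof. by []. Qed.

Lemma mul_matrix_row f a (q : {poly E}) : (1 < size f)%N -> (size q < size f)%N ->
  forall j, (j < (size f).-1)%N ->
  ((a * q) %% f)`_j = \sum_(i < (size f).-1) q`_i * ((a * 'X^i) %% f)`_j.
Proof.
move=> sf sq j hj; have sq' : (size q <= (size f).-1)%N by case: (size f) sf sq.
have -> : q = \sum_(i < (size f).-1) q`_i *: 'X^i.
  rewrite -[LHS](@take_poly_id _ (size f).-1) // /take_poly poly_def.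
  by apply: eq_bigr.
have modp_sum n (G : 'I_n -> {poly E}) : (\sum_i G i) %% f = \sum_i (G i %% f).
  by elim/big_rec2: _ => [|i x y _ <-]; rewrite ?mod0p ?modpD.
rewrite mulr_sumr modp_sum coef_sum; apply: eq_bigr => i _.
rewrite -scalerAr modpZl coefZ; congr (_ * _).
rewrite coef_sum (bigD1 i) //= coefZ coefXn eqxx mulr1 big1 ?addr0 // => k ki.
by rewrite coefZ coefXn (inj_eq val_inj) eq_sym (negPf ki) mulr0.
Qed.

Lemma norm_mod_ext f a b : f %| a - b -> norm_mod f a = norm_mod f b.
Proof.
move=> ab; rewrite !norm_modE; congr (\det _); apply/matrixP => i j; rewrite !mxE.
have -> // : (a * 'X^i) %% f = (b * 'X^i) %% f.
apply/eqP; rewrite -subr_eq0 -modpN -modpD -mulrBl.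
by apply/eqP/modp_eq0P; rewrite dvdp_mulr.
Qed.

Lemma norm_modM f a b : (1 < size f)%N -> norm_mod f (a * b) = norm_mod f a * norm_mod f b.
Proof.
move=> sf; have f0 : f != 0 by rewrite -size_poly_gt0 (ltn_trans _ sf).
rewrite !norm_modE -det_mulmx; congr (\det _); apply/matrixP => i j; rewrite !mxE.
have -> : (a * b * 'X^i) %% f = (b * ((a * 'X^i) %% f)) %% f.
  by rewrite modp_mul mulrA [b * a]mulrC.
rewrite mul_matrix_row ?ltn_modp ?ltn_ord //.
by apply: eq_bigr => k _; rewrite !mxE.
Qed.

(** The matrix of multiplication by X is the companion matrix of f / lc f. *)
Lemma norm_mod_linear f t : (1 < size f)%N -> norm_mod f (t%:P - 'X) = f.[t] / lead_coef f.
Proof.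
move=> sf; have f0 : f != 0 by rewrite -size_poly_gt0 (ltn_trans _ sf).
have lc0 : lead_coef f != 0 by rewrite lead_coef_eq0.
pose f1 : {poly E} := (lead_coef f)^-1 *: f.
have mf1 : f1 \is monic by rewrite monicE lead_coefZ mulVf.
have s1 : size f1 = size f by rewrite size_scale ?invr_eq0.
have e1 : norm_mod f (t%:P - 'X) = norm_mod f1 (t%:P - 'X).
  rewrite /norm_mod s1; congr (\det _); apply/matrixP => i j; rewrite !mxE.
  by rewrite modpZr ?invr_eq0.
rewrite e1 mulrC -hornerZ -/f1 -[in RHS](companionmxK mf1) norm_modE.
rewrite /char_poly -horner_evalE -det_map_mx; congr (\det _); apply/matrixP => i j.
rewrite !mxE /= /horner_eval hornerD hornerN hornerC hornerMn hornerX.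
rewrite mulrBl modpD modpN coefB mul_polyC modpZl coefZ modp_small ?size_polyXn; last first.
  by move: (nat_of_ord i) (ltn_ord i); rewrite s1; case: (size f) sf.
rewrite coefXn [_ == i :> nat]eq_sym -val_eqE mulr_natr; congr (_ - _).
rewrite -exprS; case: eqP => [ei|/eqP ni].
  have n1 : i.+1 = (size f1).-1.
    by rewrite ei s1; case: (size f) sf => [|[]].
  have -> : ('X^(i.+1) : {poly E}) %% f1 = 'X^(i.+1) - f1.
    have lt : (size ('X^(i.+1) - f1 : {poly E})%R < size f1)%N.
      rewrite [X in (_ < X)%N](_ : _ = i.+2); last by rewrite n1 s1 prednK // (ltn_trans _ sf).
      rewrite ltnS; apply/leq_sizeP => k hk; rewrite coefB coefXn.
      case: eqP => [->|/eqP nk].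
        by rewrite n1 -lead_coefE (monicP mf1) subrr.
      rewrite nth_default ?subrr //.
      have : (i.+1 < k)%N by rewrite ltn_neqAle eq_sym nk.
      by move=> h; apply: leq_trans h; rewrite n1 s1 prednK // (ltn_trans _ sf).
    have {1}-> : 'X^(i.+1) = 1 * f1 + ('X^(i.+1) - f1) by rewrite mul1r addrC subrK.
    by rewrite modp_addl_mul_small.
  by rewrite coefB coefXn n1 ltn_eqF ?ltn_ord // sub0r.
rewrite modp_small; first by rewrite coefXn eq_sym.
rewrite size_polyXn; move: ni (ltn_ord i); move: (nat_of_ord i) => k.
by rewrite s1; move: (size f) sf; clear; lia.
Qed.

End Norms.

(** * Square reflexivity *)

Section SquareReflexive.
Variable E : fieldType.
Hypotheses (pac : pseudo_algebraically_closed E) (two : 2%:R != 0 :> E).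
Implicit Types f g a : {poly E}.

Lemma unit_modP f a : unit_mod f a <-> coprimep a f.
Proof.
split=> [[b /dvdpP[u e]]|/inverse_mod[b]]; last by exists b.
apply/Bezout_eq1_coprimepP; exists (b, - u) => /=.
by rewrite mulNr -e; ring.
Qed.

(** Take t - X in the class of a.  If N(a) is in the class of lc f, then f(t) =
    lc f N(t - X) is a square and g = t - X will do.  If N(a) is a square, multiplying a by
    a1 - X at a point a1 where f takes a nonzero square value leads to the first case. *)
Lemma square_reflexive_pac : square_reflexive E.
Proof.
move=> f sqf a /unit_modP cop [c c0 hN].
have f0 := square_free_neq0 sqf.
have [s1|s1] := leqP (size f) 1%N.
  have dvd1 g : f %| g.
    have f1 : f %= 1 by rewrite -size_poly_eq1 eqn_leq s1 size_poly_gt0.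
    by rewrite (eqp_dvdl _ f1) dvd1p.
  exists 1; split; first exact: coprime1p.
    by exists 1; [exists 1 | ]; exact: dvd1.
  by exists 1; [exists 1 | ]; exact: dvd1p.
have lc0 : lead_coef f != 0 by rewrite lead_coef_eq0.
have radf : radical f by apply: square_free_radical.
(* The zeros of h are points that t has to avoid. *)
have linear b h d : coprimep b f -> h != 0 -> d != 0 -> norm_mod f b = lead_coef f * d ^+ 2 ->
    exists t z s, [/\ f.[t] = s ^+ 2, s != 0, h.[t] != 0, coprimep z f & f %| (t%:P - 'X) - b * z ^+ 2].
  move=> copb h0 d0 eN; have [t [z [ft ht hz]]] := square_class_value pac two radf copb h0.
  have eft : f.[t] = (lead_coef f * d * norm_mod f z) ^+ 2.
    have := norm_mod_linear t s1; rewrite (norm_mod_ext hz) norm_modM // eN expr2 norm_modM // => e.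
    by rewrite -[LHS](divfK lc0) -e; ring.
  exists t, z, (lead_coef f * d * norm_mod f z); split=> //.
    by apply: contraNneq ft => e; rewrite eft e expr0n.
  have : coprimep (b * z ^+ 2) f.
    have : coprimep (t%:P - 'X) f by rewrite coprimep_linear.
    move/unit_modP => [u hu]; apply/unit_modP; exists u; rewrite /eq_mod.
    have -> : b * z ^+ 2 * u - 1 = ((t%:P - 'X) * u - 1) - u * (t%:P - 'X - b * z ^+ 2) by ring.
    by rewrite dvdp_sub // dvdp_mull.
  by rewrite coprimepMl expr2 coprimepMl => /and3P[].
have root_mod t s : f.[t] = s ^+ 2 -> (t%:P - 'X) %| f - s%:P ^+ 2.
  move=> e; have -> : t%:P - 'X = (-1) *: ('X - t%:P) by rewrite scaleN1r opprB.
  by rewrite dvdpZl ?oppr_eq0 ?oner_eq0 // dvdp_XsubCl /root !hornerE e subrr.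
case: hN => hN; last first.
  have [t [z [s [ft s0 _ copz hz]]]] := linear a 1 c cop (oner_neq0 _) c0 hN.
  exists (t%:P - 'X); split.
  - by rewrite coprimep_linear ft expf_neq0.
  - by exists z => //; apply/unit_modP.
  exists s%:P; last by rewrite /eq_mod mul1r; apply: root_mod.
  by apply/unit_modP; rewrite coprimep_sym coprimep_linear hornerC.
have [a1 [y [fa1 ey]]] := square_value pac two sqf s1 f0.
have y0 : y != 0 by apply: contraNneq fa1 => y0; rewrite ey y0 expr0n.
have copl : coprimep (a1%:P - 'X) f by rewrite coprimep_linear.
have X0 : 'X - a1%:P != 0 by rewrite polyXsubC_eq0.
have [|||t [z [s [ft s0 ta1 copz hz]]]] := linear (a * (a1%:P - 'X)) ('X - a1%:P) (c * y / lead_coef f) _ X0.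
- by rewrite coprimepMl cop.
- by rewrite !mulf_neq0 ?invr_eq0.
- by rewrite norm_modM // hN norm_mod_linear // ey; field.
have copt : coprimep (t%:P - 'X) (a1%:P - 'X).
  rewrite coprimep_linear !hornerE; move: ta1; rewrite !hornerE; apply: contra.
  by rewrite subr_eq0 eq_sym subr_eq0.
have [r [r1 r2]] := chinese_poly s%:P y%:P copt.
exists ((t%:P - 'X) * (a1%:P - 'X)); split.
- by rewrite coprimepMl copl coprimep_linear ft expf_neq0.
- exists ((a1%:P - 'X) * z); first by apply/unit_modP; rewrite coprimepMl copl.
  rewrite /eq_mod; have -> : (t%:P - 'X) * (a1%:P - 'X) - a * ((a1%:P - 'X) * z) ^+ 2 =
    (a1%:P - 'X) * ((t%:P - 'X) - a * (a1%:P - 'X) * z ^+ 2) by ring.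
  by rewrite dvdp_mull.
have step d x : d %| r - x%:P -> d %| f - x%:P ^+ 2 -> d %| f - 1 * r ^+ 2.
  move=> d1 d2; have -> : f - 1 * r ^+ 2 = (f - x%:P ^+ 2) - (r - x%:P) * (r + x%:P) by ring.
  by rewrite dvdp_sub // dvdp_mulr.
have rval b x : (b%:P - 'X) %| r - x%:P -> r.[b] = x.
  have -> : b%:P - 'X = (-1) *: ('X - b%:P) by rewrite scaleN1r opprB.
  rewrite dvdpZl ?oppr_eq0 ?oner_eq0 // dvdp_XsubCl /root !hornerE subr_eq0.
  by move/eqP.
exists r; last first.
  by rewrite /eq_mod Gauss_dvdp // (step _ s r1 (root_mod _ _ ft)) (step _ y r2 (root_mod _ _ ey)).
apply/unit_modP; rewrite coprimep_sym coprimepMl !coprimep_linear.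
by rewrite (rval _ _ r1) (rval _ _ r2) s0 y0.
Qed.

End SquareReflexive.

Theorem theorem8p7 (E : fieldType) (charE : 2%N \notin [pchar E])
    (pacE : pseudo_algebraically_closed E) :
  [/\ square_reflexive E,
      u_invariant_le {fraction {poly E}} 4
    & local_global_isotropy E].
Proof.
have two : 2%:R != 0 :> E by apply: contraNneq charE => e; rewrite inE /= e eqxx.
have frF := tofrac_fraction_field {poly E}.
split; first exact: square_reflexive_pac.
  move=> n A regA aniso; rewrite leqNgt; apply/negP => n4; apply: aniso.
  exact: dimension_gt4_isotropic frF two pacE n A regA n4.
move=> n A regA aniso; apply: contrapT => h; apply: aniso.
apply: (local_global frF two pacE regA) => v omega K w iota comp.
apply: contrapT => aniso; apply: h; exists v; first exact: omega.
by exists K, w, iota.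
Qed.
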